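(* Assume that the conductances $\omega$ satisfy $\sup_{x\in\mathbb{Z}^d}\langle x\rangle^{-2}\sum_{y\sim x}\omega(x,y)<\infty$. Suppose there is a probability measure $\varrho$ on $\mathcal{S}'$ such that (1) there is some $T>0$ with $\varrho\circ(P^\omega_T)^{-1}=\varrho$ but $\varrho(\{\xi\in\mathcal{S}':P^\omega_T\xi=\xi\})<1$, (2) the moment condition $$\varrho\big[\|\xi\|_{H_{-N}}^2\big]=\sum_x\langle x\rangle^{-2N}\varrho\big[|\xi(x)|^2\big]<\infty$$ holds for some $N\ge0$. Then $\Delta_\omega$ has an eigenvalue in $i\mathbb{R}\setminus\{0\}$ with eigenvector $\psi=\xi+i\eta$ such that $\xi,\eta\in H_{-N}\subseteq\mathcal{S}'$. The converse holds too: if $\Delta_\omega$ has an eigenvalue in $i\mathbb{R}\setminus\{0\}$ with an eigenvector $\psi=\xi+i\eta$ such that $\xi,\eta\in H_{-N}$ for some $N\ge0$, then there is a probability measure $\varrho$ on $\mathcal{S}'$ satisfying (1) and (2); in fact $\varrho$ can be chosen to be stationary with respect to $(P^\omega_t)_{t\ge0}$ (i.e. $\varrho\circ(P^\omega_t)^{-1}=\varrho$ for all $t\geq 0$) and with $$\varrho(\{\xi\in\mathcal{S}':P^\omega_t\xi=\xi\ \ \forall t\ge0\})=0 .$$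
   Context: Let $d\ge1$; $x\sim y$ means that $x,y\in\mathbb{Z}^d$ are nearest neighbours. The conductances $\omega=(\omega(x,y))_{x,y\in\mathbb{Z}^d}$ are non-negative, symmetric and vanish unless $x\sim y$. Standing assumption: the graph on $\mathbb{Z}^d$ whose edges are the pairs $\{x,y\}$ with $\omega(x,y)>0$ has exactly one infinite connected component, denoted $\mathcal{C}(\omega)$. The Laplacian acts on (real- or complex-valued) functions on $\mathcal{C}(\omega)$ by $(\Delta_\omega u)(x)=\sum_{y\sim x}\omega(x,y)[u(x)-u(y)]$; an eigenvector for $\lambda\in\mathbb{C}$ is a non-zero $\psi$ with $\Delta_\omega\psi=\lambda\psi$ pointwise. The variable speed random walk is the continuous-time Markov chain $(X_t)_{t\geq 0}$ on $\mathcal{C}(\omega)$ with generator $-\Delta_\omega$; it is non-explosive under the growth assumption, and $p_t^\omega(x,y)=\mathbf{P}_x^\omega[X_t=y]$. Write $\langle x\rangle=(1+|x|^2)^{1/2}$. For $N\ge0$, $H_{-N}$ is the space of $f:\mathcal{C}(\omega)\to\mathbb{R}$ with $\|f\|^2_{H_{-N}}=\sum_x\langle x\rangle^{-2N}|f(x)|^2<\infty$; $\mathcal{S}'=\bigcup_{N\ge0}H_{-N}$. The semigroup acts on $\mathcal{S}'$ by $(P^\omega_t\xi)(x)=\sum_yp^\omega_t(x,y)\xi(y)$. The notation $\varrho[F(\xi)]$ means $\int_{\mathcal{S}'}F(\xi)\,\varrho(d\xi)$. *)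

(* Defs.v *)
From HB Require Import structures.
From mathcomp Require Import all_boot all_order all_algebra.
From mathcomp Require Import all_classical all_reals all_analysis.
From mathcomp Require Import complex.

Set Implicit Arguments.
Unset Strict Implicit.
Unset Printing Implicit Defensive.

Import Order.TTheory GRing.Theory Num.Theory.
Import numFieldNormedType.Exports.

Local Open Scope classical_set_scope.
Local Open Scope ring_scope.

Notation Zd d := 'rV[int]_d.

Definition sqnorm (d : nat) (x : Zd d) : int := \sum_(i < d) x ord0 i ^+ 2.

Definition neighbour (d : nat) (x y : Zd d) : bool := sqnorm (x - y) == 1.

Definition japanese (R : realType) (d : nat) (x : Zd d) : R :=
  Num.sqrt (1 + (sqnorm x)%:~R).

Section Conductances.
Variables (R : realType) (d : nat).
Implicit Types (w : Zd d -> Zd d -> R) (C : set (Zd d)).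

Record conductances w : Prop := Conductances {
  conductance_ge0 : forall x y, 0 <= w x y;
  conductance_sym : forall x y, w x y = w y x;
  conductance_nn : forall x y, ~~ neighbour x y -> w x y = 0
}.

Definition connected_by w (x y : Zd d) : Prop :=
  exists2 s : seq (Zd d), path (fun a b => 0 < w a b) x s & last x s = y.

Definition infinite_component w C : Prop :=
  (exists x, C = [set y | connected_by w x y]) /\ infinite_set C.

Definition quadratic_growth w : Prop :=
  (ereal_sup (range (fun x : Zd d =>
     (japanese R x ^- 2 * \sum_(y \in [set y | neighbour x y]) w x y)%:E))
   < +oo)%E.

End Conductances.

(* The conductances take values in the ring in which [u] does, so that the same
   operator acts on real- and on complex-valued functions.  A conductance
   between a point of [C] and a point outside [C] is zero when [C] is a
   component, so only neighbours in [C] are summed over. *)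
Definition laplacian (K : nzRingType) (d : nat) (C : set (Zd d))
    (w : Zd d -> Zd d -> K) (u : C -> K) (x : C) : K :=
  \sum_(y \in [set y : C | neighbour (val x) (val y)])
    w (val x) (val y) * (u x - u y).

Definition eigenvector (R : realType) (d : nat) (C : set (Zd d))
    (w : Zd d -> Zd d -> R) (lam : R[i]) (psi : C -> R[i]) : Prop :=
  (exists x, psi x != 0) /\
  forall x, laplacian (fun a b => (w a b)%:C%C) psi x = lam * psi x.

Section Walk.
Variables (R : realType) (d : nat) (C : set (Zd d)).
Variables (dO : measure_display) (Omega : measurableType dO).
Variables (P : C -> probability Omega R) (X : R -> Omega -> C).

Definition at_time (t : R) (y : C) : set Omega := [set o | X t o = y].

Definition transition (t : R) (x y : C) : R := fine (P x (at_time t y)).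

(* [X], under the laws [P x], is a (non-explosive, right-continuous,
   time-homogeneous) Markov chain on [C] with generator [- laplacian w].  Only
   the times [t >= 0] are constrained. *)
Record is_vsrw (w : Zd d -> Zd d -> R) : Prop := IsVSRW {
  vsrw_measurable : forall (t : R) (y : C), 0 <= t -> measurable (at_time t y);
  vsrw_right_continuous : forall (o : Omega) (t : R), 0 <= t ->
    \forall s \near t^'+, X s o = X t o;
  vsrw_start : forall x, P x (at_time 0 x) = 1%E;
  vsrw_markov : forall (x : C) (past : seq (R * C)) (s t : R) (y z : C),
    (forall q : R * C, q \in past -> 0 <= q.1 <= s) -> 0 <= s -> 0 <= t ->
    let past_event := [set o | forall q : R * C, q \in past -> X q.1 o = q.2] in
    P x (past_event `&` at_time s y `&` at_time (s + t) z) =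
    (P x (past_event `&` at_time s y) * P y (at_time t z))%E;
  vsrw_generator : forall x y,
    h^-1 * (transition h x y - (x == y)%:R) @[h --> 0^'+] -->
      - laplacian w (fun z => (z == y)%:R) x
}.

(* The sum of an absolutely convergent family of reals. *)
Definition real_sum (f : C -> R) : R :=
  fine ((\esum_(y in setT) (EFin \o f)^\+ y) -
        (\esum_(y in setT) (EFin \o f)^\- y))%E.

Definition semigroup (t : R) (xi : C -> R) (x : C) : R :=
  real_sum (fun y => transition t x y * xi y).

End Walk.

Section Distributions.
Variables (R : realType) (d : nat) (C : set (Zd d)).

(* The square of the norm of [H_{-N}], infinite off [H_{-N}]. *)
Definition sqnormH (N : R) (f : C -> R) : \bar R :=
  (\esum_(x in setT) (japanese R (val x) `^ (- 2 * N) * `|f x| ^+ 2)%:E)%E.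

Definition in_H (N : R) (f : C -> R) : Prop := (sqnormH N f < +oo)%E.

Definition tempered : set (C -> R) := [set f | exists2 N, 0 <= N & in_H N f].

Lemma tempered0 : ((fun=> 0) : C -> R) \in tempered.
Proof.
rewrite inE; exists 0 => //; rewrite /in_H /sqnormH esum1 ?ltry // => x _.
by rewrite normr0 expr0n mulr0.
Qed.

Definition Sprime0 : Type := tempered.

HB.instance Definition _ := Choice.on Sprime0.
HB.instance Definition _ := isPointed.Build Sprime0 (exist (fun f : C -> R => f \in tempered) _ tempered0).

Definition cylinders : set (set Sprime0) :=
  [set A | exists (x : C) (B : set R),
     measurable B /\ A = [set xi | B (sval xi x)]].

End Distributions.

(* [S'] with the sigma-algebra generated by the evaluations [xi |-> xi x]. *)
Notation Sprime R C := (g_sigma_algebraType (@cylinders R _ C)).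

Definition eval_Sprime (R : realType) (d : nat) (C : set (Zd d))
  (xi : Sprime R C) : C -> R := sval xi.

Section Stationarity.
Variables (R : realType) (d : nat) (C : set (Zd d)).
Variables (dO : measure_display) (Omega : measurableType dO).
Variables (P : C -> probability Omega R) (X : R -> Omega -> C).
Variable rho : probability (Sprime R C) R.

(* [{xi | P_t xi \in A}]; written so that it makes sense for a set [A] of
   elements of [S'] without a proof that [P_t] maps [S'] to itself. *)
Definition semigroup_preimage (t : R) (A : set (Sprime R C)) : set (Sprime R C) :=
  [set xi | exists2 xi', A xi' & eval_Sprime xi' = semigroup P X t (eval_Sprime xi)].

Definition invariant_at (t : R) : Prop :=
  forall A, measurable A -> rho (semigroup_preimage t A) = rho A.

Definition fixed_at (t : R) : set (Sprime R C) :=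
  [set xi | semigroup P X t (eval_Sprime xi) = eval_Sprime xi].

Definition moment_condition (N : R) : Prop :=
  (\int[rho]_xi sqnormH N (eval_Sprime xi) < +oo)%E.

End Stationarity.

Definition has_imaginary_eigenvalue (R : realType) (d : nat) (C : set (Zd d))
    (w : Zd d -> Zd d -> R) (N : R) : Prop :=
  exists lam : R[i], [/\ complex.Re lam = 0, lam != 0 &
    exists xi eta : C -> R,
      [/\ in_H N xi, in_H N eta &
          eigenvector w lam (fun x => (xi x +i* eta x)%C)]].

(* Main.v *)
(* An energy estimate with slowly varying weights shows that [P_t] has norm at
   most [exp (c t)] on [H_{-N}]; the quadratic growth of the conductances is
   exactly what the slow variation of the weights [<x>^-N] absorbs.  It follows
   that [P_h f = f - h Delta f + O(h^2)] at every point, with an error controlled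
   by the norm of [f].

   Given [rho], let [h = T / n], [Q = n^4] and [f_k = P_{kh} xi].  For a [Q]-th
   root of unity [mu], the sum [g = \sum_(k < Q) mu^k f_k] satisfies
   [P_h g = mu^-1 (g + f_Q - f_0)], so that it is nearly an eigenvector of [Delta]
   for [lam = (1 - mu^-1) / h].  Since [f_(k + n) = P_T f_k], Parseval's identity
   at a point [x0] reads, up to boundary terms,
   [\sum_mu |1 - mu^n|^2 |g(x0)|^2 = Q \sum_k |P_T f_k(x0) - f_k(x0)|^2].  The
   expectation of the right-hand side is of order [Q^2] because [rho] is not
   carried by the fixed points of [P_T], and [\sum_mu |g|^2 = Q \sum_k |f_k|^2] in
   [H_{-N}] has expectation [O(Q^2)].  Hence [|1 - mu^n| |g(x0)|] dominates a fixed
   multiple of the norm of [g] for some [xi] and some [mu].  Normalised by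
   [g(x0) = 1], these functions are bounded in [H_{-N}] while [lam] stays away from
   [0], and [|1 - h lam| = 1] forces [Re lam = h |lam|^2 / 2 -> 0]: an ultralimit
   as [n] tends to infinity is the required eigenvector.

   Conversely, [Delta psi = i om psi] implies [P_t psi = exp (- i om t) psi], so that
   the law of [cos a xi + sin a eta] with [a] uniform on the circle is invariant. *)
Require Import Defs.
From HB Require Import structures.
From mathcomp Require Import all_boot all_order all_algebra finmap.
From mathcomp Require Import cyclic separable cyclotomic.
From mathcomp Require Import all_classical all_reals all_analysis measurable_realfun.
From mathcomp Require Import complex ring lra zify.

Set Implicit Arguments.
Unset Strict Implicit.
Unset Printing Implicit Defensive.

Import Order.TTheory GRing.Theory Num.Theory.
Import numFieldNormedType.Exports Normc.

Local Open Scope classical_set_scope.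
Local Open Scope ring_scope.

(** * Unordered sums *)

(** An eigenvector of [P_T] alone would not do: [h] must shrink for [(1 - P_h) / h] to approach
    [Delta], yet invariance is known at multiples of [T] only. With [h = T / n] the times [k h]
    reduce modulo [T] to times in [[0, T]], over which squared norms grow at most by a factor
    [exp (c T)], and the final time [Q h = n^3 T] is again a multiple of [T]. So the boundary term
    [f_Q - f_0] has bounded second moment, and the frequency selection can carry [Q] times its
    squared norm along. Relative to [g(x0)] this term is then [O(Q^(-1/2)) = O(n^-2)], hence
    [O(1/n)] after division by [h], like the error of the expansion: this fixes the exponent 4.
    [Delta] need not be symmetric for the weighted norms, and the positivity of [P_t] does the work
    of a spectral decomposition: estimates are shown for bounded nonnegative functions, extended to
    nonnegative ones by truncation, and to all functions by domination or by splitting into positive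
    and negative parts. *)

Lemma ge0_lty_ex (R : realType) (x : \bar R) : (0 <= x)%E -> (x < +oo)%E ->
  exists2 r : R, 0 <= r & x = r%:E.
Proof. by case: x => [r| |]// x0 _; exists r. Qed.

Section EsumComplements.
Variables (R : realType) (T : choiceType).
Implicit Types a b : T -> \bar R.

Local Notation S a := (\esum_(x in [set: T]) a x)%E.

Lemma esum_le_ub a (B : \bar R) :
  (forall F : {fset T}, \sum_(x <- F) a x <= B)%E -> (S a <= B)%E.
Proof.
move=> aB; apply: ge_ereal_sup => _ [F [finF _] <-].
by rewrite fsbig_finite.
Qed.

Lemma le_fset_esum a (F : {fset T}) : (\sum_(x <- F) a x <= S a)%E.
Proof.
apply: esum_ge; exists [set` F]; first by split.
by rewrite fsbig_finite// set_fsetK.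
Qed.

Lemma le_esum_term a x : (a x <= S a)%E.
Proof.
by have := le_fset_esum a [fset x]%fset; rewrite big_seq_fset1.
Qed.

Lemma esum_ge0T a : (forall x, 0 <= a x)%E -> (0 <= S a)%E.
Proof. by move=> a0; apply: esum_ge0. Qed.

(** The inequality [le], valid for every constant, yields the reverse one when applied to [c^-1]. *)
Lemma esumZl (c : R) a : 0 <= c -> (forall x, 0 <= a x)%E ->
  (S (fun x => c%:E * a x) = c%:E * S a)%E.
Proof.
have le (k : R) b : 0 <= k -> (forall x, 0 <= b x)%E ->
    (S (fun x => k%:E * b x) <= k%:E * S b)%E.
  move=> k0 b0; apply: esum_le_ub => F.
  by rewrite -ge0_sume_distrr// lee_pmul ?lee_fin ?sume_ge0 ?le_fset_esum.
move=> c0 a0; apply/eqP; rewrite eq_le le//=.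
have [->|cn0] := eqVneq c 0.
  by rewrite mul0e esum_ge0// => x _; rewrite mul0e.
have {cn0}c0 : 0 < c by rewrite lt_neqAle eq_sym cn0.
have ca0 x : (0 <= c%:E * a x)%E by rewrite mule_ge0// lee_fin ltW.
have := le c^-1 _ _ ca0; rewrite invr_ge0 (ltW c0) => /(_ isT) h.
rewrite -[leRHS]mul1e -(@mulfV _ c) ?gt_eqF// EFinM -muleA.
rewrite lee_pmul2l// (le_trans _ h)//; apply: le_esum => x _.
by rewrite muleA -EFinM mulVf ?gt_eqF// mul1e.
Qed.

Lemma esum_fsupp a (r : seq T) : uniq r -> (forall x, 0 <= a x)%E ->
  (forall x, x \notin r -> a x = 0%E) -> S a = (\sum_(x <- r) a x)%E.
Proof.
move=> ur a0 ar.
rewrite (esumID [set` r])// [X in (_ + X)%E]esum1 ?adde0; last first.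
  by move=> x [_ /= /negP]; exact: ar.
by rewrite setTI esum_fset//; rewrite -fsbig_seq.
Qed.

(** Stated for all finite sets above [F], so that the sets belonging to finitely many families can
    be merged into their union. *)
Lemma esum_approx a (e : R) : (forall x, 0 <= a x)%E -> (S a < +oo)%E -> 0 < e ->
  exists F : {fset T}, forall G : {fset T}, (F `<=` G)%fset ->
    (S a <= \sum_(x <- G) a x + e%:E)%E.
Proof.
move=> a0 afin e0.
have Sfin : S a \is a fin_num by rewrite ge0_fin_numE// esum_ge0T.
have [_ [F [finF _] <-]] := ub_ereal_sup_adherent e0 Sfin.
rewrite -/(S a) => lt; exists (fset_set F) => G FG.
rewrite -leeBlDr//; apply/ltW/(lt_le_trans lt).
rewrite fsbig_finite//.
have -> : (\sum_(x <- fset_set F) a x =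
           \sum_(x <- G | x \in fset_set F) a x)%E.
  rewrite [RHS]big_fset_condE/=.
  congr (\big[_/_]_(i <- enum_fset _) _); apply/fsetP => x; rewrite !inE.
  by apply/idP/andP => [xF|[]//]; split=> //; move/fsubsetP: FG; apply.
rewrite big_mkcond/=; apply: lee_sum => x _; case: ifP => // _; exact: a0.
Qed.

Lemma esum_approx_seq (I : eqType) (r : seq I) (a : I -> T -> \bar R) (e : R) :
  (forall i x, 0 <= a i x)%E -> (forall i, S (a i) < +oo)%E -> 0 < e ->
  exists F : {fset T}, forall G : {fset T}, (F `<=` G)%fset -> forall i, i \in r ->
    (S (a i) <= \sum_(x <- G) a i x + e%:E)%E.
Proof.
move=> a0 afin e0; elim: r => [|i r [F HF]]; first by exists fset0.
have [F' HF'] := esum_approx (a0 i) (afin i) e0.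
exists (F `|` F')%fset => G; rewrite fsubUset => /andP[FG F'G] j.
by rewrite inE => /predU1P[->|/HF]; [exact: HF'|exact].
Qed.

End EsumComplements.

Lemma esum_swap (R : realType) (T U : choiceType) (a : T -> U -> \bar R) :
  (forall x y, 0 <= a x y)%E ->
  (\esum_(x in [set: T]) \esum_(y in [set: U]) a x y =
   \esum_(y in [set: U]) \esum_(x in [set: T]) a x y)%E.
Proof.
move=> a0; rewrite !esum_esum//.
apply: (@reindex_esum R _ _ _ _ (fun p : U * T => (p.2, p.1)) (fun p => a p.1 p.2)).
by split => [[]//|[x y] [x' y'] _ _ [-> ->]//|[x y] _]; exists (y, x).
Qed.

(** * Sums of absolutely summable real families *)

Section RealSum.
Variables (R : realType) (d : nat) (C : set (Zd d)).
Implicit Types f g : C -> R.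

Local Notation S a := (\esum_(x in [set: C]) a x)%E.

Definition abs_summable f := (S (fun x => `|f x|%:E) < +oo)%E.

Lemma abs_summableW f g : (forall x, `|f x| <= `|g x|) ->
  abs_summable g -> abs_summable f.
Proof.
move=> fg; apply: le_lt_trans; apply: le_esum => x _; by rewrite lee_fin.
Qed.

Lemma abs_summableD f g : abs_summable f -> abs_summable g ->
  abs_summable (fun x => f x + g x).
Proof.
rewrite /abs_summable => sf sg; apply: le_lt_trans (lte_add_pinfty sf sg).
rewrite -esumD//.
by apply: le_esum => x _; rewrite -EFinD lee_fin ler_normD.
Qed.

Lemma abs_summableZ (c : R) f : abs_summable f -> abs_summable (fun x => c * f x).
Proof.
rewrite /abs_summable => sf.
under eq_esum do rewrite normrM EFinM.
rewrite esumZl// lte_mul_pinfty//.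
Qed.

Lemma ge0_real_sum f : (forall x, 0 <= f x) -> real_sum f = fine (S (fun x => (f x)%:E)).
Proof.
move=> f0; rewrite /real_sum [X in (_ - X)%E]esum1 ?sube0; last first.
  by move=> x _; rewrite funenegE /= max_r// lee_fin oppr_le0.
congr fine; apply: eq_esum => x _; by rewrite funeposE /= max_l// lee_fin.
Qed.

Lemma ge0_real_sumE f : (forall x, 0 <= f x) -> abs_summable f ->
  (real_sum f)%:E = S (fun x => (f x)%:E).
Proof.
move=> f0 sf; rewrite ge0_real_sum// fineK// ge0_fin_numE.
  apply: le_lt_trans sf; apply: le_esum => x _; rewrite lee_fin ler_norm//.
by apply: esum_ge0T => x; rewrite lee_fin.
Qed.

Lemma real_sumBE f g : (forall x, 0 <= f x) -> (forall x, 0 <= g x) ->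
  abs_summable f -> abs_summable g ->
  real_sum (fun x => f x - g x) = real_sum f - real_sum g.
Proof.
move=> f0 g0 sf sg.
have h : ((real_sum f - real_sum g)%:E =
  S ((fun x => (f x)%:E) \- (fun x => (g x)%:E))^\+%E
  - S ((fun x => (f x)%:E) \- (fun x => (g x)%:E))^\-%E)%E.
  rewrite esumB//; last 2 first.
  - by move=> x _; rewrite lee_fin.
  - by move=> x _; rewrite lee_fin.
  by rewrite EFinB !ge0_real_sumE.
by rewrite /real_sum -[RHS]/(fine (_)%:E) h.
Qed.

Lemma abs_summable_pos f : abs_summable f -> abs_summable (fun x => Num.max (f x) 0).
Proof.
apply: abs_summableW => x; rewrite ger0_norm ?le_max ?lexx ?orbT//.
by rewrite ge_max ler_norm normr_ge0.
Qed.

Lemma abs_summable_neg f : abs_summable f -> abs_summable (fun x => Num.max (- f x) 0).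
Proof.
apply: abs_summableW => x; rewrite ger0_norm ?le_max ?lexx ?orbT//.
by rewrite ge_max -normrN ler_norm normr_ge0.
Qed.

Lemma posneg (x : R) : x = Num.max x 0 - Num.max (- x) 0.
Proof. by case: (leP x 0); case: (leP (- x) 0) => ? ?; lra. Qed.

Lemma real_sumE f : abs_summable f ->
  real_sum f = real_sum (fun x => Num.max (f x) 0) - real_sum (fun x => Num.max (- f x) 0).
Proof.
move=> sf; rewrite -real_sumBE.
- by congr real_sum; apply/funext => x; exact: posneg.
- by move=> x; rewrite le_max lexx orbT.
- by move=> x; rewrite le_max lexx orbT.
- exact: abs_summable_pos.
- exact: abs_summable_neg.
Qed.

Lemma ge0_real_sumD f g : (forall x, 0 <= f x) -> (forall x, 0 <= g x) ->
  abs_summable f -> abs_summable g ->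
  real_sum (fun x => f x + g x) = real_sum f + real_sum g.
Proof.
move=> f0 g0 sf sg; apply: EFin_inj.
rewrite EFinD !ge0_real_sumE//; last 2 first.
- by move=> x; rewrite addr_ge0.
- exact: abs_summableD.
by rewrite -esumD// => x _; rewrite lee_fin.
Qed.

(** [f + g] is the difference of [f^+ + g^+] and [f^- + g^-]. These need not be its positive and
    negative parts, whence the form of [real_sumBE], which takes any pair of nonnegative
    families. *)
Lemma real_sumD f g : abs_summable f -> abs_summable g ->
  real_sum (fun x => f x + g x) = real_sum f + real_sum g.
Proof.
move=> sf sg; rewrite (real_sumE sf) (real_sumE sg).
pose m h (x : C) : R := Num.max (h x) 0.
have m0 h x : 0 <= m h x by rewrite le_max lexx orbT.
pose n h (x : C) : R := Num.max (- h x) 0.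
have n0 h x : 0 <= n h x by rewrite le_max lexx orbT.
have ms h : abs_summable h -> abs_summable (m h) by exact: abs_summable_pos.
have ns h : abs_summable h -> abs_summable (n h) by exact: abs_summable_neg.
transitivity (real_sum (fun x => (m f x + m g x) - (n f x + n g x))).
  by congr real_sum; apply/funext => x; rewrite (posneg (f x)) (posneg (g x)) /m /n; ring.
rewrite real_sumBE; [| | |by apply: abs_summableD; [exact: ms|exact: ms]|
  by apply: abs_summableD; [exact: ns|exact: ns]];
  [|by move=> x; rewrite addr_ge0|by move=> x; rewrite addr_ge0].
rewrite !ge0_real_sumD//; [|exact: ns|exact: ns|exact: ms|exact: ms].
by rewrite /m /n; ring.
Qed.

Lemma real_sum0 : real_sum (fun _ : C => 0) = 0 :> R.
Proof. by rewrite ge0_real_sum// esum1. Qed.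

Lemma abs_summableN f : abs_summable f -> abs_summable (fun x => - f x).
Proof. by apply: abs_summableW => x; rewrite normrN. Qed.

Lemma real_sumN f : abs_summable f -> real_sum (fun x => - f x) = - real_sum f.
Proof.
move=> sf; apply/eqP; rewrite -addr_eq0 -real_sumD//; last exact: abs_summableN.
rewrite (_ : (fun x => _) = fun=> 0) ?real_sum0//.
by apply/funext => x; rewrite addNr.
Qed.

Lemma ge0_real_sumZ (c : R) f : 0 <= c -> (forall x, 0 <= f x) -> abs_summable f ->
  real_sum (fun x => c * f x) = c * real_sum f.
Proof.
move=> c0 f0 sf; apply: EFin_inj.
rewrite EFinM !ge0_real_sumE//; last 2 first.
- by move=> x; rewrite mulr_ge0.
- exact: abs_summableZ.
by rewrite -esumZl// => x; rewrite lee_fin.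
Qed.

Lemma real_sumZ (c : R) f : abs_summable f ->
  real_sum (fun x => c * f x) = c * real_sum f.
Proof.
move=> sf.
have pos (k : R) : 0 <= k -> real_sum (fun x => k * f x) = k * real_sum f.
  move=> k0; rewrite (real_sumE sf) mulrBr -!ge0_real_sumZ//;
    [|by move=> x; rewrite le_max lexx orbT|exact: abs_summable_neg|
      by move=> x; rewrite le_max lexx orbT|exact: abs_summable_pos].
  rewrite -real_sumBE.
  - by congr real_sum; apply/funext => x; rewrite {1}(posneg (f x)); ring.
  - by move=> x; rewrite mulr_ge0// le_max lexx orbT.
  - by move=> x; rewrite mulr_ge0// le_max lexx orbT.
  - by apply: abs_summableZ; exact: abs_summable_pos.
  - by apply: abs_summableZ; exact: abs_summable_neg.
have [c0|c0] := leP 0 c; first exact: pos.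
rewrite (_ : (fun x => _) = fun x => - ((- c) * f x)); last first.
  by apply/funext => x; rewrite mulNr opprK.
rewrite real_sumN; last exact: abs_summableZ.
by rewrite pos ?oppr_ge0 ?ltW// mulNr opprK.
Qed.

Lemma le_real_sum f g : (forall x, f x <= g x) -> abs_summable f -> abs_summable g ->
  real_sum f <= real_sum g.
Proof.
move=> fg sf sg; rewrite -subr_ge0 -real_sumN// -real_sumD//; last exact: abs_summableN.
rewrite ge0_real_sum; last by move=> x; rewrite subr_ge0.
by rewrite fine_ge0// esum_ge0// => x _; rewrite lee_fin subr_ge0.
Qed.

Lemma norm_abs_summable f : abs_summable f -> abs_summable (fun x => `|f x|).
Proof. by apply: abs_summableW => x; rewrite normr_id. Qed.

Lemma ler_norm_real_sum f : abs_summable f -> `|real_sum f| <= real_sum (fun x => `|f x|).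
Proof.
move=> sf; have sfa := norm_abs_summable sf.
rewrite ler_norml -real_sumN//; apply/andP; split; apply: le_real_sum => //.
- by move=> x; rewrite lerNl -normrN ler_norm.
- exact: abs_summableN.
- by move=> x; exact: ler_norm.
Qed.

Lemma abs_summable_fsupp f (r : seq C) : (forall x, x \notin r -> f x = 0) ->
  abs_summable f.
Proof.
move=> fr; rewrite /abs_summable (@esum_fsupp _ _ _ (undup r)) ?undup_uniq//.
- by rewrite sumEFin ltry.
- by move=> x; rewrite mem_undup => /fr ->; rewrite normr0.
Qed.

Lemma real_sum_fsupp f (r : seq C) : uniq r -> (forall x, x \notin r -> f x = 0) ->
  real_sum f = \sum_(x <- r) f x.
Proof.
move=> ur fr; have sf := abs_summable_fsupp fr.
have pos g : (forall x, 0 <= g x) -> (forall x, x \notin r -> g x = 0) ->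
    real_sum g = \sum_(x <- r) g x.
  move=> g0 gr; apply: EFin_inj; rewrite ge0_real_sumE ?(abs_summable_fsupp gr)//.
  by rewrite (esum_fsupp ur) ?sumEFin// => x xr; rewrite gr.
rewrite real_sumE// !pos.
- by rewrite -sumrB; apply: eq_bigr => x _; rewrite -posneg.
- by move=> x; rewrite le_max lexx orbT.
- by move=> x /fr ->; rewrite oppr0 maxxx.
- by move=> x; rewrite le_max lexx orbT.
- by move=> x /fr ->; rewrite maxxx.
Qed.

End RealSum.

(** * Weights on the lattice *)

Lemma le_sum_subset (R : realType) (T : choiceType) (F s : seq T) (g : T -> R) :
  uniq F -> uniq s -> (forall x, 0 <= g x) -> {subset F <= s} ->
  \sum_(x <- F) g x <= \sum_(x <- s) g x.
Proof.
move=> uF us g0 Fs.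
have p : perm_eq F [seq x <- s | x \in F].
  apply: uniq_perm; rewrite ?filter_uniq// => x.
  by rewrite mem_filter; case: (boolP (x \in F)) => //= /Fs ->.
rewrite (perm_big _ p)/= big_filter big_mkcond/=.
by apply: ler_sum => x _; case: ifP.
Qed.

Section Lattice.
Variables (R : realType) (d : nat).
Implicit Types x y : Zd d.

Local Notation jap := (@japanese R d).

Lemma sqnorm_ge0 x : 0 <= sqnorm x.
Proof. by apply: sumr_ge0 => i _; exact: sqr_ge0. Qed.

Lemma sqnormE x : (sqnorm x)%:~R = \sum_(i < d) (x ord0 i)%:~R ^+ 2 :> R.
Proof. by rewrite /sqnorm rmorph_sum; apply: eq_bigr => i _; rewrite rmorphXn. Qed.

Lemma sqr_japanese x : jap x ^+ 2 = 1 + (sqnorm x)%:~R.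
Proof. by rewrite sqr_sqrtr// addr_ge0// ler0z sqnorm_ge0. Qed.

Lemma japanese_ge1 x : 1 <= jap x.
Proof.
by rewrite -[leLHS]sqrtr1 ler_wsqrtr// lerDl ler0z sqnorm_ge0.
Qed.

Lemma japanese_gt0 x : 0 < jap x.
Proof. exact: lt_le_trans (japanese_ge1 x). Qed.

Lemma neighbour_sym x y : neighbour x y = neighbour y x.
Proof.
rewrite /neighbour; congr (_ == _); apply: eq_bigr => i _.
by rewrite !mxE; ring.
Qed.

Lemma japanese_neighbour x y : neighbour x y -> jap y <= jap x + 1.
Proof.
move=> /eqP/(congr1 (fun z : int => z%:~R : R)); rewrite sqnormE => xy.
have s0 := japanese_gt0 x; have s1 := japanese_ge1 x.
rewrite -(@ler_pXn2r _ 2)// ?nnegrE ?(ltW (japanese_gt0 y)) ?addr_ge0 ?(ltW s0)//.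
rewrite sqrrD expr1n mulr1 sqr_japanese sqnormE sqr_japanese.
have -> : \sum_(i < d) (y ord0 i)%:~R ^+ 2 = (sqnorm x)%:~R + 1 +
    \sum_(i < d) 2 * (x ord0 i)%:~R * ((y ord0 i)%:~R - (x ord0 i)%:~R) :> R.
  rewrite (_ : _ + 1 = (sqnorm x)%:~R + \sum_(i < d) ((x - y) ord0 i)%:~R ^+ 2); last by rewrite xy.
  rewrite sqnormE -!big_split/=.
  by apply: eq_bigr => i _; rewrite !mxE rmorphB/=; ring.
suff : \sum_(i < d) 2 * (x ord0 i)%:~R * ((y ord0 i)%:~R - (x ord0 i)%:~R)
    <= jap x *+ 2 by move: (jap x) => s; lra.
(* Cauchy-Schwarz in the form [2 a b <= a^2 / s + s b^2] with [s = <x>] *)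
apply: (@le_trans _ _ (\sum_(i < d) ((x ord0 i)%:~R ^+ 2 / jap x +
    jap x * ((y ord0 i)%:~R - (x ord0 i)%:~R) ^+ 2))).
  apply: ler_sum => i _; set a := (x ord0 i)%:~R; set b := _ - a.
  have : 0 <= (a - jap x * b) ^+ 2 / jap x by rewrite divr_ge0 ?sqr_ge0// ltW.
  rewrite (_ : _ / _ = a ^+ 2 / jap x + jap x * b ^+ 2 - 2 * a * b) ?subr_ge0//.
  by field; rewrite gt_eqF.
rewrite big_split/= -mulr_suml -mulr_sumr -sqnormE.
rewrite (_ : \sum_(i < d) _ ^+ 2 = 1) ?mulr1; last first.
  rewrite -[RHS](_ : 1%:~R = _)// -xy; apply: eq_bigr => i _.
  by rewrite !mxE rmorphB/=; ring.
rewrite mulr2n lerD2r ler_pdivrMr// -expr2 sqr_japanese; lra.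
Qed.

Lemma japanese_neighbour2 x y : neighbour x y -> jap y <= 2 * jap x.
Proof.
move=> /japanese_neighbour xy; apply: (le_trans xy).
by rewrite mulr_natl mulr2n lerD2l japanese_ge1.
Qed.

(** Coordinates of neighbours differ by at most 1, so the neighbours of [x] lie in a translate of
    the cube [{0, 1, 2}^d]. *)
Lemma finite_neighbours x : finite_set [set y | neighbour x y].
Proof.
pose f (v : 'rV['I_3]_d) : Zd d := \row_i (x ord0 i + (v ord0 i)%:Z - 1).
apply: (@sub_finite_set _ _ (f @` [set: 'rV['I_3]_d])); last first.
  by apply: finite_image; exact: finite_finset.
move=> y /= /eqP xy.
have bnd i : -1 <= y ord0 i - x ord0 i <= 1.
  have : (y ord0 i - x ord0 i) ^+ 2 <= 1.
    rewrite -xy /sqnorm (bigD1 i)//= !mxE -[leLHS]addr0 lerD//.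
      by rewrite -[leLHS]sqrrN opprB.
    by apply: sumr_ge0 => j _; exact: sqr_ge0.
  nia.
exists (\row_i inord (absz (y ord0 i - x ord0 i + 1))) => //.
apply/rowP => i; rewrite !mxE; have := bnd i; move: (y ord0 i) (x ord0 i) => a b ab.
have h : (absz (a - b + 1)%R < 3)%N by lia.
by rewrite inordK//; lia.
Qed.

(** The correction [2 / (n + 1)] makes the induction close: each new term is at most the telescoping
    difference [2 / (m + 1) - 2 / (m + 2)]. *)
Lemma sum_inv_sqr_le n : \sum_(j < n.+1) (1 + j%:R ^+ 2)^-1 <= 3 - 2 / n.+1%:R :> R.
Proof.
elim: n => [|n IH]; first by rewrite big_ord_recr big_ord0/= expr0n/= addr0 invr1; lra.
rewrite big_ord_recr/=.
have n0 : (0 : R) <= n%:R by rewrite ler0n.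
rewrite -(natr1 n.+1) -(natr1 n) in IH *.
set m : R := n%:R in n0 IH *.
have : (1 + (m + 1) ^+ 2)^-1 <= 2 / (m + 1) - 2 / (m + 1 + 1).
  rewrite -subr_ge0 (_ : _ - _ = (m ^+ 2 + m + 2) /
    ((m + 1) * (m + 1 + 1) * (1 + (m + 1) ^+ 2))).
    by rewrite divr_ge0 ?mulr_ge0//; nra.
  by field; rewrite !gt_eqF//; nra.
move: IH; lra.
Qed.

Lemma sum_inv_sqr_box n :
  \sum_(j < (n + n).+1) (1 + (j%:Z - n%:Z)%:~R ^+ 2)^-1 <= 6 :> R.
Proof.
have half k : \sum_(j < k) (1 + j%:R ^+ 2)^-1 <= 3 :> R.
  case: k => [|k]; first by rewrite big_ord0.
  by apply: (le_trans (sum_inv_sqr_le k)); rewrite gerBl divr_ge0.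
rewrite -(big_mkord xpredT (fun j => (1 + (j%:Z - n%:Z)%:~R ^+ 2)^-1)).
rewrite (@big_cat_nat _ _ _ n) //=; last by rewrite -addnS leq_addr.
rewrite [X in X + _]big_nat_rev/= [X in X + _]big_mkord.
rewrite -[X in \sum_(X <= i < _) _]add0n [X in _ + X]big_addn -addnS addKn [X in _ + X]big_mkord.
apply: (@le_trans _ _ (3 + 3)); last by lra.
apply: lerD; [apply: le_trans (half n)|apply: le_trans (half n.+1)];
  apply: ler_sum => j _.
  rewrite lef_pV2 ?posrE ?ltr_wpDr ?sqr_ge0// lerD2l.
  rewrite (_ : (_ - _)%:~R = - (j.+1%:R : R)); last first.
    rewrite (_ : (_ - _)%R = - (j.+1%:Z)) ?mulrNz//.
    by have := ltn_ord j; lia.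
  by rewrite sqrrN ler_pXn2r ?nnegrE// ler_nat.
by rewrite PoszD addrK.
Qed.

Lemma japanese_prod x : (jap x ^- (2 * d)) <= \prod_(i < d) (1 + (x ord0 i)%:~R ^+ 2)^-1.
Proof.
rewrite exprM -exprVn.
have -> : (jap x ^+ 2)^-1 ^+ d = \prod_(i < d) (jap x ^+ 2)^-1 by rewrite prodr_const card_ord.
apply: ler_prod => i _; rewrite invr_ge0 sqr_ge0/= lef_pV2 ?posrE ?exprn_gt0 ?japanese_gt0//.
  rewrite sqr_japanese lerD2l sqnormE (bigD1 i)//= lerDl.
  by apply: sumr_ge0 => j _; exact: sqr_ge0.
by rewrite ltr_wpDr ?sqr_ge0.
Qed.

(** [<x>^(-2d)] is at most the product of the factors [1 / (1 + x_i^2)], because each [1 + x_i^2] is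
    at most [<x>^2]. A finite set lies in a box, over which the sum of the products is the product
    of [d] one-dimensional sums, each at most 6. *)
Lemma summable_japanese :
  (\esum_(x in [set: Zd d]) (jap x ^- (2 * d))%:E <= (6 ^+ d)%:E)%E.
Proof.
apply: esum_le_ub => F; rewrite sumEFin lee_fin.
pose n := (\sum_(x <- F) \sum_(i < d) `|x ord0 i|)%N.
pose f (v : {ffun 'I_d -> 'I_(n + n).+1}) : Zd d := \row_i ((v i)%:Z - n%:Z).
have injf : injective f.
  move=> u v /rowP uv; apply/ffunP => i; apply/val_inj/eqP.
  by have := uv i; rewrite !mxE => /addIr [/eqP].
apply: (@le_trans _ _ (\sum_(x <- F) \prod_(i < d) (1 + (x ord0 i)%:~R ^+ 2)^-1)).
  by apply: ler_sum => x _; exact: japanese_prod.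
apply: (@le_trans _ _ (\sum_(x <- [seq f v | v <- enum {ffun 'I_d -> 'I_(n + n).+1}])
    \prod_(i < d) (1 + (x ord0 i)%:~R ^+ 2)^-1)).
  apply: le_sum_subset; first exact: fset_uniq.
    by rewrite map_inj_uniq// enum_uniq.
    by move=> x; apply: prodr_ge0 => i _; rewrite invr_ge0 addr_ge0 ?sqr_ge0.
  move=> x xF.
  have xn i : (`|x ord0 i| <= n)%N.
    rewrite /n (big_fsetD1 x)//= (bigD1 i)//= -addnA leq_addr//.
  apply/mapP; exists [ffun i => inord (absz (x ord0 i + n%:Z)%R)]; first by rewrite mem_enum.
  apply/rowP => i; rewrite mxE ffunE; have := xn i; move: (x ord0 i) n {f injf xn} => a n an.
  have h : (absz (a + n%:Z)%R < (n + n).+1)%N by lia.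
  by rewrite inordK//; lia.
rewrite big_map big_enum/=.
under eq_bigr do under eq_bigr do rewrite mxE.
rewrite -(bigA_distr_bigA (fun (i : 'I_d) (j : 'I_(n + n).+1) =>
  (1 + (j%:Z - n%:Z)%:~R ^+ 2)^-1)) prodr_const card_ord.
apply: lerXn2r; rewrite ?nnegrE ?sum_inv_sqr_box//.
by apply: sumr_ge0 => j _; rewrite invr_ge0 addr_ge0 ?sqr_ge0.
Qed.

End Lattice.

(** The relative change of the weight along an edge is [O(1 / <x>)]. Squared and summed against
    conductances of total size [O(<x>^2)], it stays bounded. *)
Definition slowly_varying (R : realType) (d : nat) (c : R) (phi : Zd d -> R) :=
  forall x y : Zd d, neighbour x y -> `|phi y - phi x| * japanese R x <= c * phi x.

(** * Slowly varying weights *)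

Section SlowVariation.
Variables (R : realType) (d : nat).
Implicit Types (x y : Zd d) (phi chi : Zd d -> R).
Local Notation jap := (@japanese R d).

(** The discrete product rule evaluates one factor at [y], where [chi y <= (1 + b) * chi x]; this
    produces [a * (1 + b)] besides [b]. *)
Lemma slowly_varyingM a b phi chi : 0 <= a -> 0 <= b ->
  (forall x, 0 <= phi x) -> (forall x, 0 <= chi x) ->
  slowly_varying a phi -> slowly_varying b chi ->
  slowly_varying (a * (1 + b) + b) (fun x => phi x * chi x).
Proof.
move=> a0 b0 p0 c0 sp sc x y xy.
have j1 := japanese_ge1 R x.
have sp' := sp _ _ xy; have sc' := sc _ _ xy.
have cy : chi y <= (1 + b) * chi x.
  have := ler_norm (chi y - chi x).
  have : 0 <= `|chi y - chi x| by [].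
  by move: sc'; move: `|_ - _| => t; nra.
have -> : phi y * chi y - phi x * chi x =
    (phi y - phi x) * chi y + phi x * (chi y - chi x) by ring.
apply: (@le_trans _ _ ((`|phi y - phi x| * chi y + phi x * `|chi y - chi x|) * jap x)).
  rewrite ler_wpM2r ?(le_trans _ j1)//; apply: (le_trans (ler_normD _ _)).
  by rewrite !normrM (ger0_norm (c0 _)) (ger0_norm (p0 _)).
rewrite mulrDl [leRHS]mulrDl; apply: lerD; last first.
  rewrite -mulrA [leRHS](_ : _ = phi x * (b * chi x)); last by ring.
  by rewrite ler_wpM2l.
rewrite mulrAC; apply: (@le_trans _ _ (a * phi x * chi y)); first by rewrite ler_wpM2r.
rewrite [leRHS](_ : _ = a * phi x * ((1 + b) * chi x)); last by ring.
by rewrite ler_wpM2l ?mulr_ge0.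
Qed.

(** The constant is independent of [e], which is what later allows the cut-off to be removed. With
    [a = <x>] and [b = <y>] it comes from [(a + b) * a <= 12 * b ^+ 2], a consequence of
    [a <= 2 * b]. *)
Lemma slowly_varying_inv (e : R) : 0 <= e ->
  slowly_varying 12 (fun x : Zd d => (1 + e * jap x ^+ 2)^-1).
Proof.
move=> e0 x y xy.
have := japanese_neighbour R xy; have := japanese_neighbour2 R xy.
rewrite neighbour_sym in xy.
have := japanese_neighbour R xy; have := japanese_neighbour2 R xy.
have := japanese_ge1 R x; have := japanese_ge1 R y.
move: (jap x) (jap y) => a b b1 a1 ab2 ab ba2 ba.
have pa : 0 < 1 + e * a ^+ 2 by rewrite ltr_wpDr// mulr_ge0// sqr_ge0.
have pb : 0 < 1 + e * b ^+ 2 by rewrite ltr_wpDr// mulr_ge0// sqr_ge0.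
have -> : (1 + e * b ^+ 2)^-1 - (1 + e * a ^+ 2)^-1 =
    e * ((a - b) * (a + b)) / (1 + e * b ^+ 2) / (1 + e * a ^+ 2).
  by field; rewrite !gt_eqF.
rewrite !normrM !normfV (ger0_norm e0) (gtr0_norm pa) (gtr0_norm pb).
rewrite (mulrAC _ _ a) ler_wpM2r ?invr_ge0 ?(ltW pa)//.
rewrite mulrAC ler_pdivrMr//.
have : `|a - b| <= 1 by rewrite ler_norml; lra.
have : 0 <= `|a - b| by [].
rewrite (ger0_norm (_ : 0 <= a + b)); last by lra.
move: `|a - b| => t t0 t1.
have h0 : (a + b) * a <= 12 * b ^+ 2 by nra.
have : t * ((a + b) * a) <= 12 * b ^+ 2.
  by rewrite (le_trans _ h0)// ler_piMl// mulr_ge0; lra.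
move=> h; have : e * (t * ((a + b) * a)) <= e * (12 * b ^+ 2) by rewrite ler_wpM2l.
set u := b ^+ 2; lra.
Qed.

(** Adding 1 to the constants turns the product rule into multiplication: [1 + (a * (1 + b) + b) =
    (1 + a) * (1 + b)]. *)
Lemma slowly_varyingX a phi k : 0 <= a -> (forall x, 0 <= phi x) ->
  slowly_varying a phi -> slowly_varying ((1 + a) ^+ k - 1) (fun x => phi x ^+ k).
Proof.
move=> a0 p0 sp; elim: k => [|k IH] x y xy; first by rewrite !expr0 !subrr normr0 !mul0r.
have a1 : 0 <= (1 + a) ^+ k - 1 by rewrite subr_ge0 exprn_ege1// lerDl.
have := slowly_varyingM a0 a1 p0 (fun x => exprn_ge0 k (p0 x)) sp IH xy.
by rewrite -!exprS (_ : a * _ + _ = (1 + a) ^+ k.+1 - 1)// exprS; ring.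
Qed.

(** With [r = a / b <= 2], the claim bounds [r^N - 1]. Raising the exponent to the integer [m] only
    moves the power further from 1, and [r^m - 1] is [r - 1] times a geometric sum of [m] terms at
    most [2^m]. One more factor 2 comes from [a <= 2 * b]. *)
Lemma powR_ratio (N a b : R) (m : nat) : 0 <= N -> N <= m%:R -> 1 <= a -> 1 <= b ->
  a <= b + 1 -> b <= a + 1 ->
  `|b `^ (- N) - a `^ (- N)| * a <= (m%:R * 2 ^+ m.+1) * a `^ (- N).
Proof.
move=> N0 Nm a1 b1 ab ba.
have a0 : 0 < a by lra. 
have b0 : 0 < b by lra.
pose r := a / b.
have r0 : 0 < r by rewrite divr_gt0.
have r2 : r <= 2 by rewrite ler_pdivrMr//; lra.
have -> : b `^ (- N) = r `^ N * a `^ (- N).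
  rewrite /r powRM ?invr_ge0 ?(ltW a0) ?(ltW b0)//.
  rewrite mulrAC (powRN a) mulfV ?gt_eqF ?powR_gt0// mul1r.
  by rewrite -(powR_inv1 (ltW b0)) -powRrM mulN1r.
rewrite -{2}[a `^ _]mul1r -mulrBl normrM (ger0_norm (powR_ge0 _ _)) mulrAC.
rewrite ler_wpM2r ?powR_ge0//.
suff : `|r `^ N - 1| <= m%:R * 2 ^+ m * `|r - 1|.
  move=> /(ler_wpM2r (ltW a0)) /le_trans; apply.
  rewrite exprSr mulrA -!mulrA ler_wpM2l// ler_wpM2l// ?exprn_ge0//.
  have -> : r - 1 = (a - b) / b by rewrite /r; field; rewrite gt_eqF.
  rewrite normrM normfV (gtr0_norm b0).
  rewrite mulrAC ler_pdivrMr//.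
  have : `|a - b| <= 1 by rewrite ler_norml; lra.
  have : 0 <= `|a - b| by [].
  by move: `|a - b| => t; nra.
have mono : `|r `^ N - 1| <= `|r ^+ m - 1|.
  rewrite -(powR_mulrn m (ltW r0)).
  have [r1|r1] := leP 1 r.
    have h1 : 1 <= r `^ N by rewrite -(powRr0 r) ler_powR.
    have h2 : r `^ N <= r `^ m%:R by rewrite ler_powR.
    by rewrite !ger0_norm ?subr_ge0 ?lerD2r// (le_trans h1).
  have h1 : r `^ N <= 1 by rewrite -(powRr0 r) ger_powR// r0 ltW.
  have h2 : r `^ m%:R <= r `^ N by rewrite ger_powR// r0 ltW.
  by rewrite !ler0_norm ?subr_le0 ?lerN2 ?lerD2r// (le_trans h2).
apply: (le_trans mono); rewrite subrX1 normrM mulrC ler_wpM2r//.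
apply: (le_trans (ler_norm_sum _ _ _)).
rewrite -[m in m%:R]card_ord -sum1_card natr_sum mulr_suml.
apply: ler_sum => i _; rewrite mul1r normrX (gtr0_norm r0).
have [r1|r1] := leP 1 r.
  apply: (@le_trans _ _ (r ^+ m)); first by rewrite ler_weXn2l// ltnW.
  by apply: lerXn2r; rewrite ?nnegrE ?(ltW r0).
apply: (@le_trans _ _ 1); first by rewrite exprn_ile1// ltW.
by rewrite exprn_ege1// ler1n.
Qed.

Lemma slowly_varying_powR (N : R) : 0 <= N ->
  exists2 c, 0 <= c & slowly_varying c (fun x : Zd d => jap x `^ (- N)).
Proof.
move=> N0; have [m Nm] : exists m : nat, N <= m%:R.
  by exists (Num.truncn N).+1; rewrite ltW// truncnS_gt.
exists (m%:R * 2 ^+ m.+1) => [|x y xy]; first by rewrite mulr_ge0 ?exprn_ge0.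
apply: powR_ratio => //; rewrite ?japanese_ge1//.
  by apply: japanese_neighbour; rewrite neighbour_sym.
exact: japanese_neighbour.
Qed.

End SlowVariation.

(** * The heat semigroup *)

(** This isolates what the analysis takes from the walk: positivity, conservation of mass, the
    Chapman-Kolmogorov equation and the derivative at time 0, the latter entry by entry without any
    uniformity. *)
Record heat_kernel (R : realType) (d : nat) (C : set (Zd d))
    (w : Zd d -> Zd d -> R) (p : R -> C -> C -> R) : Prop := HeatKernel {
  heat_ge0 : forall t x y, 0 <= t -> 0 <= p t x y;
  heat_sum1 : forall t x, 0 <= t -> (\esum_(y in [set: C]) (p t x y)%:E = 1)%E;
  heat_chapman : forall s t x z, 0 <= s -> 0 <= t ->
    (\esum_(y in [set: C]) (p s x y * p t y z)%:E = (p (s + t) x z)%:E)%E;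
  heat_at0 : forall x y, p 0 x y = (x == y)%:R;
  heat_generator : forall x y,
    h^-1 * (p h x y - (x == y)%:R) @[h --> 0^'+] -->
      - laplacian w (fun z => (z == y)%:R) x
}.

(** * The Laplacian on the component *)

Section Laplacian.
Variables (R : realType) (d : nat) (C : set (Zd d)).
Variables (w : Zd d -> Zd d -> R) (hw : conductances w).
Implicit Types (u v : C -> R) (x y : C).

Definition neighbours x : seq C :=
  fset_set [set y : C | neighbour (val x) (val y)].

Lemma finite_neighbours_in x : finite_set [set y : C | neighbour (val x) (val y)].
Proof.
have -> : [set y : C | neighbour (val x) (val y)] =
    val @^-1` [set y | neighbour (val x) y] by [].
by apply: finite_preimage (finite_neighbours _) => a b _ _; exact: val_inj.
Qed.

Lemma neighbours_uniq x : uniq (neighbours x).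
Proof. exact: fset_uniq. Qed.

Lemma mem_neighbours x y : (y \in neighbours x) = neighbour (val x) (val y).
Proof.
rewrite /neighbours in_fset_set ?inE//; first by apply/idP/idP; rewrite ?inE.
exact: finite_neighbours_in.
Qed.

Lemma laplacianE (K : nzRingType) (c : Zd d -> Zd d -> K) (u : C -> K) x :
  laplacian c u x = \sum_(y <- neighbours x) c (val x) (val y) * (u x - u y).
Proof. by rewrite /laplacian fsbig_finite//; exact: finite_neighbours_in. Qed.

Definition degree x := \sum_(y <- neighbours x) w (val x) (val y).

Definition adjacency u x := \sum_(y <- neighbours x) w (val x) (val y) * u y.

(** The signless Laplacian, degree plus adjacency. It is monotone and dominates [|Delta u|] when
    applied to [|u|], so that pointwise bounds propagate through repeated Laplacians. *)
Definition signless u x := degree x * u x + adjacency u x.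

Lemma degree_ge0 x : 0 <= degree x.
Proof. by apply: sumr_ge0 => y _; exact: conductance_ge0 hw _ _. Qed.

Lemma lapE u x : laplacian w u x = degree x * u x - adjacency u x.
Proof.
rewrite laplacianE /degree /adjacency mulr_suml -sumrB.
by apply: eq_bigr => y _; rewrite mulrBr.
Qed.

Lemma adjacencyD u v x : adjacency (fun y => u y + v y) x = adjacency u x + adjacency v x.
Proof. by rewrite -big_split; apply: eq_bigr => y _; rewrite mulrDr. Qed.

Lemma adjacencyZ c u x : adjacency (fun y => c * u y) x = c * adjacency u x.
Proof. by rewrite /adjacency mulr_sumr; apply: eq_bigr => y _; rewrite mulrCA. Qed.

Lemma lapD u v x : laplacian w (fun y => u y + v y) x = laplacian w u x + laplacian w v x.
Proof. by rewrite !lapE adjacencyD; ring. Qed.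

Lemma lapZ c u x : laplacian w (fun y => c * u y) x = c * laplacian w u x.
Proof. by rewrite !lapE adjacencyZ; ring. Qed.

Lemma lapB u v x : laplacian w (fun y => u y - v y) x = laplacian w u x - laplacian w v x.
Proof.
rewrite (_ : (fun y => u y - v y) = fun y => u y + (-1) * v y); last first.
  by apply/funext => y; rewrite mulN1r.
by rewrite lapD lapZ mulN1r.
Qed.

Lemma ler_adjacency u v x : (forall y, u y <= v y) -> adjacency u x <= adjacency v x.
Proof.
move=> uv; apply: ler_sum => y _; rewrite ler_wpM2l//; exact: conductance_ge0 hw _ _.
Qed.

Lemma ler_signless u v x : (forall y, u y <= v y) -> signless u x <= signless v x.
Proof. by move=> uv; rewrite lerD ?ler_adjacency// ler_wpM2l// degree_ge0. Qed.

Lemma signlessZ c u x : signless (fun y => c * u y) x = c * signless u x.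
Proof. by rewrite /signless adjacencyZ; ring. Qed.

Lemma ler_norm_lap u x : `|laplacian w u x| <= signless (fun y => `|u y|) x.
Proof.
rewrite lapE; apply: (le_trans (ler_normB _ _)); apply: lerD.
  by rewrite normrM (ger0_norm (degree_ge0 x)).
apply: (le_trans (ler_norm_sum _ _ _)); apply: ler_sum => y _.
by rewrite normrM ger0_norm//; exact: conductance_ge0 hw _ _.
Qed.

Lemma lap_local u v x : u x = v x -> (forall y, y \in neighbours x -> u y = v y) ->
  laplacian w u x = laplacian w v x.
Proof.
by move=> ux uv; rewrite !laplacianE; apply: eq_big_seq => y /uv ->; rewrite ux.
Qed.

End Laplacian.

(** * The semigroup as a positive operator *)

Section Semigroup.
Variables (R : realType) (d : nat) (C : set (Zd d)).
Variables (w : Zd d -> Zd d -> R) (hw : conductances w).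
Variables (p : R -> C -> C -> R) (hp : heat_kernel w p).
Implicit Types (f g : C -> R) (x y : C) (s t : R).

Local Notation S a := (\esum_(x in [set: C]) a x)%E.

Definition heat t f x := real_sum (fun y => p t x y * f y).

(** Absolute convergence at all times and points at once: this class is stable under the semigroup,
    so that the semigroup law holds in it. *)
Definition heat_dom f := forall t x, 0 <= t -> abs_summable (fun y => p t x y * f y).

Lemma heat_domW f g : (forall x, `|f x| <= `|g x|) -> heat_dom g -> heat_dom f.
Proof.
move=> fg dg t x t0; apply: abs_summableW (dg t x t0) => y.
by rewrite !normrM ler_wpM2l.
Qed.

Lemma heat_domD f g : heat_dom f -> heat_dom g -> heat_dom (fun x => f x + g x).
Proof.
move=> df dg t x t0.
rewrite (_ : (fun _ => _) = fun y => p t x y * f y + p t x y * g y); last first.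
  by apply/funext => y; rewrite mulrDr.
by apply: abs_summableD; [exact: df|exact: dg].
Qed.

Lemma heat_domZ c f : heat_dom f -> heat_dom (fun x => c * f x).
Proof.
move=> df t x t0; have := abs_summableZ c (df t x t0).
by congr abs_summable; apply/funext => y; rewrite mulrCA.
Qed.

Lemma heat_domN f : heat_dom f -> heat_dom (fun x => - f x).
Proof. by apply: heat_domW => x; rewrite normrN. Qed.

Lemma heat_dom_norm f : heat_dom f -> heat_dom (fun x => `|f x|).
Proof. by apply: heat_domW => x; rewrite normr_id. Qed.

Lemma heat_dom_cst c : heat_dom (fun=> c).
Proof.
move=> t x t0.
rewrite (_ : (fun _ => _) = fun y => c * p t x y); last by apply/funext => y; rewrite mulrC.
apply: abs_summableZ; rewrite /abs_summable.
under eq_esum do rewrite (ger0_norm (heat_ge0 hp _ _ t0)).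
by rewrite (heat_sum1 hp)// ltry.
Qed.

Lemma heat_dom_bounded f B : (forall x, `|f x| <= B) -> heat_dom f.
Proof.
by move=> fB; apply: heat_domW (heat_dom_cst B) => x; rewrite (le_trans (fB x))// ler_norm.
Qed.

Section Time.
Variables (t : R) (t0 : 0 <= t).

Lemma heatD f g x : heat_dom f -> heat_dom g ->
  heat t (fun y => f y + g y) x = heat t f x + heat t g x.
Proof.
move=> df dg; rewrite /heat -real_sumD; [|exact: df|exact: dg].
by congr real_sum; apply/funext => y; rewrite mulrDr.
Qed.

Lemma heatZ c f x : heat_dom f -> heat t (fun y => c * f y) x = c * heat t f x.
Proof.
move=> df; rewrite /heat -real_sumZ; last exact: df.
by congr real_sum; apply/funext => y; rewrite mulrCA.
Qed.

Lemma heatN f x : heat_dom f -> heat t (fun y => - f y) x = - heat t f x.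
Proof.
move=> df; rewrite (_ : (fun y => - f y) = (fun y => -1 * f y)).
  by rewrite heatZ// mulN1r.
by apply/funext => y; rewrite mulN1r.
Qed.

Lemma heatB f g x : heat_dom f -> heat_dom g ->
  heat t (fun y => f y - g y) x = heat t f x - heat t g x.
Proof. by move=> df dg; rewrite heatD ?heatN//; exact: heat_domN. Qed.

Lemma ler_heat f g x : heat_dom f -> heat_dom g -> (forall y, f y <= g y) ->
  heat t f x <= heat t g x.
Proof.
move=> df dg fg; apply: le_real_sum; [|exact: df|exact: dg].
by move=> y; rewrite ler_wpM2l// (heat_ge0 hp).
Qed.

Lemma heat_cst c x : heat t (fun=> c) x = c.
Proof.
rewrite -{1}[c]mulr1 (heatZ _ _ (heat_dom_cst 1)) /heat.
rewrite (_ : (fun _ => _) = p t x); last by apply/funext => y; rewrite mulr1.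
rewrite ge0_real_sum; last by move=> y; exact: (heat_ge0 hp).
by rewrite (heat_sum1 hp) ?mulr1.
Qed.

Lemma ge0_heat f x : (forall y, 0 <= f y) -> heat_dom f -> 0 <= heat t f x.
Proof.
by move=> f0 df; rewrite -(heat_cst 0 x) ler_heat//; exact: heat_dom_cst.
Qed.

Lemma ler_norm_heat f x : heat_dom f -> `|heat t f x| <= heat t (fun y => `|f y|) x.
Proof.
move=> df; apply: (le_trans (ler_norm_real_sum (df t x t0))).
rewrite le_eqVlt; apply/orP; left; apply/eqP.
by congr real_sum; apply/funext => y; rewrite normrM (ger0_norm (heat_ge0 hp _ _ t0)).
Qed.

Lemma heat_bounded f B x : (forall y, `|f y| <= B) -> `|heat t f x| <= B.
Proof.
move=> fB; have df := heat_dom_bounded fB.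
rewrite (le_trans (ler_norm_heat _ df))// -[leRHS](heat_cst B x).
by apply: ler_heat => //; [exact: heat_dom_norm|exact: heat_dom_cst].
Qed.

Lemma heatE f x : (forall y, 0 <= f y) -> heat_dom f ->
  (heat t f x)%:E = S (fun y => (p t x y * f y)%:E).
Proof.
move=> f0 df; rewrite /heat ge0_real_sumE//; last exact: df.
by move=> y; rewrite mulr_ge0// (heat_ge0 hp).
Qed.

End Time.

Lemma heat0 f : heat 0 f = f.
Proof.
apply/funext => x; rewrite /heat (@real_sum_fsupp _ _ _ _ [:: x])//; last first.
  by move=> y; rewrite inE eq_sym (heat_at0 hp) => /negPf ->; rewrite mul0r.
by rewrite big_seq1 (heat_at0 hp) eqxx mul1r.
Qed.

(** Tonelli and the Chapman-Kolmogorov equation. The value on the right is finite, so the identity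
    also shows that [heat t f] is again in the domain. *)
Lemma ge0_heat_heat s t f : 0 <= s -> 0 <= t -> (forall y, 0 <= f y) -> heat_dom f ->
  forall x, S (fun y => (p s x y * heat t f y)%:E) = (heat (s + t) f x)%:E.
Proof.
move=> s0 t0 f0 df x; rewrite heatE ?addr_ge0//.
transitivity (S (fun y => \esum_(z in [set: C]) (p s x y * p t y z * f z)%:E)%E).
  apply: eq_esum => y _; rewrite EFinM heatE//.
  rewrite -esumZl ?(heat_ge0 hp)//; first by apply: eq_esum => z _; rewrite -EFinM mulrA.
  by move=> z; rewrite lee_fin mulr_ge0// (heat_ge0 hp).
rewrite esum_swap; last by move=> y z; rewrite lee_fin !mulr_ge0 ?(heat_ge0 hp).
apply: eq_esum => z _.
rewrite [in RHS]mulrC EFinM -(heat_chapman hp)// -esumZl//.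
  by apply: eq_esum => y _; rewrite -EFinM mulrC.
by move=> y; rewrite lee_fin mulr_ge0 ?(heat_ge0 hp).
Qed.

Lemma ge0_heat_dom_heat t f : 0 <= t -> (forall y, 0 <= f y) -> heat_dom f ->
  heat_dom (heat t f).
Proof.
move=> t0 f0 df s x s0; rewrite /abs_summable.
under eq_esum do rewrite ger0_norm ?mulr_ge0 ?(heat_ge0 hp) ?ge0_heat//.
by rewrite ge0_heat_heat// ltry.
Qed.

Lemma heat_dom_heat t f : 0 <= t -> heat_dom f -> heat_dom (heat t f).
Proof.
move=> t0 df; apply: heat_domW (ge0_heat_dom_heat t0 _ (heat_dom_norm df)) => // x.
by rewrite (le_trans (ler_norm_heat _ _ df))// ler_norm.
Qed.

Lemma heat_dom_pos f : heat_dom f -> heat_dom (fun x => Num.max (f x) 0).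
Proof.
apply: heat_domW => x; rewrite ger0_norm ?le_max ?lexx ?orbT//.
by rewrite ge_max ler_norm normr_ge0.
Qed.

Lemma heat_heat s t f : 0 <= s -> 0 <= t -> heat_dom f ->
  heat s (heat t f) = heat (s + t) f.
Proof.
move=> s0 t0 df; apply/funext => x.
have pos g : (forall y, 0 <= g y) -> heat_dom g -> heat s (heat t g) x = heat (s + t) g x.
  move=> g0 dg; apply: EFin_inj; rewrite heatE//.
  - exact: ge0_heat_heat.
  - by move=> y; exact: ge0_heat.
  - exact: heat_dom_heat.
pose f1 x := Num.max (f x) 0; pose f2 x := Num.max (- f x) 0.
have d1 : heat_dom f1 by exact: heat_dom_pos.
have d2 : heat_dom f2 by apply: heat_dom_pos; exact: heat_domN.
have -> : f = fun x => f1 x - f2 x by apply/funext => y; exact: posneg.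
have -> : heat t (fun x => f1 x - f2 x) = fun x => heat t f1 x - heat t f2 x.
  by apply/funext => y; rewrite heatB.
rewrite !heatB ?addr_ge0//; try exact: heat_dom_heat.
by rewrite !pos// => y; rewrite le_max lexx orbT.
Qed.

End Semigroup.

(** * First-order expansion of the semigroup *)

Lemma at_right0P (R : realType) (Q : R -> Prop) :
  (\forall h \near 0^'+, Q h) -> exists2 e : R, 0 < e & forall h, 0 < h < e -> Q h.
Proof.
move=> /nbhs_ballP[e /= e0 H]; exists e => // h /andP[h0 he]; apply: H => //.
by rewrite /ball/= sub0r normrN gtr0_norm.
Qed.

Lemma seq_uniform_delta (R : realType) (T : eqType) (Q : T -> R -> Prop) (r : seq T) :
  (forall y, exists2 e : R, 0 < e & forall h, 0 < h < e -> Q y h) ->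
  exists2 e : R, 0 < e & forall h, 0 < h < e -> forall y, y \in r -> Q y h.
Proof.
move=> Qe; elim: r => [|y r [e e0 IH]]; first by exists 1.
have [e' e'0 H] := Qe y; exists (Num.min e e'); first by rewrite lt_min e0.
move=> h; rewrite lt_min => /and3P[h0 he he'] z.
by rewrite inE => /predU1P[->|]; [apply: H|apply: IH]; rewrite h0.
Qed.

Section Taylor.
Variables (R : realType) (d : nat) (C : set (Zd d)).
Variables (w : Zd d -> Zd d -> R) (hw : conductances w).
Variables (p : R -> C -> C -> R) (hp : heat_kernel w p).
Implicit Types (f g b : C -> R) (x y : C) (s t h e a c B D : R).

Local Notation S a := (\esum_(x in [set: C]) a x)%E.
Local Notation heat := (heat p).
Local Notation dom := (heat_dom p).

Lemma neighbour_irrefl x : x \notin neighbours x.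
Proof.
rewrite mem_neighbours /neighbour subrr /sqnorm big1// => i _.
by rewrite !mxE expr0n.
Qed.

(** On the ball of radius 1 about [x], which is all that the Laplacian sees, [g] is a finite
    combination of indicators. *)
Lemma lap_coord g x :
  \sum_(y <- x :: neighbours x) g y * laplacian w (fun z => (z == y)%:R) x = laplacian w g x.
Proof.
have ur : uniq (x :: neighbours x) by rewrite /= neighbour_irrefl neighbours_uniq.
have E z : z \in x :: neighbours x ->
    \sum_(y <- x :: neighbours x) g y * (z == y)%:R = g z.
  move=> zr; rewrite (bigD1_seq z)//= eqxx mulr1 big1 ?addr0// => y.
  by rewrite eq_sym => /negPf ->; rewrite mulr0.
transitivity (laplacian w (fun z => \sum_(y <- x :: neighbours x) g y * (z == y)%:R) x).
  elim: (x :: _) => [|a r IH].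
    by rewrite big_nil laplacianE big1// => y _; rewrite !big_nil subrr mulr0.
  rewrite big_cons IH -lapZ -lapD; congr laplacian; apply/funext => z.
  by rewrite big_cons.
apply: lap_local; first by rewrite E// mem_head.
by move=> y yr; rewrite E// in_cons yr orbT.
Qed.

Lemma lap_cst c x : laplacian w (fun=> c) x = 0.
Proof. by rewrite laplacianE big1// => y _; rewrite subrr mulr0. Qed.

(** The generator is given entry by entry, but the bound must hold for all [g] with [|g| <= B] at
    once. On the ball about [x] there are finitely many entries. The mass outside is 1 minus the
    mass of the ball, and it is [o(h)] because [Delta 1 = 0]. *)
Lemma heat_generator_uniform x (e : R) : 0 < e ->
  exists2 del : R, 0 < del & forall h, 0 < h < del -> forall B g, (forall y, `|g y| <= B) ->
    `|heat h g x - g x + h * laplacian w g x| <= e * B * h.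
Proof.
move=> e0; pose r := x :: neighbours x.
have ur : uniq r by rewrite /= neighbour_irrefl neighbours_uniq.
pose n : R := (size r)%:R.
have n0 : 0 < n by rewrite ltr0n.
(* Half of [e] goes to the [n] entries on the ball, the other half to the mass outside. *)
pose e' := e / (2 * n).
have e'0 : 0 < e' by rewrite divr_gt0// mulr_gt0.
pose L y := laplacian w (fun z => (z == y)%:R) x.
pose err y h := p h x y - (x == y)%:R + h * L y.
have [del del0 Hdel] : exists2 del : R, 0 < del & forall h, 0 < h < del ->
    forall y, y \in r -> `|err y h| <= e' * h.
  apply: seq_uniform_delta => y.
  have /cvgrPdist_lt/(_ _ e'0)/at_right0P[del del0 H] := @heat_generator _ _ _ _ _ hp x y.
  exists del => // h hd; have /andP[h0 _] := hd.
  have := H _ hd; rewrite -/(L y) => /ltW.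
  rewrite (_ : _ - _ = - (err y h / h)); last by rewrite /err; field; rewrite gt_eqF.
  by rewrite normrN normrM normfV (gtr0_norm h0) ler_pdivrMr.
exists del => // h hd B g gB; have /andP[h0 _] := hd; have h0' := ltW h0.
have B0 : 0 <= B by rewrite (le_trans _ (gB x)).
pose g1 y := if y \in r then g y else 0.
pose g2 y := if y \in r then 0 else g y.
pose o1 y : R := if y \in r then 1 else 0.
pose o2 y : R := if y \in r then 0 else 1.
have dg1 : dom g1.
  by apply: (heat_dom_bounded hp (B := B)) => y; rewrite /g1; case: ifP; rewrite ?normr0.
have dg2 : dom g2.
  by apply: (heat_dom_bounded hp (B := B)) => y; rewrite /g2; case: ifP; rewrite ?normr0.
have do1 : dom o1.
  by apply: (heat_dom_bounded hp (B := 1)) => y; rewrite /o1; case: ifP; rewrite ?normr0 ?normr1.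
have do2 : dom o2.
  by apply: (heat_dom_bounded hp (B := 1)) => y; rewrite /o2; case: ifP; rewrite ?normr0 ?normr1.
have fin k : heat h (fun y => if y \in r then k y else 0) x = \sum_(y <- r) p h x y * k y.
  rewrite /heat (@real_sum_fsupp _ _ _ _ r)//.
    by apply: eq_big_seq => y ->.
  by move=> y /negPf ->; rewrite mulr0.
have hg : heat h g x = \sum_(y <- r) p h x y * g y + heat h g2 x.
  have {1}-> : g = (fun y => g1 y + g2 y).
    by apply/funext => y; rewrite /g1 /g2; case: ifP; rewrite ?addr0 ?add0r.
  by rewrite heatD// -fin.
have ho : 1 = \sum_(y <- r) p h x y * 1 + heat h o2 x.
  rewrite -{1}(heat_cst hp h0' 1 x).
  have -> : (fun=> 1) = (fun y => o1 y + o2 y).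
    by apply/funext => y; rewrite /o1 /o2; case: ifP; rewrite ?addr0 ?add0r.
  by rewrite heatD// -fin.
have dl (k : C -> R) : \sum_(y <- r) k y * (x == y)%:R = k x.
  rewrite (bigD1_seq x)//= ?mem_head// eqxx mulr1 big1 ?addr0// => y.
  by rewrite eq_sym => /negPf ->; rewrite mulr0.
have expand k : \sum_(y <- r) p h x y * k y =
    \sum_(y <- r) k y * err y h + k x - h * laplacian w k x.
  rewrite -(lap_coord k x) -/r mulr_sumr -[k x](dl k) -big_split/= -sumrB.
  by apply: eq_bigr => y _; rewrite /err -/(L y); ring.
have err_sum : \sum_(y <- r) `|err y h| <= n * (e' * h).
  rewrite /n -sum1_size natr_sum mulr_suml big_seq_cond [leRHS]big_seq_cond.
  by apply: ler_sum => y /andP[yr _]; rewrite mul1r Hdel.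
have o2_le : heat h o2 x <= n * (e' * h).
  have := ho; rewrite expand lap_cst mulr0 subr0 => ho'.
  have -> : heat h o2 x = - \sum_(y <- r) 1 * err y h by lra.
  apply: le_trans err_sum; rewrite -sumrN; apply: ler_sum => y _.
  by rewrite mul1r -normrN ler_norm.
have g2_le : `|heat h g2 x| <= B * (n * (e' * h)).
  rewrite (le_trans (ler_norm_heat hp h0' x dg2))//.
  apply: (@le_trans _ _ (heat h (fun y => B * o2 y) x)).
    apply: (ler_heat hp) => //.
    - exact: heat_dom_norm.
    - exact: heat_domZ.
    - by move=> y; rewrite /g2 /o2; case: ifP => _; rewrite ?normr0 ?mulr0 ?mulr1.
  by rewrite heatZ// ler_wpM2l.
have g1_le : `|\sum_(y <- r) g y * err y h| <= B * (n * (e' * h)).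
  rewrite (le_trans (ler_norm_sum _ _ _))// (le_trans _ (ler_wpM2l B0 err_sum))//.
  by rewrite mulr_sumr; apply: ler_sum => y _; rewrite normrM ler_wpM2r.
rewrite hg expand.
move: g1_le g2_le; move: (\sum_(y <- r) _) (heat h g2 x) (h * _) => a b c g1_le g2_le.
rewrite [X in `|X|](_ : _ = a + b); last by ring.
apply: (le_trans (ler_normD _ _)); apply: (le_trans (lerD g1_le g2_le)).
rewrite /e' (_ : _ + _ = e * B * h)//; field; rewrite gt_eqF//.
Qed.

(* Cut [[0, h]] into [n] steps, expand each of them, and let [n] tend to infinity. *)
Lemma heat_increment f B x h a D : (forall y, `|f y| <= B) -> 0 <= h ->
  (forall s, 0 <= s <= h -> `|laplacian w (heat s f) x - a| <= D) ->
  `|heat h f x - f x + h * a| <= h * D.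
Proof.
move=> fB; rewrite le_eqVlt => /predU1P[<- _|h0 HD].
  by rewrite (heat0 hp) subrr !mul0r addr0 normr0.
have B0 : 0 <= B by rewrite (le_trans _ (fB x)).
apply/ler_addgt0Pr => e e0.
pose e1 := e / (h * B + 1).
have hB1 : 0 < h * B + 1 by rewrite ltr_wpDl// mulr_ge0// ltW.
have e10 : 0 < e1 by rewrite divr_gt0.
have [del del0 Hdel] := heat_generator_uniform x e10.
pose n := (Num.truncn (h / del)).+1.
have n0 : (0 : R) < n%:R by rewrite ltr0n.
pose k := h / n%:R.
have k0 : 0 < k by rewrite divr_gt0.
have kdel : k < del.
  by rewrite ltr_pdivrMr// mulrC -ltr_pdivrMr// truncnS_gt.
have main j : (j <= n)%N ->
    `|heat (j%:R * k) f x - f x + (j%:R * k) * a| <= (j%:R * k) * (D + e1 * B).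
  elim: j => [|j IH] jn; first by rewrite !mul0r (heat0 hp) subrr addr0 normr0.
  have jk0 : 0 <= j%:R * k by rewrite mulr_ge0// ltW.
  have df := heat_dom_bounded hp fB.
  have E : heat (j.+1%:R * k) f x = heat k (heat (j%:R * k) f) x.
    by rewrite (heat_heat hp)// ?ltW// -natr1 mulrDl mul1r addrC.
  pose g := heat (j%:R * k) f.
  have gB y : `|g y| <= B by exact: (heat_bounded hp).
  have h1 := Hdel k _ B g gB; rewrite k0 kdel in h1; have {}h1 := h1 isT.
  have h2 : `|laplacian w g x - a| <= D.
    apply: HD; rewrite jk0/= -(divfK (lt0r_neq0 n0) h) -/k mulrC ler_pM2l// ler_nat.
    exact: ltnW.
  have h3 := IH (ltnW jn).
  rewrite E -/g -natr1.
  rewrite (_ : _ + _ = (heat k g x - g x + k * laplacian w g x) -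
    k * (laplacian w g x - a) + (g x - f x + j%:R * k * a)); last by ring.
  apply: (le_trans (ler_normD _ _)).
  apply: (le_trans (lerD (ler_normB _ _) h3)).
  rewrite (normrM k) (gtr0_norm k0).
  have := ler_wpM2l (ltW k0) h2; move: h1; set X := `|_|; set Y := `|_|; lra.
have := main n (leqnn n).
rewrite (_ : n%:R * k = h); last by rewrite /k mulrC divfK// gt_eqF.
move/le_trans; apply; rewrite mulrDr lerD2l /e1.
rewrite (_ : h * _ = e * (h * B / (h * B + 1))); last by ring.
by rewrite ler_piMr ?(ltW e0)// ler_pdivrMr// mul1r lerDl.
Qed.

Lemma bounded_heat_increment b h f B x : 0 <= h -> (forall y, `|f y| <= B) ->
  (forall s, 0 <= s <= h -> forall y, `|heat s f y| <= b y) ->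
  `|heat h f x - f x| <= h * signless w b x.
Proof.
move=> h0 fB Hb; rewrite -[X in `|X|]addr0 -(mulr0 h); apply: (heat_increment fB h0).
move=> s sh; rewrite subr0 (le_trans (ler_norm_lap hw _ _))//.
by apply: ler_signless => // y; exact: Hb.
Qed.


(** Compare with [a = Delta f (x)] in [heat_increment]: the deviation [Delta (P_s f - f)] is bounded
    through the first-order increment, whence the second application of [signless]. *)
Lemma bounded_heat_taylor b h f B x : 0 <= h -> (forall y, `|f y| <= B) ->
  (forall s, 0 <= s <= h -> forall y, `|heat s f y| <= b y) ->
  `|heat h f x - f x + h * laplacian w f x| <= h ^+ 2 * signless w (signless w b) x.
Proof.
move=> h0 fB Hb.
have b0 y : 0 <= b y by rewrite (le_trans _ (Hb 0 _ y))// lexx.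
have Jb0 y : 0 <= signless w b y.
  by rewrite addr_ge0 ?mulr_ge0 ?degree_ge0// sumr_ge0// => z _; rewrite mulr_ge0// (conductance_ge0 hw).
rewrite expr2 -mulrA; apply: (heat_increment fB h0) => s /andP[s0 sh].
rewrite -lapB (le_trans (ler_norm_lap hw _ _))// -signlessZ.
apply: ler_signless => // y.
apply: (@le_trans _ _ (s * signless w b y)); last by rewrite ler_wpM2r.
apply: (bounded_heat_increment y s0 fB) => u /andP[u0 us] z.
by apply: Hb; rewrite u0 (le_trans us).
Qed.

(** [g] is [f] restricted to a finite set that contains [r] and carries all but [e] of the sum for
    each of the finitely many [x] in [r]. *)
Lemma heat_truncation f h e (r : seq C) : 0 <= h -> (forall y, 0 <= f y) -> dom f ->
  0 < e -> exists g B, [/\ forall y, 0 <= g y <= f y, forall y, g y <= B,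
    forall y, y \in r -> g y = f y &
    forall x, x \in r -> heat h g x <= heat h f x <= heat h g x + e].
Proof.
move=> h0 f0 df e0.
have pf0 x y : (0 <= (p h x y * f y)%:E)%E by rewrite lee_fin mulr_ge0// (heat_ge0 hp).
have fin x : (S (fun y => (p h x y * f y)%:E) < +oo)%E.
  by rewrite -(heatE hp)// ltry.
have [F HF] := esum_approx_seq r pf0 fin e0.
pose G : {fset C} := (F `|` [fset y | y in r])%fset.
pose g y := if y \in G then f y else 0.
have g0f y : 0 <= g y <= f y by rewrite /g; case: ifP => _; rewrite ?lexx f0.
exists g, (\sum_(y <- G) f y); split => //.
- move=> y; rewrite /g; case: ifP => yG; last exact: sumr_ge0.
  by rewrite (big_fsetD1 y)//= lerDl sumr_ge0.
- by move=> y yr; rewrite /g !inE yr orbT.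
move=> x xr.
have dg : dom g.
  by apply: heat_domW df => y; have /andP[a1 a2] := g0f y; rewrite !ger0_norm// f0.
apply/andP; split; first by apply: (ler_heat hp) => // y; case/andP: (g0f y).
have := HF G (fsubsetUl _ _) x xr; rewrite -(heatE hp)// sumEFin -EFinD lee_fin.
suff <- : heat h g x = \sum_(y <- G) p h x y * f y by [].
rewrite /heat (@real_sum_fsupp _ _ _ _ G) ?fset_uniq//; last first.
  by move=> y yG; rewrite /g (negPf yG) mulr0.
by apply: eq_big_seq => y yG; rewrite /g yG.
Qed.

(** A truncation [g <= f] is bounded, inherits the bound [b] by positivity, agrees with [f] wherever
    the Laplacian at [x] looks, and changes [P_h f (x)] by at most [e]. The bounds do not involve
    the supremum of [g], so [e] may tend to 0. *)
Lemma heat_taylor b h f x : 0 <= h -> (forall y, 0 <= f y) -> dom f ->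
  (forall s, 0 <= s <= h -> forall y, heat s f y <= b y) ->
  `|heat h f x - f x| <= h * signless w b x /\
  `|heat h f x - f x + h * laplacian w f x| <= h ^+ 2 * signless w (signless w b) x.
Proof.
move=> h0 f0 df Hb.
have trunc (e : R) : 0 < e -> exists g B, [/\ forall y, `|g y| <= B,
    forall s, 0 <= s <= h -> forall y, `|heat s g y| <= b y,
    g x = f x, laplacian w g x = laplacian w f x & `|heat h f x - heat h g x| <= e].
  move=> e0.
  have [g [B [gf gB gr gx]]] := heat_truncation (x :: neighbours x) h0 f0 df e0.
  have /andP[g1 g2] := gx x (mem_head _ _).
  have g0 y : 0 <= g y by case/andP: (gf y).
  have gfle y : g y <= f y by case/andP: (gf y).
  have dg : dom g by apply: heat_domW df => y; rewrite !ger0_norm.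
  exists g, B; split.
  - by move=> y; rewrite ger0_norm.
  - move=> s /andP[s0 sh] y; rewrite ger0_norm ?(ge0_heat hp)//.
    by rewrite (le_trans (ler_heat hp s0 _ dg df gfle))// Hb// s0.
  - by rewrite gr// mem_head.
  - apply: lap_local; first by rewrite gr// mem_head.
    by move=> y yr; rewrite gr// in_cons yr orbT.
  - by rewrite ger0_norm; lra.
split; apply/ler_addgt0Pr => e /trunc[g [B [gB Hg gx gl hg]]].
  have := bounded_heat_increment x h0 gB Hg; rewrite gx => H.
  rewrite (_ : _ - _ = (heat h g x - f x) + (heat h f x - heat h g x)); last by ring.
  by apply: (le_trans (ler_normD _ _)); exact: lerD.
have := bounded_heat_taylor x h0 gB Hg; rewrite gx gl => H.
rewrite (_ : _ + _ = (heat h g x - f x + h * laplacian w f x) +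
  (heat h f x - heat h g x)); last by ring.
by apply: (le_trans (ler_normD _ _)); exact: lerD.
Qed.

End Taylor.

(** * The weighted energy estimate *)

Section Energy.
Variables (R : realType) (d : nat) (C : set (Zd d)).
Variables (w : Zd d -> Zd d -> R) (hw : conductances w).
Variables (K : R) (K1 : 1 <= K).
Hypothesis degK : forall x : C, degree w x <= K * japanese R (val x) ^+ 2.
Implicit Types (f g u : C -> R) (x y : C) (phi : Zd d -> R) (c s t h e B : R).

Local Notation S a := (\esum_(x in [set: C]) a x)%E.
Local Notation jap x := (japanese R (val x)).

Lemma esum_neighbours (a : C -> R) x : (forall y, 0 <= a y) ->
  (forall y, y \notin neighbours x -> a y = 0) ->
  S (fun y => (a y)%:E) = (\sum_(y <- neighbours x) a y)%:E.
Proof.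
move=> a0 ax; rewrite (esum_fsupp (neighbours_uniq x)) ?sumEFin//.
by move=> y /ax ->.
Qed.

Lemma conductance0 x y : y \notin neighbours x -> w (val x) (val y) = 0.
Proof. by rewrite mem_neighbours; exact: conductance_nn hw _ _. Qed.

Definition energy phi u := S (fun x => (phi (val x) ^+ 2 * u x ^+ 2)%:E).

(* Symmetrising the double sum and completing the square,
   [(a^2 + b^2) u v <= a^2 u^2 + b^2 v^2 + (a - b)^2 (u^2 + v^2) / 2]. *)
Lemma energy_form_le phi c u : 0 <= c -> (forall z, 0 <= phi z) -> slowly_varying c phi ->
  (forall x, 0 <= u x) ->
  (S (fun x => (2 * phi (val x) ^+ 2 * (u x * adjacency w u x))%:E) <=
   S (fun x => (2 * phi (val x) ^+ 2 * (degree w x * u x ^+ 2))%:E) +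
   (c ^+ 2 * K)%:E * energy phi u)%E.
Proof.
move=> c0 phi0 sphi u0.
pose a x := phi (val x); pose W x y := w (val x) (val y).
have W0 x y : 0 <= W x y by exact: conductance_ge0 hw _ _.
have a0 x : 0 <= a x by exact: phi0.
have Wsym x y : W x y = W y x by exact: conductance_sym hw _ _.
pose G x y := W x y * (a x ^+ 2 * u x ^+ 2 + 2^-1 * (a x - a y) ^+ 2 * u x ^+ 2).
have G0 x y : 0 <= G x y.
  have h2 : 0 <= 2^-1 :> R by rewrite invr_ge0 ler0n.
  apply: mulr_ge0 => //; apply: addr_ge0; first by rewrite mulr_ge0 ?sqr_ge0.
  exact: mulr_ge0 (mulr_ge0 h2 (sqr_ge0 _)) (sqr_ge0 _).
have lhsE : S (fun x => (2 * phi (val x) ^+ 2 * (u x * adjacency w u x))%:E) =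
    (S (fun x => S (fun y => (W x y * (a x ^+ 2 * (u x * u y)))%:E)) +
     S (fun x => S (fun y => (W x y * (a x ^+ 2 * (u x * u y)))%:E)))%E.
  rewrite -esumD; last 2 first.
  - by move=> x _; apply: esum_ge0 => y _; rewrite lee_fin !mulr_ge0 ?sqr_ge0.
  - by move=> x _; apply: esum_ge0 => y _; rewrite lee_fin !mulr_ge0 ?sqr_ge0.
  apply: eq_esum => x _; rewrite (esum_neighbours (x := x)); last 2 first.
  - by move=> y; rewrite !mulr_ge0 ?sqr_ge0.
  - by move=> y /conductance0; rewrite /W => ->; rewrite mul0r.
  rewrite -EFinD; congr (_%:E).
  rewrite /adjacency -/(a x) (_ : \sum_(y <- neighbours x) W x y * (a x ^+ 2 * (u x * u y)) =
    a x ^+ 2 * u x * \sum_(y <- neighbours x) w (val x) (val y) * u y); first by ring.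
  by rewrite mulr_sumr; apply: eq_bigr => y _; rewrite /W; ring.
rewrite lhsE.
have swapE : S (fun x => S (fun y => (W x y * (a x ^+ 2 * (u x * u y)))%:E)) =
    S (fun x => S (fun y => (W x y * (a y ^+ 2 * (u x * u y)))%:E)).
  rewrite esum_swap; last by move=> x y; rewrite lee_fin !mulr_ge0 ?sqr_ge0.
  by apply: eq_esum => x _; apply: eq_esum => y _; rewrite Wsym (mulrC (u y)).
rewrite {2}swapE -esumD; last 2 first.
- by move=> x _; apply: esum_ge0 => y _; rewrite lee_fin !mulr_ge0 ?sqr_ge0.
- by move=> x _; apply: esum_ge0 => y _; rewrite lee_fin !mulr_ge0 ?sqr_ge0.
apply: (@le_trans _ _ (S (fun x => S (fun y => (G x y)%:E) + S (fun y => (G y x)%:E))%E)).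
  apply: le_esum => x _; rewrite -!esumD; last 4 first.
  - by move=> y _; rewrite lee_fin !mulr_ge0 ?sqr_ge0.
  - by move=> y _; rewrite lee_fin !mulr_ge0 ?sqr_ge0.
  - by move=> y _; rewrite lee_fin.
  - by move=> y _; rewrite lee_fin.
  apply: le_esum => y _; rewrite -!EFinD lee_fin -subr_ge0.
  rewrite /G (Wsym y x) (_ : _ - _ = W x y * ((a x * u x - a y * u y) ^+ 2 +
    2^-1 * ((a x - a y) * (u x - u y)) ^+ 2)); last by field.
  by rewrite mulr_ge0// addr_ge0 ?sqr_ge0// mulr_ge0 ?sqr_ge0// invr_ge0.
rewrite esumD; last 2 first.
- by move=> x _; apply: esum_ge0 => y _; rewrite lee_fin.
- by move=> x _; apply: esum_ge0 => y _; rewrite lee_fin.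
rewrite (esum_swap (a := fun x y => (G y x)%:E)); last by move=> x y; rewrite lee_fin.
have K0 : 0 <= K := le_trans ler01 K1.
rewrite /energy -esumZl; [|by rewrite mulr_ge0 ?sqr_ge0|]; last first.
  by move=> x; rewrite lee_fin mulr_ge0 ?sqr_ge0.
rewrite -!esumD; last 4 first.
- by move=> x _; rewrite lee_fin !mulr_ge0 ?sqr_ge0 ?degree_ge0.
- by move=> x _; rewrite -EFinM lee_fin !mulr_ge0.
- by move=> x _; apply: esum_ge0 => y _; rewrite lee_fin.
- by move=> x _; apply: esum_ge0 => y _; rewrite lee_fin.
apply: le_esum => x _; rewrite (esum_neighbours (x := x))//; last first.
  by move=> y /conductance0; rewrite /G /W => ->; rewrite mul0r.
rewrite -EFinM -!EFinD lee_fin -/(a x).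
have jx0 : 0 < jap x := japanese_gt0 R (val x).
(* Each squared difference is at most [(c * a x / <x>)^2], and the total conductance [K * <x>^2]
   cancels the denominator. *)
have grad : \sum_(y <- neighbours x) W x y * (a x - a y) ^+ 2 <= c ^+ 2 * K * a x ^+ 2.
  apply: (@le_trans _ _ (degree w x * (c * a x / jap x) ^+ 2)).
    rewrite mulr_suml big_seq [leRHS]big_seq; apply: ler_sum => y.
    rewrite mem_neighbours => xy; rewrite ler_wpM2l//.
    rewrite -real_normK ?num_real// -normrN opprB.
    apply: lerXn2r; rewrite ?nnegrE ?divr_ge0 ?mulr_ge0 ?(ltW jx0) ?phi0//.
    by rewrite ler_pdivlMr// sphi.
  rewrite expr_div_n exprMn mulrA ler_pdivrMr ?exprn_gt0//.
  rewrite [leRHS](_ : _ = (K * jap x ^+ 2) * (c ^+ 2 * a x ^+ 2)); last by ring.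
  by rewrite ler_wpM2r ?mulr_ge0 ?sqr_ge0// degK.
have -> : \sum_(y <- neighbours x) G x y = a x ^+ 2 * u x ^+ 2 * degree w x +
    2^-1 * u x ^+ 2 * \sum_(y <- neighbours x) W x y * (a x - a y) ^+ 2.
  rewrite /degree !mulr_sumr -big_split/=; apply: eq_bigr => y _.
  by rewrite /G /W; ring.
have := ler_wpM2r (sqr_ge0 (u x)) grad; lra.
Qed.

Variables (p : R -> C -> C -> R) (hp : heat_kernel w p).
Local Notation heat := (heat p).
Local Notation dom := (heat_dom p).

(** This is the square of [P_h f = f - h Delta f + O(h^2)]. The degree part of [2 h f Delta f] is
    moved to the left so that only nonnegative terms will be summed. The remainder is measured by
    [r = B K^2 <x>^4], the size of [Delta^2], whose square explains [<x>^8]; the constant is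
    [164 = 4 + 60 + 100], from [t1], [t2] and [t3]. *)
Lemma heat_sqr_step f B x h : (forall y, 0 <= f y <= B) -> 0 <= h <= 1 ->
  heat h f x ^+ 2 + 2 * h * (degree w x * f x ^+ 2) <=
  f x ^+ 2 + 2 * h * (f x * adjacency w f x) + h ^+ 2 * (164 * B ^+ 2 * K ^+ 4 * jap x ^+ 8).
Proof.
move=> fB /andP[h0 h1].
have f0 y : 0 <= f y by case/andP: (fB y).
have fB' y : f y <= B by case/andP: (fB y).
have fBn y : `|f y| <= B by rewrite ger0_norm.
have B0 : 0 <= B by rewrite (le_trans (f0 x)).
have K0 : 0 <= K := le_trans ler01 K1.
have sg v y : (forall z, v z = B) -> signless w v y = 2 * B * degree w y.
  move=> vB; rewrite /signless /adjacency vB.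
  under eq_bigr do rewrite vB.
  by rewrite -mulr_suml -/(degree w y); ring.
have J1 y : signless w (fun=> B) y <= 2 * B * K * jap y ^+ 2.
  rewrite sg// [leRHS](_ : _ = 2 * B * (K * jap y ^+ 2)); last by ring.
  by rewrite ler_wpM2l ?mulr_ge0.
have jx1 := japanese_ge1 R (val x).
have jx0 := japanese_gt0 R (val x).
set j := jap x in jx1 jx0 *.
have dx : degree w x <= K * j ^+ 2 by exact: degK.
have d0 : 0 <= degree w x := degree_ge0 hw x.
(* Since [<y> <= 2 <x>] for a neighbour, the factor is [10 = 2 + 8]: the degree part contributes 2,
   the adjacency part [2 * 2^2]. *)
have J2 : signless w (signless w (fun=> B)) x <= 10 * B * K ^+ 2 * j ^+ 4.
  apply: (@le_trans _ _ (signless w (fun y => 2 * B * K * jap y ^+ 2) x)).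
    exact: ler_signless.
  rewrite /signless -/j.
  apply: (@le_trans _ _ (degree w x * (2 * B * K * j ^+ 2) + degree w x * (8 * B * K * j ^+ 2))).
    rewrite lerD2l /adjacency /degree mulr_suml big_seq [leRHS]big_seq; apply: ler_sum => y.
    rewrite mem_neighbours => xy; rewrite ler_wpM2l ?(conductance_ge0 hw)//.
    rewrite [leRHS](_ : _ = 2 * B * K * (2 * j) ^+ 2); last by ring.
    rewrite ler_wpM2l ?mulr_ge0//; apply: lerXn2r; rewrite ?nnegrE ?mulr_ge0 ?(ltW jx0)//.
      exact: ltW (japanese_gt0 R _).
    exact: japanese_neighbour2.
  rewrite -mulrDr (_ : 2 * B * K * _ + _ = 10 * B * K * j ^+ 2); last by ring.
  rewrite [leRHS](_ : _ = (K * j ^+ 2) * (10 * B * K * j ^+ 2)); last by ring.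
  by apply: ler_wpM2r => //; rewrite -!mulrA mulr_ge0 ?ler0n// mulr_ge0// mulr_ge0 ?sqr_ge0.
have := bounded_heat_taylor hw hp x h0 fBn
  (fun s sh y => heat_bounded hp (proj1 (andP sh)) y fBn).
set u := heat h f x; set l := laplacian w f x => T.
have l_le : `|l| <= 2 * B * K * j ^+ 2.
  rewrite (le_trans (ler_norm_lap hw _ _))// (le_trans _ (J1 x))//.
  exact: ler_signless.
have lE : l = degree w x * f x - adjacency w f x by exact: lapE.
pose q := B * K * j ^+ 2.
pose r := B * K ^+ 2 * j ^+ 4.
have {}T : `|u - f x + h * l| <= h ^+ 2 * (10 * r).
  apply: (le_trans T); rewrite ler_wpM2l ?sqr_ge0// (le_trans J2)//.
  by rewrite [leLHS](_ : _ = 10 * r)// /r; ring.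
set e := u - f x + h * l in T.
have uE : u = f x - h * l + e by rewrite /e; ring.
rewrite uE.
have -> : f x ^+ 2 + 2 * h * (f x * adjacency w f x) =
  f x ^+ 2 + 2 * h * (degree w x * f x ^+ 2) - 2 * h * (f x * l) by rewrite lE; ring.
suff H : h ^+ 2 * l ^+ 2 + 2 * e * (f x - h * l) + e ^+ 2 <=
    h ^+ 2 * (164 * B ^+ 2 * K ^+ 4 * j ^+ 8).
  rewrite -subr_ge0 [X in 0 <= X](_ : _ = h ^+ 2 * (164 * B ^+ 2 * K ^+ 4 * j ^+ 8) -
    (h ^+ 2 * l ^+ 2 + 2 * e * (f x - h * l) + e ^+ 2)) ?subr_ge0//.
  by ring.
have K12 : 1 <= K ^+ 2 by rewrite exprn_ege1.
have j2 : 1 <= j ^+ 2 by rewrite exprn_ege1.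
have j0 : 0 <= j := ltW jx0.
have q0 : 0 <= q by rewrite /q !mulr_ge0 ?sqr_ge0.
have Kj : 1 <= K * j ^+ 2 by rewrite -[leLHS]mulr1 ler_pM.
have BQ : B <= q by rewrite /q -mulrA ler_peMr.
have qr : q <= r.
  rewrite /r (_ : _ * j ^+ 4 = q * (K * j ^+ 2)); last by rewrite /q; ring.
  by rewrite ler_peMr.
have r0 : 0 <= r := le_trans q0 qr.
have -> : 164 * B ^+ 2 * K ^+ 4 * j ^+ 8 = 164 * r ^+ 2 by rewrite /r; ring.
have t1 : l ^+ 2 <= 4 * r ^+ 2.
  rewrite -real_normK ?num_real// (_ : 4 * _ = (2 * r) ^+ 2); last by ring.
  apply: lerXn2r; rewrite ?nnegrE ?mulr_ge0//.
  by rewrite (le_trans l_le)// (_ : 2 * B * K * j ^+ 2 = 2 * q) ?ler_wpM2l// /q; ring.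
have t2 : 2 * e * (f x - h * l) <= 60 * (h ^+ 2 * r ^+ 2).
  apply: (le_trans (ler_norm _)); rewrite !normrM (ger0_norm (ler0n _ 2)).
  have fl : `|f x - h * l| <= 3 * r.
    apply: (le_trans (ler_normB _ _)); rewrite normrM (ger0_norm h0).
    have : h * `|l| <= 1 * (2 * q).
      apply: ler_pM => //; apply: (le_trans l_le); rewrite [leLHS](_ : _ = 2 * q)// /q; ring.
    by move: (fBn x) BQ qr; move: `|f x| (h * `|l|) (q) (r) => ? ? ? ?; lra.
  rewrite (_ : 60 * _ = 2 * (h ^+ 2 * (10 * r)) * (3 * r)); last by ring.
  by apply: ler_pM => //; rewrite ?mulr_ge0// ler_wpM2l.
have t3 : e ^+ 2 <= 100 * (h ^+ 2 * r ^+ 2).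
  rewrite -real_normK ?num_real//.
  apply: (@le_trans _ _ ((h ^+ 2 * (10 * r)) ^+ 2)).
    by apply: lerXn2r; rewrite ?nnegrE ?mulr_ge0 ?sqr_ge0.
  rewrite (_ : _ ^+ 2 = h ^+ 2 * (100 * (h ^+ 2 * r ^+ 2))); last by ring.
  by rewrite ler_piMl ?exprn_ile1// !mulr_ge0 ?sqr_ge0.
have := ler_wpM2l (sqr_ge0 h) t1; lra.
Qed.

Lemma energy_bounded_fin phi B f : (forall z, 0 <= phi z) -> 0 <= B ->
  (S (fun x => (phi (val x) ^+ 2 * jap x ^+ 8)%:E) < +oo)%E ->
  (forall y, 0 <= f y <= B) -> (energy phi f < +oo)%E.
Proof.
move=> phi0 B0 Zfin fB.
apply: (@le_lt_trans _ _ ((B ^+ 2)%:E * S (fun x => (phi (val x) ^+ 2 * jap x ^+ 8)%:E))%E).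
  rewrite -esumZl ?sqr_ge0//; last first.
    by move=> x; rewrite lee_fin mulr_ge0 ?sqr_ge0// exprn_ge0// ltW// japanese_gt0.
  apply: le_esum => x _; rewrite -EFinM lee_fin [leRHS]mulrCA ler_wpM2l ?sqr_ge0//.
  have /andP[f0 fB'] := fB x.
  rewrite -[leLHS]mulr1; apply: ler_pM; rewrite ?sqr_ge0//.
    by apply: lerXn2r; rewrite ?nnegrE.
  by rewrite exprn_ege1// japanese_ge1.
by rewrite lte_mul_pinfty// lee_fin sqr_ge0.
Qed.

Lemma energy_heat_step phi c f B h : 0 <= c -> (forall z, 0 <= phi z) ->
  slowly_varying c phi ->
  (S (fun x => (phi (val x) ^+ 2 * jap x ^+ 8)%:E) < +oo)%E -> 0 <= B ->
  (forall y, 0 <= f y <= B) -> 0 <= h <= 1 ->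
  (energy phi (heat h f) <= (1 + h * (c ^+ 2 * K))%:E * energy phi f +
    (h ^+ 2 * (164 * B ^+ 2 * K ^+ 4))%:E * S (fun x => (phi (val x) ^+ 2 * jap x ^+ 8)%:E))%E.
Proof.
move=> c0 phi0 sphi; set Z := S _ => Zfin B0 fB hh; have /andP[h0 h1] := hh.
have f0 y : 0 <= f y by case/andP: (fB y).
have fB' y : f y <= B by case/andP: (fB y).
have K0 : 0 <= K := le_trans ler01 K1.
have j1 x : 1 <= jap x := japanese_ge1 R (val x).
have j0 x : 0 <= jap x := le_trans ler01 (j1 x).
have M0 : 0 <= 164 * B ^+ 2 * K ^+ 4 by rewrite !mulr_ge0// exprn_ge0.
have W0 x : 0 <= adjacency w f x.
  by apply: sumr_ge0 => y _; rewrite mulr_ge0// (conductance_ge0 hw).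
have d0 x : 0 <= degree w x := degree_ge0 hw x.
have p20 z : 0 <= phi z ^+ 2 := sqr_ge0 _.
pose D := S (fun x => (2 * phi (val x) ^+ 2 * (degree w x * f x ^+ 2))%:E).
pose Q := S (fun x => (2 * phi (val x) ^+ 2 * (f x * adjacency w f x))%:E).
have D0 : (0 <= D)%E by apply: esum_ge0T => x; rewrite lee_fin !mulr_ge0.
have f2B x : f x ^+ 2 <= B ^+ 2 by apply: lerXn2r; rewrite ?nnegrE.
(* Finiteness is what allows [D] to be cancelled between [step] and [Qle] at the end. *)
have Dfin : (D < +oo)%E.
  apply: (@le_lt_trans _ _ ((2 * K * B ^+ 2)%:E * Z)%E); last first.
    by rewrite lte_mul_pinfty// lee_fin !mulr_ge0.
  rewrite /D -esumZl ?mulr_ge0//; last by move=> x; rewrite lee_fin mulr_ge0// exprn_ge0.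
  apply: le_esum => x _; rewrite -EFinM lee_fin.
  rewrite [leRHS](_ : _ = 2 * phi (val x) ^+ 2 * (K * jap x ^+ 8 * B ^+ 2)); last by ring.
  rewrite ler_wpM2l ?mulr_ge0//; apply: ler_pM; rewrite ?sqr_ge0//.
  by rewrite (le_trans (degK x))// ler_wpM2l// ler_weXn2l.
have step : (energy phi (heat h f) + h%:E * D <= energy phi f + h%:E * Q +
    (h ^+ 2 * (164 * B ^+ 2 * K ^+ 4))%:E * Z)%E.
  rewrite /energy /D /Q /Z -!esumZl// ?mulr_ge0 ?sqr_ge0//; last 3 first.
  - by move=> x; rewrite lee_fin mulr_ge0// exprn_ge0.
  - by move=> x; rewrite lee_fin !mulr_ge0.
  - by move=> x; rewrite lee_fin !mulr_ge0.
  rewrite -!esumD; last 6 first.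
  - by move=> x _; rewrite -EFinD lee_fin addr_ge0 ?mulr_ge0.
  - by move=> x _; rewrite -EFinM lee_fin mulr_ge0 ?mulr_ge0 ?sqr_ge0 ?exprn_ge0.
  - by move=> x _; rewrite lee_fin mulr_ge0 ?sqr_ge0.
  - by move=> x _; rewrite -EFinM lee_fin !mulr_ge0.
  - by move=> x _; rewrite lee_fin mulr_ge0 ?sqr_ge0.
  - by move=> x _; rewrite -EFinM lee_fin !mulr_ge0.
  apply: le_esum => x _; rewrite -!EFinM -!EFinD lee_fin.
  have := ler_wpM2l (p20 (val x)) (heat_sqr_step x fB hh).
  set A := phi _ ^+ 2; rewrite !mulrDr.
  by rewrite [X in _ + X <= _](_ : _ = h * (2 * A * (degree w x * f x ^+ 2))) ?
    [X in _ + X + _](_ : _ = h * (2 * A * (f x * adjacency w f x)))?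
    [X in _ <= _ + X](_ : _ = h ^+ 2 * (164 * B ^+ 2 * K ^+ 4) * (A * jap x ^+ 8)) //; ring.
have f_fin := energy_bounded_fin phi0 B0 Zfin fB.
have u_fin : (energy phi (heat h f) < +oo)%E.
  apply: (energy_bounded_fin phi0 B0 Zfin) => y.
  have bnd : `|heat h f y| <= B by apply: (heat_bounded hp) => // z; rewrite ger0_norm.
  have := ge0_heat hp h0 y f0 (heat_dom_bounded hp (B := B) _) => ->.
    by rewrite (le_trans (ler_norm _)).
  by move=> z; rewrite ger0_norm.
have en0 v : (0 <= energy phi v)%E.
  by apply: esum_ge0T => x; rewrite lee_fin mulr_ge0 ?sqr_ge0.
have Z0 : (0 <= Z)%E by apply: esum_ge0T => x; rewrite lee_fin mulr_ge0// exprn_ge0.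
have Q0 : (0 <= Q)%E by apply: esum_ge0T => x; rewrite lee_fin !mulr_ge0.
have Qle : (Q <= D + (c ^+ 2 * K)%:E * energy phi f)%E by exact: energy_form_le.
have Qfin : (Q < +oo)%E.
  apply: (le_lt_trans Qle); rewrite lte_add_pinfty// lte_mul_pinfty// lee_fin.
  by rewrite mulr_ge0 ?sqr_ge0.
move: step Qle.
have [z _ ->] := ge0_lty_ex Z0 Zfin; have [dd _ ->] := ge0_lty_ex D0 Dfin.
have [q _ ->] := ge0_lty_ex Q0 Qfin; have [e0 _ ->] := ge0_lty_ex (en0 _) f_fin.
have [e1 _ ->] := ge0_lty_ex (en0 _) u_fin.
rewrite -!EFinM -!EFinD !lee_fin => st Qle.
have := ler_wpM2l h0 Qle; lra.
Qed.

(** Iterate the step [n] times with [h = t / n]. The growth factors multiply to at most [exp (k t)],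
    while the quadratic errors add up to [n h^2 = t^2 / n], up to constants. The bound [B] and the
    sum against [<x>^8] occur only in this vanishing error. *)
Lemma energy_heat_bounded phi c f B t : 0 <= c -> (forall z, 0 <= phi z) ->
  slowly_varying c phi ->
  (S (fun x => (phi (val x) ^+ 2 * jap x ^+ 8)%:E) < +oo)%E -> 0 <= B ->
  (forall y, 0 <= f y <= B) -> 0 <= t ->
  (energy phi (heat t f) <= (expR (c ^+ 2 * K * t))%:E * energy phi f)%E.
Proof.
move=> c0 phi0 sphi Zfin B0 fB t0.
have f0 y : 0 <= f y by case/andP: (fB y).
have fB' y : f y <= B by case/andP: (fB y).
have fBn y : `|f y| <= B by rewrite ger0_norm.
have K0 : 0 <= K := le_trans ler01 K1.
have df := heat_dom_bounded hp fBn.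
have uB s y : 0 <= s -> 0 <= heat s f y <= B.
  move=> s0; rewrite (ge0_heat hp)//=.
  by rewrite (le_trans (ler_norm _))// (heat_bounded hp).
pose z := fine (S (fun x => (phi (val x) ^+ 2 * jap x ^+ 8)%:E)).
have ZE : S (fun x => (phi (val x) ^+ 2 * jap x ^+ 8)%:E) = z%:E.
  rewrite fineK// ge0_fin_numE// esum_ge0T// => x.
  by rewrite lee_fin mulr_ge0 ?sqr_ge0// exprn_ge0// ltW// japanese_gt0.
have z0 : 0 <= z.
  rewrite -lee_fin -ZE esum_ge0T// => x.
  by rewrite lee_fin mulr_ge0 ?sqr_ge0// exprn_ge0// ltW// japanese_gt0.
have en0 v : (0 <= energy phi v)%E.
  by apply: esum_ge0T => x; rewrite lee_fin mulr_ge0 ?sqr_ge0.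
pose E s := fine (energy phi (heat s f)).
have EE s : 0 <= s -> energy phi (heat s f) = (E s)%:E.
  move=> s0; rewrite fineK// ge0_fin_numE//.
  by apply: (energy_bounded_fin phi0 B0 Zfin) => y; exact: uB.
have E0 s : 0 <= s -> 0 <= E s by move=> s0; rewrite -lee_fin -EE.
pose M := 164 * B ^+ 2 * K ^+ 4.
have M0 : 0 <= M by rewrite !mulr_ge0// exprn_ge0.
pose k := c ^+ 2 * K.
have k0 : 0 <= k by rewrite mulr_ge0 ?sqr_ge0.
have -> : energy phi f = (E 0)%:E by rewrite -EE// (heat0 hp).
rewrite EE// -EFinM lee_fin -/k.
apply/ler_addgt0Pr => e e0.
(* The first summand ensures [h <= 1], the second brings the accumulated error below [e]. *)
pose n := (Num.truncn (t + expR (k * t) * (t ^+ 2 * M * z) / e)).+1.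
have n0 : (0 : R) < n%:R by rewrite ltr0n.
have A0 : 0 <= expR (k * t) * (t ^+ 2 * M * z).
  by rewrite !mulr_ge0 ?expR_ge0.
have nlt : t + expR (k * t) * (t ^+ 2 * M * z) / e < n%:R by rewrite truncnS_gt.
pose h := t / n%:R.
have h0 : 0 <= h by rewrite divr_ge0// ltW.
have h1 : h <= 1.
  rewrite ler_pdivrMr// mul1r (le_trans _ (ltW nlt))// lerDl divr_ge0// ltW//.
have a1 : 1 <= 1 + h * k by rewrite lerDl mulr_ge0.
have main j : E (j%:R * h) <= (1 + h * k) ^+ j * (E 0 + j%:R * (h ^+ 2 * M * z)).
  elim: j => [|j IH]; first by rewrite !mul0r expr0 addr0 mul1r.
  have jh0 : 0 <= j%:R * h by rewrite mulr_ge0.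
  have := @energy_heat_step phi c (heat (j%:R * h) f) B h c0 phi0 sphi Zfin B0
    (fun y => uB _ y jh0).
  rewrite h0 h1 => /(_ isT).
  rewrite (heat_heat hp)// ZE (_ : h + _ = j.+1%:R * h); last by rewrite -natr1; ring.
  rewrite !EE ?mulr_ge0// -!EFinM -EFinD lee_fin -/k -/M.
  move=> /le_trans; apply.
  apply: (@le_trans _ _ ((1 + h * k) * ((1 + h * k) ^+ j * (E 0 + j%:R * (h ^+ 2 * M * z))) +
    (1 + h * k) ^+ j.+1 * (h ^+ 2 * M * z))).
    apply: lerD; first by rewrite ler_wpM2l// (le_trans ler01).
    by rewrite ler_peMl ?exprn_ege1// !mulr_ge0.
  rewrite -natr1 (exprS _ j).
  have -> : forall a b e y q : R, a * (b * (e + y * q)) + a * b * q = a * b * (e + (y + 1) * q).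
    by move=> *; ring.
  exact: lexx.
have := main n; have nh : n%:R * h = t by rewrite mulrC divfK// gt_eqF.
rewrite nh => /le_trans; apply.
have ple : (1 + h * k) ^+ n <= expR (k * t).
  rewrite -nh (_ : k * _ = n%:R * (h * k)); last by ring.
  rewrite expRM_natl; apply: lerXn2r; rewrite ?nnegrE ?expR_ge0 ?(le_trans ler01)//.
  exact: expR_ge1Dx.
apply: (@le_trans _ _ (expR (k * t) * (E 0 + n%:R * (h ^+ 2 * M * z)))).
  by rewrite ler_wpM2r// addr_ge0 ?E0 ?mulr_ge0.
rewrite mulrDr lerD2l.
rewrite (_ : _ * _ = expR (k * t) * (t ^+ 2 * M * z) / n%:R); last first.
  by rewrite -nh; field; rewrite gt_eqF.
have : expR (k * t) * (t ^+ 2 * M * z) / e <= n%:R by rewrite (le_trans _ (ltW nlt))// lerDr.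
by rewrite !ler_pdivrMr// (mulrC e).
Qed.

End Energy.

(** * The semigroup on weighted spaces *)

Section WeightedSpaces.
Variables (R : realType) (d : nat) (C : set (Zd d)).
Implicit Types (f g u : C -> R) (x y : C) (N c s t h e : R).

Local Notation S a := (\esum_(x in [set: C]) a x)%E.
Local Notation jap x := (japanese R (val x)).

Definition weight N (z : Zd d) : R := japanese R z `^ (- N).

Lemma weight_gt0 N z : 0 < weight N z.
Proof. by rewrite powR_gt0// japanese_gt0. Qed.

Lemma weight_le1 N z : 0 <= N -> weight N z <= 1.
Proof.
move=> N0; rewrite /weight powRN invf_le1 ?powR_gt0 ?japanese_gt0//.
by rewrite -[leLHS](powRr0 (japanese R z)) ler_powR// japanese_ge1.
Qed.

Lemma sqnormHE N f : sqnormH N f = energy (weight N) f.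
Proof.
apply: eq_esum => x _; rewrite real_normK ?num_real//; congr ((_ * _)%:E).
by rewrite /weight -powR_mulrn ?powR_ge0// -powRrM; congr (_ `^ _); ring.
Qed.

Lemma sqnormH_ge0 N f : (0 <= sqnormH N f)%E.
Proof. by apply: esum_ge0T => x; rewrite lee_fin mulr_ge0 ?powR_ge0 ?exprn_ge0. Qed.

Lemma sqnormH_norm N f g : (forall x, `|f x| <= `|g x|) -> (sqnormH N f <= sqnormH N g)%E.
Proof.
move=> fg; apply: le_esum => x _; rewrite lee_fin ler_wpM2l ?powR_ge0//.
by apply: lerXn2r; rewrite ?nnegrE.
Qed.

Lemma in_HW N f g : (forall x, `|f x| <= `|g x|) -> in_H N g -> in_H N f.
Proof. by move=> fg; apply: le_lt_trans; exact: sqnormH_norm. Qed.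

Lemma sqnormHZ N c f : sqnormH N (fun x => c * f x) = ((c ^+ 2)%:E * sqnormH N f)%E.
Proof.
rewrite /sqnormH -esumZl ?sqr_ge0//; last first.
  by move=> x; rewrite lee_fin mulr_ge0 ?powR_ge0 ?exprn_ge0.
apply: eq_esum => x _; rewrite -EFinM; congr (_%:E).
by rewrite normrM exprMn real_normK ?num_real// mulrCA.
Qed.

Lemma sqnormHD N f g : (sqnormH N (fun x => (f x + g x)%R) <=
  2%:E * (sqnormH N f + sqnormH N g))%E.
Proof.
have pos u x : (0 <= (jap x `^ (-2 * N) * `|u x| ^+ 2)%:E)%E.
  by rewrite lee_fin mulr_ge0 ?powR_ge0 ?exprn_ge0.
rewrite /sqnormH -esumD// -esumZl//; last by move=> x; rewrite adde_ge0.
apply: le_esum => x _; rewrite -EFinD -EFinM lee_fin -mulrDr [leRHS]mulrCA ler_wpM2l ?powR_ge0//.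
rewrite !real_normK ?num_real// -subr_ge0.
by rewrite (_ : _ - _ = (f x - g x) ^+ 2) ?sqr_ge0//; ring.
Qed.

Lemma in_HD N f g : in_H N f -> in_H N g -> in_H N (fun x => f x + g x).
Proof.
move=> hf hg; apply: (le_lt_trans (sqnormHD _ _ _)).
by rewrite lte_mul_pinfty// lte_add_pinfty.
Qed.

Lemma in_HZ N c f : in_H N f -> in_H N (fun x => c * f x).
Proof. by move=> hf; rewrite /in_H sqnormHZ lte_mul_pinfty// lee_fin sqr_ge0. Qed.

Lemma in_H_pointwise N f (Y : R) x : (sqnormH N f <= Y%:E)%E ->
  `|f x| <= jap x `^ N * Num.sqrt Y.
Proof.
move=> fY; have := le_trans (le_esum_term (fun x => (jap x `^ (-2 * N) * `|f x| ^+ 2)%:E) x) fY.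
rewrite lee_fin => H.
have j0 : 0 < jap x `^ N by rewrite powR_gt0// japanese_gt0.
have Y0 : 0 <= Y by rewrite -lee_fin (le_trans (sqnormH_ge0 N f)).
rewrite mulrC -ler_pdivrMr// -(@ler_pXn2r _ 2)// ?nnegrE ?divr_ge0 ?sqrtr_ge0 ?(ltW j0)//.
rewrite sqr_sqrtr// (le_trans _ H)// expr_div_n mulrC.
suff -> : jap x `^ (- 2 * N) = (jap x `^ N) ^- 2 by [].
rewrite (_ : - 2 * N = - (N * 2%:R)); last by ring.
by rewrite powRN powRrM powR_mulrn// ltW.
Qed.

(** Sums over the component are compared with sums over the lattice along the injection [val]. *)
Lemma esum_val (g : Zd d -> \bar R) : (forall z, 0 <= g z)%E ->
  (S (fun x => g (val x)) <= \esum_(z in [set: Zd d]) g z)%E.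
Proof.
move=> g0; apply: esum_le_ub => F.
apply: le_trans (le_fset_esum g [fset val x | x in F]%fset).
by rewrite big_imfset//= => a b _ _; exact: val_inj.
Qed.

Lemma summable_weight (m : nat) : (2 * d <= m)%N -> (S (fun x => (jap x ^- m)%:E) < +oo)%E.
Proof.
move=> dm; apply: (@le_lt_trans _ _ (6 ^+ d)%:E); last exact: ltry.
apply: le_trans (summable_japanese R d).
apply: (@le_trans _ _ (S (fun x => (jap x ^- (2 * d))%:E))).
  apply: le_esum => x _; rewrite lee_fin lef_pV2 ?posrE ?exprn_gt0 ?japanese_gt0//.
  by rewrite ler_weXn2l// japanese_ge1.
by apply: esum_val => z; rewrite lee_fin invr_ge0 exprn_ge0// ltW// japanese_gt0.
Qed.

(* The cut-off makes the weight summable against any power of [<x>], while its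
   slow variation stays uniform in [e]. *)
Definition cutoff_weight N e (z : Zd d) : R :=
  weight N z * (1 + e * japanese R z ^+ 2)^-1 ^+ (d + 4).

Lemma cutoff_weight_slow N : 0 <= N -> exists2 c, 0 <= c &
  forall e, 0 <= e -> slowly_varying c (cutoff_weight N e).
Proof.
move=> N0; have [c c0 sc] := slowly_varying_powR d N0.
pose b : R := (1 + 12) ^+ (d + 4) - 1.
have b0 : 0 <= b by rewrite subr_ge0 exprn_ege1// lerDl.
exists (c * (1 + b) + b); first by rewrite addr_ge0// mulr_ge0// addr_ge0.
move=> e e0; apply: slowly_varyingM => //.
- by move=> z; rewrite ltW// weight_gt0.
- by move=> z; rewrite exprn_ge0// invr_ge0 addr_ge0// mulr_ge0// sqr_ge0.
apply: slowly_varyingX => //; last exact: slowly_varying_inv.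
by move=> z; rewrite invr_ge0 addr_ge0// mulr_ge0// sqr_ge0.
Qed.

Lemma cutoff_weight_ge0 N e z : 0 <= e -> 0 <= cutoff_weight N e z.
Proof.
move=> e0; rewrite mulr_ge0// ?(ltW (weight_gt0 _ _))//.
by rewrite exprn_ge0// invr_ge0 addr_ge0// mulr_ge0// sqr_ge0.
Qed.

Lemma cutoff_weight_le N e z : 0 <= e -> cutoff_weight N e z <= weight N z.
Proof.
move=> e0; have ej : 0 <= e * japanese R z ^+ 2 by rewrite mulr_ge0 ?sqr_ge0.
rewrite ler_piMr ?(ltW (weight_gt0 _ _))// exprn_ile1 ?invr_ge0 ?addr_ge0//.
by rewrite invf_le1 ?lerDl// ltr_wpDr.
Qed.

(** With [k = d + 4], the squared cut-off is at most [(e <x>^2)^(-2k)]. Against [<x>^8] there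
    remains the power [4k - 8 = 4d + 8] of [1 / <x>], above the summable exponent [2d]. *)
Lemma cutoff_weight_summable N e : 0 <= N -> 0 < e ->
  (S (fun x => (cutoff_weight N e (val x) ^+ 2 * jap x ^+ 8)%:E) < +oo)%E.
Proof.
move=> N0 e0; pose k := (d + 4)%N.
apply: (@le_lt_trans _ _ ((e ^- (2 * k))%:E * S (fun x => (jap x ^- (4 * k - 8))%:E))%E); last first.
  rewrite lte_mul_pinfty// ?lee_fin ?invr_ge0 ?exprn_ge0 ?(ltW e0)//.
  by apply: summable_weight; rewrite /k; lia.
rewrite -esumZl ?invr_ge0 ?exprn_ge0 ?(ltW e0)//; last first.
  by move=> x; rewrite lee_fin invr_ge0 exprn_ge0// ltW// japanese_gt0.
apply: le_esum => x _; rewrite -EFinM lee_fin.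
have j0 := japanese_gt0 R (val x); set j := jap x in j0 *.
have ej0 : 0 < e * j ^+ 2 by rewrite mulr_gt0// exprn_gt0.
apply: (@le_trans _ _ (((e * j ^+ 2)^-1 ^+ k) ^+ 2 * j ^+ 8)).
  rewrite ler_wpM2r ?exprn_ge0 ?(ltW j0)//; apply: lerXn2r;
    rewrite ?nnegrE ?cutoff_weight_ge0 ?(ltW e0)// ?exprn_ge0 ?invr_ge0 ?(ltW ej0)//.
  rewrite /cutoff_weight -/k -[leRHS]mul1r; apply: ler_pM.
  - exact: ltW (weight_gt0 _ _).
  - by rewrite exprn_ge0// invr_ge0 addr_ge0// ltW.
  - exact: weight_le1.
  apply: lerXn2r; rewrite ?nnegrE ?invr_ge0 ?addr_ge0 ?(ltW ej0)//.
  by rewrite lef_pV2 ?posrE ?lerDr// ltr_wpDl// ltW.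
rewrite le_eqVlt; apply/orP; left; apply/eqP.
have -> : j ^- (4 * k - 8) = j ^- (4 * k) * j ^+ 8.
  by rewrite exprB ?unitfE ?gt_eqF// ?/k; [rewrite invfM invrK|lia].
by rewrite -exprM exprVn exprMn -exprM invfM (mulnC k 2%N) (mulnA 2 2 k)%N -mulrA.
Qed.

(** By convexity the power lies below its chord over [[0, 1]]. *)
Lemma expr1D_le (a : R) m : 0 <= a <= 1 -> (1 + a) ^+ m <= 1 + (2 ^+ m - 1) * a.
Proof.
move=> /andP[a0 a1]; elim: m => [|m IH]; first by rewrite !expr0 subrr mul0r addr0.
have m1 : 1 <= (2 : R) ^+ m by rewrite exprn_ege1// ler1n.
rewrite !exprS; apply: (le_trans (ler_wpM2l _ IH)); first by lra.
rewrite -subr_ge0 (_ : _ - _ = (2 ^+ m - 1) * (a * (1 - a))); last by ring.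
by rewrite !mulr_ge0// subr_ge0.
Qed.

(** On a finite set [F] with [<x>^2 <= G], the parameter [a / G] keeps the squared cut-off above
    [(1 + a)^(-m)]. The resulting factor [(1 + a)^m] tends to 1 with [a]. *)
Lemma energy_cutoff_limit N u (Y : R) : 0 <= Y ->
  (forall e : R, 0 < e -> (energy (cutoff_weight N e) u <= Y%:E)%E) -> (energy (weight N) u <= Y%:E)%E.
Proof.
move=> Y0 HY; apply: esum_le_ub => F; rewrite sumEFin lee_fin.
pose G := 1 + \sum_(x <- F) jap x ^+ 2.
have G1 : 1 <= G by rewrite lerDl sumr_ge0// => x _; rewrite sqr_ge0.
have G0 : 0 < G by rewrite (lt_le_trans ltr01).
have jG x : x \in F -> jap x ^+ 2 <= G.
  move=> xF; rewrite /G (big_fsetD1 x)//= addrCA lerDl addr_ge0// sumr_ge0// => y _.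
  by rewrite sqr_ge0.
pose m := (2 * (d + 4))%N; pose q : R := 2 ^+ m - 1.
have q0 : 0 <= q by rewrite subr_ge0 exprn_ege1// ler1n.
apply/ler_addgt0Pr => e e0.
pose a := Num.min 1 (e / (q * Y + 1)).
have qY : 0 < q * Y + 1 by rewrite ltr_wpDl// mulr_ge0.
have a0 : 0 < a by rewrite lt_min ltr01 divr_gt0.
have a1 : a <= 1 by rewrite ge_min lexx.
have aq : q * a * Y <= e.
  apply: (@le_trans _ _ (q * (e / (q * Y + 1)) * Y)).
    by rewrite ler_wpM2r// ler_wpM2l// ge_min lexx orbT.
  rewrite (_ : _ * Y = e * (q * Y / (q * Y + 1))); last by ring.
  by rewrite ler_piMr ?(ltW e0)// ler_pdivrMr// mul1r lerDl.
have aG : 0 < a / G by rewrite divr_gt0.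
have := le_trans (le_fset_esum (fun x => (cutoff_weight N (a / G) (val x) ^+ 2 * u x ^+ 2)%:E) F)
  (HY _ aG).
rewrite sumEFin lee_fin => H.
apply: (@le_trans _ _ ((1 + a) ^+ m * \sum_(x <- F) cutoff_weight N (a / G) (val x) ^+ 2 * u x ^+ 2)).
  rewrite mulr_sumr big_seq [leRHS]big_seq; apply: ler_sum => x xF.
  rewrite [leRHS]mulrA ler_wpM2r ?sqr_ge0// /cutoff_weight exprMn [leRHS]mulrCA ler_peMr ?sqr_ge0//.
  rewrite -exprM (mulnC _ 2) -/m -exprMn exprn_ege1//.
  have pj : 0 < 1 + a / G * jap x ^+ 2 by rewrite ltr_wpDr// mulr_ge0 ?sqr_ge0// ltW.
  rewrite ler_pdivlMr// mul1r lerD2l mulrAC ler_pdivrMr// ler_wpM2l ?jG// ltW//.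
apply: (@le_trans _ _ ((1 + q * a) * Y)).
  apply: ler_pM => //; first by rewrite exprn_ge0// addr_ge0// ltW.
    by apply: sumr_ge0 => x _; rewrite mulr_ge0 ?sqr_ge0.
  by apply: expr1D_le; rewrite (ltW a0).
by rewrite mulrDl mul1r lerD2l.
Qed.

End WeightedSpaces.

(** * Growth and expansion of the semigroup on weighted spaces *)

Section HeatWeighted.
Variables (R : realType) (d : nat) (C : set (Zd d)).
Variables (w : Zd d -> Zd d -> R) (hw : conductances w).
Variables (K : R) (K1 : 1 <= K).
Hypothesis degK : forall x : C, degree w x <= K * japanese R (val x) ^+ 2.
Variables (p : R -> C -> C -> R) (hp : heat_kernel w p).
Implicit Types (f g u : C -> R) (x y : C) (c s t h e B : R).

Local Notation S a := (\esum_(x in [set: C]) a x)%E.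
Local Notation jap x := (japanese R (val x)).
Local Notation heat := (heat p).
Local Notation dom := (heat_dom p).

Lemma heat_in_H_bounded N : 0 <= N -> exists2 c, 0 <= c & forall f B t,
  (forall y, 0 <= f y <= B) -> in_H N f -> 0 <= t ->
  (sqnormH N (heat t f) <= (expR (c * t))%:E * sqnormH N f)%E.
Proof.
move=> N0; have [c c0 sc] := cutoff_weight_slow d N0.
have K0 : 0 <= K := le_trans ler01 K1.
exists (c ^+ 2 * K); first by rewrite mulr_ge0 ?sqr_ge0.
move=> f B t fB fH t0.
have [Y Y0 YE] := ge0_lty_ex (sqnormH_ge0 N f) fH.
have B0 x : 0 <= B by case/andP: (fB x) => /le_trans; apply.
rewrite YE -EFinM sqnormHE; apply: energy_cutoff_limit.
  by rewrite mulr_ge0 ?expR_ge0.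
(* The sign of [B] is read off at a point of [C]; if [C] is empty, the energy is an empty sum. *)
move=> e e0; have [[x _]|none] := pselect (exists x : C, True); last first.
  rewrite /energy esum1 ?lee_fin ?mulr_ge0 ?expR_ge0// => x.
  by case: none; exists x.
have := energy_heat_bounded hw K1 degK hp c0
  (fun z => cutoff_weight_ge0 N z (ltW e0)) (sc e (ltW e0))
  (cutoff_weight_summable C N0 e0) (B0 x) fB t0.
move=> /le_trans; apply; rewrite EFinM lee_wpmul2l ?lee_fin ?expR_ge0// -YE sqnormHE.
apply: le_esum => y _; rewrite lee_fin ler_wpM2r ?sqr_ge0//.
apply: lerXn2r; rewrite ?nnegrE ?cutoff_weight_ge0 ?cutoff_weight_le ?(ltW e0)//.
exact: ltW (weight_gt0 _ _).
Qed.

(** Even the convergence of [P_t f] has to be shown. Restrictions of [f] to finite sets are bounded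
    and their images have norms bounded uniformly, hence so are their values at a point, which are
    the partial sums of the series. *)
Lemma heat_in_H_ge0 N : 0 <= N -> exists2 c, 0 <= c & forall f,
  (forall y, 0 <= f y) -> in_H N f -> dom f /\ forall t, 0 <= t ->
  (sqnormH N (heat t f) <= (expR (c * t))%:E * sqnormH N f)%E.
Proof.
move=> N0; have [c c0 Hc] := heat_in_H_bounded N0; exists c => // f f0 fH.
have [Y Y0 YE] := ge0_lty_ex (sqnormH_ge0 N f) fH.
have below g B t : (forall y, 0 <= g y <= f y) -> (forall y, g y <= B) -> 0 <= t ->
    (sqnormH N (heat t g) <= (expR (c * t) * Y)%:E)%E.
  move=> gf gB t0; have gH : in_H N g.
    by apply: in_HW fH => y; have /andP[g0 gfy] := gf y; rewrite !ger0_norm.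
  have := Hc g B t _ gH t0; move=> /(_ _)/le_trans; apply.
    by move=> y; have /andP[-> _] := gf y; rewrite gB.
  rewrite EFinM lee_wpmul2l ?lee_fin ?expR_ge0// -YE.
  by apply: sqnormH_norm => y; have /andP[g0 gfy] := gf y; rewrite !ger0_norm.
have df : dom f.
  move=> t x t0; rewrite /abs_summable.
  apply: (@le_lt_trans _ _ (jap x `^ N * Num.sqrt (expR (c * t) * Y))%:E); last exact: ltry.
  apply: esum_le_ub => F.
  pose g y := if y \in F then f y else 0.
  have gf y : 0 <= g y <= f y by rewrite /g; case: ifP => _; rewrite ?lexx f0.
  have gB y : g y <= \sum_(y <- F) f y.
    rewrite /g; case: ifP => yG; last exact: sumr_ge0.
    by rewrite (big_fsetD1 y)//= lerDl sumr_ge0.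
  have := in_H_pointwise x (below g _ t gf gB t0).
  rewrite /heat (@real_sum_fsupp _ _ _ _ F) ?fset_uniq//; last first.
    by move=> y yG; rewrite /g (negPf yG) mulr0.
  move=> /(le_trans (ler_norm _)); rewrite sumEFin lee_fin; apply: le_trans.
  rewrite le_eqVlt; apply/orP; left; apply/eqP; apply: eq_big_seq => y yF.
  by rewrite /g yF ger0_norm// mulr_ge0// (heat_ge0 hp).
split=> // t t0; rewrite YE -EFinM sqnormHE; apply: esum_le_ub => F.
rewrite sumEFin lee_fin; apply/ler_addgt0Pr => e e0.
(* From [v <= u <= v + k] follows [u^2 <= v^2 + 2 k u]; [A] is the weighted sum of the [2 u], and
   [k = e / (A + 1)]. *)
pose A := 2 * \sum_(x <- F) weight N (val x) ^+ 2 * heat t f x.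
have u0 x : 0 <= heat t f x by exact: (ge0_heat hp).
have A0 : 0 <= A by rewrite mulr_ge0// sumr_ge0// => x _; rewrite mulr_ge0 ?sqr_ge0.
have A1 : 0 < A + 1 by rewrite ltr_wpDl.
have e1 : 0 < e / (A + 1) by rewrite divr_gt0.
have [g [B [gf gB _ gu]]] := heat_truncation hp F t0 f0 df e1.
have := le_trans (le_fset_esum (fun x => (weight N (val x) ^+ 2 * heat t g x ^+ 2)%:E) F) _.
move=> /(_ (expR (c * t) * Y)%:E); rewrite -[esum _ _]/(energy (weight N) (heat t g)) -sqnormHE.
move=> /(_ (below g B t gf gB t0)); rewrite sumEFin lee_fin => H.
apply: (@le_trans _ _ (\sum_(x <- F) weight N (val x) ^+ 2 * heat t g x ^+ 2 + e / (A + 1) * A)).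
  rewrite /A [X in _ + X](_ : _ = \sum_(x <- F) (e / (A + 1) * (2 * (weight N (val x) ^+ 2 * heat t f x)))); last first.
    by rewrite -!mulr_sumr.
  rewrite -big_split/= big_seq [leRHS]big_seq; apply: ler_sum => x xF.
  have /andP[ug1 ug2] := gu x xF.
  rewrite [leRHS](_ : _ = weight N (val x) ^+ 2 * (heat t g x ^+ 2 + 2 * (e / (A + 1)) * heat t f x)); last by ring.
  rewrite ler_wpM2l ?sqr_ge0//.
  have dg : dom g by apply: heat_domW df => y; have /andP[g0 gfy] := gf y; rewrite !ger0_norm.
  have v0 : 0 <= heat t g x.
    by apply: (ge0_heat hp) => // y; case/andP: (gf y).
  move: (u0 x) v0 ug1 ug2 (ltW e1); move: (heat t f x) (heat t g x) (e / _) => a b k.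
  nra.
apply: lerD => //.
by rewrite mulrAC ler_pdivrMr// ler_wpM2l ?(ltW e0)// lerDl.
Qed.

Theorem heat_in_H N : 0 <= N -> exists2 c, 0 <= c & forall f, in_H N f ->
  dom f /\ forall t, 0 <= t ->
  (sqnormH N (heat t f) <= (expR (c * t))%:E * sqnormH N f)%E.
Proof.
move=> N0; have [c c0 Hc] := heat_in_H_ge0 N0; exists c => // f fH.
have faH : in_H N (fun y => `|f y|) by apply: in_HW fH => y; rewrite normr_id.
have [da Ha] := Hc _ (fun y => normr_ge0 (f y)) faH.
have df : dom f by apply: heat_domW da => y; rewrite normr_id.
split=> // t t0; apply: (@le_trans _ _ (sqnormH N (heat t (fun y => `|f y|)))).
  apply: sqnormH_norm => x; rewrite [leRHS]ger0_norm ?(ler_norm_heat hp)//.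
  by apply: (ge0_heat hp).
apply: (le_trans (Ha t t0)); rewrite lee_wpmul2l ?lee_fin ?expR_ge0//.
by apply: sqnormH_norm => y; rewrite normr_id.
Qed.

Lemma signless_powR a x : 0 <= a ->
  signless w (fun y => jap y `^ a) x <= K * (1 + 2 `^ a) * jap x `^ (a + 2).
Proof.
move=> a0; have K0 : 0 <= K := le_trans ler01 K1.
have j0 y : 0 < jap y := japanese_gt0 R (val y).
have -> : jap x `^ (a + 2) = jap x ^+ 2 * jap x `^ a.
  rewrite powRD; last by rewrite (gt_eqF (j0 x)) implybT.
  by rewrite mulrC -[2]/(2%:R) powR_mulrn// ltW.
apply: (@le_trans _ _ (degree w x * ((1 + 2 `^ a) * jap x `^ a))).
  rewrite mulrDl mul1r mulrDr lerD2l /adjacency /degree mulr_suml big_seq [leRHS]big_seq.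
  apply: ler_sum => y; rewrite mem_neighbours => xy.
  rewrite ler_wpM2l ?(conductance_ge0 hw)// -powRM//; last exact: ltW.
  rewrite ge0_ler_powR ?nnegrE ?mulr_ge0 ?(ltW (j0 _))//.
  exact: japanese_neighbour2.
rewrite [leRHS](_ : _ = K * jap x ^+ 2 * ((1 + 2 `^ a) * jap x `^ a)); last by ring.
by rewrite ler_wpM2r// mulr_ge0 ?addr_ge0 ?powR_ge0.
Qed.

(** For times up to 1 the norm bound gives [|P_s g (y)| <= b y] with [b] of order [<y>^N]. Each
    application of [signless] raises the exponent by 2, whence [N + 4] for the remainder. The factor
    2 in [A] accounts for the positive and the negative part. *)
Theorem heat_taylor_H N : 0 <= N -> exists2 A : R, 0 <= A & forall f (Y : R) h x,
  (sqnormH N f <= (Y ^+ 2)%:E)%E -> 0 <= Y -> 0 <= h <= 1 ->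
  `|heat h f x - f x| <= h * (A * jap x `^ (N + 4) * Y) /\
  `|heat h f x - f x + h * laplacian w f x| <= h ^+ 2 * (A * jap x `^ (N + 4) * Y).
Proof.
move=> N0; have [c c0 Hc] := heat_in_H N0.
have K0 : 0 <= K := le_trans ler01 K1.
pose k := Num.sqrt (expR c); have k0 : 0 <= k by exact: sqrtr_ge0.
pose a1 := K * (1 + 2 `^ N); have a10 : 0 <= a1 by rewrite mulr_ge0 ?addr_ge0 ?powR_ge0.
pose a2 := K * (1 + 2 `^ (N + 2)).
have a20 : 0 <= a2 by rewrite mulr_ge0 ?addr_ge0 ?powR_ge0.
pose A := 2 * (k * a1 * (1 + a2)).
have A0 : 0 <= A by rewrite !mulr_ge0// addr_ge0.
exists A => // f Y h x fY Y0 /andP[h0 h1].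
have j1 y : 1 <= jap y := japanese_ge1 R (val y).
have j0 y : 0 < jap y := japanese_gt0 R (val y).
pose b y := k * Y * jap y `^ N.
have Jb y : signless w b y <= k * Y * (a1 * jap y `^ (N + 2)).
  by rewrite signlessZ ler_wpM2l ?mulr_ge0//; exact: signless_powR.
have JJb : signless w (signless w b) x <= k * a1 * a2 * jap x `^ (N + 4) * Y.
  apply: (le_trans (ler_signless hw _ Jb)).
  rewrite (_ : (fun y => _) = (fun y => k * Y * a1 * jap y `^ (N + 2))); last first.
    by apply/funext => y; rewrite mulrA.
  rewrite signlessZ [leRHS](_ : _ = k * Y * a1 * (a2 * jap x `^ (N + 2 + 2))); last first.
    by rewrite (_ : N + 2 + 2 = N + 4); ring.
  rewrite ler_wpM2l ?mulr_ge0//; apply: signless_powR; exact: addr_ge0.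
have Jbx : signless w b x <= k * a1 * jap x `^ (N + 4) * Y.
  apply: (le_trans (Jb x)); rewrite [leRHS](_ : _ = k * Y * (a1 * jap x `^ (N + 4))); last by ring.
  rewrite ler_wpM2l ?mulr_ge0// ler_wpM2l// ler_powR// lerD2l; lra.
have pos g : (forall y, 0 <= g y) -> (sqnormH N g <= (Y ^+ 2)%:E)%E ->
    `|heat h g x - g x| <= h * (k * a1 * jap x `^ (N + 4) * Y) /\
    `|heat h g x - g x + h * laplacian w g x| <= h ^+ 2 * (k * a1 * a2 * jap x `^ (N + 4) * Y).
  move=> g0 gY; have [dg Hg] := Hc g (le_lt_trans gY (ltry _)).
  have bnd s : 0 <= s <= h -> forall y, heat s g y <= b y.
    move=> /andP[s0 sh] y.
    have sY : (sqnormH N (heat s g) <= (expR c * Y ^+ 2)%:E)%E.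
      apply: (le_trans (Hg s s0)); rewrite EFinM.
      apply: lee_pmul => //; rewrite ?lee_fin ?expR_ge0 ?sqnormH_ge0//.
      by rewrite ler_expR ler_piMr// (le_trans sh).
    have := in_H_pointwise y sY; rewrite sqrtrM ?expR_ge0// sqrtr_sqr (ger0_norm Y0).
    by move=> /(le_trans (ler_norm _)); rewrite /b -/k mulrC.
  have [T1 T2] := heat_taylor hw hp x h0 g0 dg bnd.
  split; first by rewrite (le_trans T1)// ler_wpM2l.
  by rewrite (le_trans T2)// ler_wpM2l ?sqr_ge0.
pose f1 y := Num.max (f y) 0; pose f2 y := Num.max (- f y) 0.
have f10 y : 0 <= f1 y by rewrite le_max lexx orbT.
have f20 y : 0 <= f2 y by rewrite le_max lexx orbT.
have f1Y : (sqnormH N f1 <= (Y ^+ 2)%:E)%E.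
  apply: le_trans fY; apply: sqnormH_norm => y.
  by rewrite ger0_norm// ge_max ler_norm normr_ge0.
have f2Y : (sqnormH N f2 <= (Y ^+ 2)%:E)%E.
  apply: le_trans fY; apply: sqnormH_norm => y.
  by rewrite ger0_norm// ge_max -normrN ler_norm normr_ge0.
have [d1 _] := Hc f1 (le_lt_trans f1Y (ltry _)).
have [d2 _] := Hc f2 (le_lt_trans f2Y (ltry _)).
have [P1 P2] := pos f1 f10 f1Y; have [M1 M2] := pos f2 f20 f2Y.
have -> : f = fun y => f1 y - f2 y by apply/funext => y; exact: posneg.
rewrite heatB// lapB; move: P1 P2 M1 M2.
move: (heat h f1 x) (heat h f2 x) (laplacian w f1 x) (laplacian w f2 x) => u1 u2 l1 l2.
have J0 : 0 <= jap x `^ (N + 4) by exact: powR_ge0.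
have e1 : 2 * (k * a1 * jap x `^ (N + 4) * Y) <= A * jap x `^ (N + 4) * Y.
  rewrite (_ : 2 * _ = (2 * (k * a1)) * (jap x `^ (N + 4) * Y)); last by ring.
  rewrite -[leRHS]mulrA ler_wpM2r ?mulr_ge0// /A ler_wpM2l// ler_peMr ?mulr_ge0//.
  by rewrite lerDl.
have e2 : 2 * (k * a1 * a2 * jap x `^ (N + 4) * Y) <= A * jap x `^ (N + 4) * Y.
  rewrite (_ : 2 * _ = (2 * (k * a1 * a2)) * (jap x `^ (N + 4) * Y)); last by ring.
  rewrite -[leRHS]mulrA ler_wpM2r ?mulr_ge0// /A ler_wpM2l// ler_wpM2l ?mulr_ge0//.
  by rewrite lerDr.
move=> P1 P2 M1 M2; split.
  rewrite (_ : _ - _ = (u1 - f1 x) - (u2 - f2 x)); last by ring.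
  apply: (le_trans (ler_normB _ _)); apply: le_trans (ler_wpM2l h0 e1); lra.
rewrite (_ : _ + _ = (u1 - f1 x + h * l1) - (u2 - f2 x + h * l2)); last by ring.
apply: (le_trans (ler_normB _ _)); apply: le_trans (ler_wpM2l (sqr_ge0 h) e2); lra.
Qed.

End HeatWeighted.

(** * The walk as a heat kernel *)

Section Walk.
Variables (R : realType) (d : nat) (C : set (Zd d)).
Variables (w : Zd d -> Zd d -> R) (hw : conductances w).
Implicit Types (x y : C) (s t : R).

Local Notation S a := (\esum_(x in [set: C]) a x)%E.

(** Countable additivity, with the events indexed by the codes in [nat] of the points of [C]; a
    number that codes no point gives the empty event. *)
Lemma esum_partition (dO : measure_display) (Omega : measurableType dO)
    (mu : {measure set Omega -> \bar R}) (Y : Omega -> C) (A : set Omega) :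
  (forall y, measurable [set o | Y o = y]) -> measurable A ->
  S (fun y => mu (A `&` [set o | Y o = y])) = mu A.
Proof.
move=> mY mA; pose e (y : C) : nat := choice.pickle (val y).
have inje : injective e by move=> a b /(pcan_inj choice.pickleK)/val_inj.
pose B n := [set o | A o /\ e (Y o) = n].
have mB n : measurable (B n).
  have [[y <-]|none] := pselect (exists y, e y = n).
    rewrite (_ : B (e y) = A `&` [set o | Y o = y]); first exact: measurableI.
    by apply/seteqP; split=> o /= [Ao Yo]; split=> //; [exact: inje|rewrite Yo].
  rewrite (_ : B n = set0); first exact: measurable0.
  by apply/seteqP; split=> o //= [_ eo]; apply: none; exists (Y o).
have tB : trivIset setT B.
  by apply/trivIsetP => i j _ _ ij; apply/seteqP; split=> o //= [[_ eo] [_ eo']];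
  move: ij; rewrite -eo -eo' eqxx.
have -> : A = \bigcup_n B n.
  by apply/seteqP; split=> o; [move=> Ao; exists (e (Y o))|case=> n _ []].
have bA : \bigcup_n B n `<=` A by move=> o [n _ []].
rewrite [RHS]measure_bigcup//= nneseries_esum; last by move=> n _; exact: measure_ge0.
rewrite (_ : [set x | x \in [set: nat]] = [set: nat]); last first.
  by apply/seteqP; split=> n //= _; rewrite inE.
rewrite [RHS](esumID [set e y | y in [set: C]]); last by move=> n _; exact: measure_ge0.
rewrite setTI [X in (_ + X)%E]esum1 ?adde0; last first.
  move=> n [_ /= ne]; rewrite (_ : B n = set0) ?measure0//.
  by apply/seteqP; split=> o //= [_ eo]; apply: ne; exists (Y o).
rewrite esum_image; last by move=> a b _ _; exact: inje.
apply: eq_esum => y _; apply: (congr1 mu); apply/seteqP; split=> o /=.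
  by move=> [/bA Ao Yo]; rewrite -Yo.
by move=> [Ao /inje Yo]; split=> //; exists (e (Y o)).
Qed.

Variables (dO : measure_display) (Omega : measurableType dO).
Variables (P : C -> probability Omega R) (X : R -> Omega -> C).
Hypothesis hX : is_vsrw P X w.

Lemma transitionE t x y : 0 <= t -> (transition P X t x y)%:E = P x (at_time X t y).
Proof. by move=> t0; rewrite /transition fineK// fin_num_measure//; exact: vsrw_measurable hX _ _ t0. Qed.

(** The Chapman-Kolmogorov equation is the Markov property with an empty past, summed over the
    position at the intermediate time. *)
Lemma vsrw_heat_kernel : heat_kernel w (transition P X).
Proof.
have part x t A : 0 <= t -> measurable A ->
    S (fun y => P x (A `&` at_time X t y)) = P x A.
  by move=> t0 mA; apply: esum_partition => // y; exact: vsrw_measurable hX _ _ t0.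
split.
- by move=> t x y t0; rewrite fine_ge0.
- move=> t x t0; under eq_esum do rewrite transitionE// -[at_time _ _ _]setTI.
  by rewrite part// probability_setT.
- move=> s t x z s0 t0; rewrite transitionE ?addr_ge0//.
  rewrite -(part x s _ s0); last by apply: vsrw_measurable hX _ _ _; rewrite addr_ge0.
  apply: eq_esum => y _; rewrite EFinM !transitionE//.
  have no (q : R * C) : q \in [::] -> 0 <= q.1 <= s by [].
  have := @vsrw_markov _ _ _ _ _ _ _ _ hX x [::] s t y z no s0 t0.
  move=> /=; have -> : [set o | forall q : R * C, q \in [::] -> X q.1 o = q.2] = setT.
    by apply/seteqP; split=> o // _ q.
  by rewrite !setTI setIC => ->.
- move=> x y; have mz z := @vsrw_measurable _ _ _ _ _ _ _ _ hX 0 z (lexx 0).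
  have [<-|xy] := eqVneq x y; first by rewrite /transition (vsrw_start hX).
  apply: EFin_inj; rewrite transitionE//; apply/eqP; rewrite eq_le measure_ge0 andbT.
  have -> : 0%:E = (P x (~` at_time X 0 x)).
    by rewrite probability_setC// (vsrw_start hX) subee.
  rewrite le_measure ?inE//; first exact: measurableC.
  by move=> o /= Xy Xx; move: xy; rewrite -Xy -Xx eqxx.
- by move=> x y; exact: vsrw_generator hX x y.
Qed.

Lemma degree_growth : quadratic_growth w ->
  exists2 K : R, 1 <= K & forall x : C, degree w x <= K * japanese R (val x) ^+ 2.
Proof.
pose E := range (fun x : Zd d =>
  (japanese R x ^- 2 * \sum_(y \in [set y | neighbour x y]) w x y)%:E).
move=> sup; have {}sup : (ereal_sup E < +oo)%E by exact: sup.
have ub (x : \bar R) : E x -> (x <= ereal_sup E)%E by move=> Ex; exact: ereal_sup_ubound.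
have [r Er] : exists r : R, forall x : \bar R, E x -> (x <= r%:E)%E.
  move: sup ub; case: (ereal_sup E) => [r _ ub| // | _ ub]; first by exists r.
  by exists 0 => x /ub; rewrite leeNy_eq => /eqP ->; rewrite leNye.
exists (Num.max 1 r) => [|x]; first by rewrite le_max lexx.
have j0 : 0 < japanese R (val x) ^+ 2 by rewrite exprn_gt0// japanese_gt0.
rewrite -ler_pdivrMr// (@le_trans _ _ r)//; last by rewrite le_max lexx orbT.
have := Er _ (ex_intro2 _ _ (val x) I erefl); rewrite lee_fin; apply: le_trans.
rewrite mulrC ler_wpM2l ?invr_ge0 ?(ltW j0)//.
rewrite fsbig_finite ?finite_neighbours//=.
rewrite /degree -(big_map val xpredT (fun z => w (val x) z)).
apply: le_sum_subset; [by rewrite map_inj_uniq ?neighbours_uniq//; exact: val_inj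
  |exact: fset_uniq|by move=> z; exact: conductance_ge0 hw _ _|].
move=> z /mapP[y yn ->]; rewrite in_fset_set ?inE/=; last exact: finite_neighbours.
  by rewrite -mem_neighbours.
exact: finite_neighbours.
Qed.

End Walk.

(** * Roots of unity and Parseval *)

Section ComplexModulus.
Variable R : realType.
Implicit Types (z u : R[i]).
Local Open Scope complex_scope.

Definition sqmod z : R := complex.Re z ^+ 2 + complex.Im z ^+ 2.

Lemma sqmodE z : sqmod z = normc z ^+ 2.
Proof. by case: z => a b; rewrite /sqmod/= sqr_sqrtr// addr_ge0 ?sqr_ge0. Qed.

Lemma sqmod_ge0 z : 0 <= sqmod z.
Proof. by rewrite addr_ge0 ?sqr_ge0. Qed.

Lemma normc_ge0 z : 0 <= normc z.
Proof. by case: z => a b; exact: sqrtr_ge0. Qed.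

Lemma sqmodM z u : sqmod (z * u) = sqmod z * sqmod u.
Proof. by rewrite !sqmodE normcM exprMn. Qed.

Lemma sqmodX z n : sqmod (z ^+ n) = sqmod z ^+ n.
Proof.
elim: n => [|n IH]; first by rewrite !expr0 /sqmod/= expr1n expr0n addr0.
by rewrite !exprS sqmodM IH.
Qed.

Lemma sqmodN z : sqmod (- z) = sqmod z.
Proof. by rewrite !sqmodE normcN. Qed.

Lemma sqmod_eq0 z : (sqmod z == 0) = (z == 0).
Proof.
case: z => a b; rewrite /sqmod/= paddr_eq0 ?sqr_ge0// !sqrf_eq0.
by rewrite eq_complex.
Qed.

Lemma sqmodV z : sqmod z^-1 = (sqmod z)^-1.
Proof. by rewrite !sqmodE normcV exprVn. Qed.

Lemma sqmod_real (a : R) : sqmod a%:C = a ^+ 2.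
Proof. by rewrite /sqmod/= expr0n addr0. Qed.

Lemma Re_sqr_le z : complex.Re z ^+ 2 <= sqmod z.
Proof. by rewrite lerDl sqr_ge0. Qed.

Lemma Im_sqr_le z : complex.Im z ^+ 2 <= sqmod z.
Proof. by rewrite lerDr sqr_ge0. Qed.

Lemma sqmodJ z : (sqmod z)%:C = z * z^*%C.
Proof.
case: z => a b; rewrite /sqmod/=; apply/eqP; rewrite eq_complex/=.
by apply/andP; split; apply/eqP; ring.
Qed.

Lemma normc_sum n (F : nat -> R[i]) : normc (\sum_(i < n) F i) <= \sum_(i < n) normc (F i).
Proof.
elim: n => [|n IH]; first by rewrite !big_ord0 normc0.
by rewrite !big_ord_recr/= (le_trans (le_normcD _ _))// lerD2r.
Qed.

Lemma unit_modulus z n : (0 < n)%N -> z ^+ n = 1 -> sqmod z = 1.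
Proof.
move=> n0 zn; have : sqmod z ^+ n = 1 by rewrite -sqmodX zn /sqmod/= expr1n expr0n addr0.
by move=> /eqP; rewrite pexpr_eq1 ?sqmod_ge0// => /eqP.
Qed.

(** The quotient of [1 - z^n] by [1 - z] is a sum of [n] numbers of modulus 1. This later keeps the
    approximate eigenvalue away from 0. *)
Lemma sqmod_1subX z n : sqmod z = 1 -> sqmod (1 - z ^+ n) <= n%:R ^+ 2 * sqmod (1 - z).
Proof.
move=> z1; have nz : normc z = 1.
  by apply/eqP; rewrite -(@pexpr_eq1 _ _ 2) ?normc_ge0// -sqmodE z1.
have -> : 1 - z ^+ n = (1 - z) * \sum_(i < n) z ^+ i.
  by rewrite -opprB subrX1 -mulNr opprB.
rewrite sqmodM mulrC ler_wpM2r ?sqmod_ge0// sqmodE.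
apply: lerXn2r; rewrite ?nnegrE ?normc_ge0//.
apply: (le_trans (normc_sum n (fun i => z ^+ i))).
have nzi i : normc (z ^+ i) = 1.
  by elim: i => [|i IH]; rewrite ?expr0 ?normc1// exprS normcM nz IH mulr1.
by under eq_bigr do rewrite nzi; rewrite sumr_const card_ord.
Qed.

Lemma sqmod_1sub_le z : sqmod z = 1 -> sqmod (1 - z) <= 4.
Proof.
case: z => a b; rewrite /sqmod/= => h.
have : a ^+ 2 <= 1 by rewrite -h lerDl sqr_ge0.
by move: h; rewrite !expr2; nra.
Qed.

(** [X^n - 1] splits and is separable, and [n] distinct [n]-th roots of unity include a primitive
    one. *)
Lemma prim_root_exists n : (0 < n)%N -> exists z : R[i], n.-primitive_root z.
Proof.
move=> n0; pose q : {poly R[i]} := 'X^n - 1.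
have [r Dq] := closed_field_poly_normal q.
have lq : lead_coef q = 1 by rewrite lead_coefDl ?lead_coefXn// size_polyXn size_polyN size_polyC oner_eq0; lia.
rewrite lq scale1r in Dq.
have rn1 : all n.-unity_root r.
  by apply/allP=> z; rewrite -root_prod_XsubC -Dq.
have sz_r : (n < (size r).+1)%N.
  by rewrite -(size_prod_XsubC r id) -Dq size_XnsubC.
have [|z] := hasP (has_prim_root n0 rn1 _ sz_r); last by exists z.
by rewrite -separable_prod_XsubC -Dq separable_Xn_sub_1// pnatr_eq0 -lt0n.
Qed.

(** Expand each squared modulus into a double sum over [k] and [l]. Off the diagonal, the sum over
    [m] runs through the powers of [z^k / z^l], an [n]-th root of unity other than 1, and
    vanishes. *)
Lemma parseval n (z : R[i]) (a : nat -> R) : n.-primitive_root z ->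
  \sum_(m < n) sqmod (\sum_(k < n) (z ^+ m) ^+ k * (a k)%:C) =
  n%:R * \sum_(k < n) a k ^+ 2.
Proof.
move=> pz; have n0 := prim_order_gt0 pz.
have z1 : sqmod z = 1 by apply: (unit_modulus n0); exact: prim_expr_order.
have z0 : z != 0 by rewrite -sqmod_eq0 z1 oner_eq0.
have zJ : z^*%C = z^-1.
  by apply: (mulfI z0); rewrite -sqmodJ z1 mulfV.
apply: (@complexI R); rewrite rmorph_sum/=.
have E m : (sqmod (\sum_(k < n) (z ^+ m) ^+ k * (a k)%:C))%:C =
    \sum_(k < n) \sum_(l < n) ((a k * a l)%:C * (z ^+ k / z ^+ l) ^+ m).
  rewrite sqmodJ rmorph_sum/= mulr_suml; apply: eq_bigr => k _.
  rewrite mulr_sumr; apply: eq_bigr => l _.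
  have -> : ((z ^+ m) ^+ l * (a l)%:C)^*%C = (z^-1 ^+ m) ^+ l * (a l)%:C.
    by rewrite -zJ -conjc_real -!(rmorphXn (@conjc R)) -(rmorphM (@conjc R)) conjc_real.
  rewrite rmorphM/= [in RHS]exprMn.
  by rewrite !exprVn -!exprM !(mulnC m); ring.
under eq_bigr do rewrite E.
rewrite exchange_big/= rmorphM rmorph_sum/= rmorph_nat mulr_sumr.
apply: eq_bigr => k _; rewrite exchange_big/= (bigD1 k)//= [X in _ + X]big1 ?addr0.
  under eq_bigr do rewrite mulfV ?expf_neq0// expr1n mulr1.
  by rewrite sumr_const card_ord -expr2 mulr_natl.
move=> l lk; rewrite -mulr_sumr; set r := z ^+ k / z ^+ l.
suff -> : \sum_(m < n) r ^+ m = 0 by rewrite mulr0.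
have r1 : r - 1 != 0.
  rewrite subr_eq0 -(inj_eq (mulIf (expf_neq0 l z0))) divfK ?expf_neq0// mul1r.
  by rewrite (eq_prim_root_expr pz) !modn_small// eq_sym.
apply: (mulfI r1); rewrite mulr0 -subrX1.
by rewrite /r exprMn exprVn (exprAC z k) (exprAC z l) (prim_expr_order pz) !expr1n invr1 mulr1 subrr.
Qed.

End ComplexModulus.

(** * Frequency selection *)

Lemma sume_const (R : realType) (x : \bar R) n : (0 <= x)%E ->
  (\sum_(i < n) x = n%:R%:E * x)%E.
Proof.
move=> x0; elim: n => [|n IH]; first by rewrite big_ord0 mul0e.
by rewrite big_ord_recr/= IH -natr1 EFinD ge0_muleDl ?lee_fin// mul1e.
Qed.

Section FourierSelection.
Variables (R : realType) (d : nat) (C : set (Zd d)).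
Implicit Types (f : nat -> C -> R) (x y : C) (N : R) (mu z : R[i]).
Local Open Scope complex_scope.

Local Notation S a := (\esum_(x in [set: C]) a x)%E.
Local Notation jap x := (japanese R (val x)).

Definition fourier Q f mu x : R[i] := \sum_(k < Q) mu ^+ k * (f k x)%:C.

Definition csqnormH N (g : C -> R[i]) := S (fun x => (weight N (val x) ^+ 2 * sqmod (g x))%:E).

Lemma csqnormH_ge0 N g : (0 <= csqnormH N g)%E.
Proof. by apply: esum_ge0T => x; rewrite lee_fin mulr_ge0 ?sqr_ge0 ?sqmod_ge0. Qed.

Lemma csqnormHZ N z g : csqnormH N (fun x => g x * z) = ((sqmod z)%:E * csqnormH N g)%E.
Proof.
rewrite /csqnormH -esumZl ?sqmod_ge0//; last first.
  by move=> x; rewrite lee_fin mulr_ge0 ?sqr_ge0 ?sqmod_ge0.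
by apply: eq_esum => x _; rewrite -EFinM sqmodM mulrA mulrC.
Qed.

Lemma sqnormH_Re N g : (sqnormH N (fun x => complex.Re (g x)) <= csqnormH N g)%E.
Proof.
rewrite sqnormHE; apply: le_esum => x _.
by rewrite lee_fin ler_wpM2l ?sqr_ge0 ?Re_sqr_le.
Qed.

Lemma sqnormH_Im N g : (sqnormH N (fun x => complex.Im (g x)) <= csqnormH N g)%E.
Proof.
rewrite sqnormHE; apply: le_esum => x _.
by rewrite lee_fin ler_wpM2l ?sqr_ge0 ?Im_sqr_le.
Qed.

(** The shift is taken modulo [Q], which makes it a bijection of the indices, and [mu^Q = 1] makes
    the phases agree at the wrap-around. *)
Lemma fourier_shift Q f mu x n : (0 < Q)%N -> mu ^+ Q = 1 ->
  mu ^+ n * fourier Q (fun k => f ((k + n) %% Q)%N) mu x = fourier Q f mu x.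
Proof.
case: Q => // Q _ muQ; rewrite /fourier mulr_sumr.
have modX i : mu ^+ (i %% Q.+1) = mu ^+ i by exact: expr_mod.
rewrite [RHS](reindex_inj (addIr (inZp n : 'I_Q.+1)))/=.
apply: eq_bigr => k _; rewrite mulrA -exprD addnC modnDmr modX//.
Qed.

Lemma fourier_diff Q f mu x n : (0 < Q)%N -> mu ^+ Q = 1 ->
  sqmod (fourier Q (fun k y => f ((k + n) %% Q)%N y - f k y) mu x) =
  sqmod (1 - mu ^+ n) * sqmod (fourier Q f mu x).
Proof.
move=> Q0 muQ; rewrite -sqmodM mulrBl mul1r.
rewrite -{1}(fourier_shift f x n Q0 muQ) -mulrBr sqmodM sqmodX.
rewrite (unit_modulus Q0 muQ) expr1n mul1r; congr sqmod.
rewrite /fourier -sumrB; apply: eq_bigr => k _.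
by rewrite rmorphB mulrBr.
Qed.

(* If the conclusion failed for every [m], summing over [m] and applying Parseval
   on both sides would contradict the hypothesis. *)
Lemma fourier_select N Q n (z : R[i]) f x0 (e : R) (Y : \bar R) :
  Q.-primitive_root z -> (n <= Q)%N -> 0 <= e -> (0 <= Y)%E ->
  (e%:E * (\sum_(k < Q) sqnormH N (f k) + Q%:R%:E * Y) <
    (\sum_(k < Q - n) (f (k + n)%N x0 - f k x0) ^+ 2)%:E)%E ->
  exists m : nat, (e%:E * (csqnormH N (fourier Q f (z ^+ m)%R) + Q%:R%:E * Y) <
    (sqmod (1 - (z ^+ m) ^+ n) * sqmod (fourier Q f (z ^+ m) x0))%:E)%E.
Proof.
move=> pz nQ e0 Y0; apply: contraPP => none.
have {}none m : ((sqmod (1 - (z ^+ m) ^+ n) * sqmod (fourier Q f (z ^+ m) x0))%:E <=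
    e%:E * (csqnormH N (fourier Q f (z ^+ m)%R) + Q%:R%:E * Y))%E.
  by rewrite leNgt; apply/negP => H; apply: none; exists m.
have Q0 := prim_order_gt0 pz.
have QR : 0 < Q%:R :> R by rewrite ltr0n.
have zmQ m : (z ^+ m) ^+ Q = 1 by rewrite exprAC (prim_expr_order pz) expr1n.
apply/negP; rewrite -leNgt -(lee_pmul2l (_ : Q%:R%:E \is a fin_num))//.
pose a k := f ((k + n) %% Q)%N x0 - f k x0.
apply: (@le_trans _ _ (\sum_(m < Q) (sqmod (1 - (z ^+ m) ^+ n) *
    sqmod (fourier Q f (z ^+ m) x0))%:E)%E).
  rewrite sumEFin -EFinM lee_fin.
  under [leRHS]eq_bigr do rewrite -fourier_diff//.
  rewrite /fourier (parseval a pz) ler_wpM2l ?(ltW QR)//.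
  (* Below [Q - n] the cyclic shift is the true one; the remaining terms, squares of wrapped-around
     differences, are dropped. *)
  rewrite (big_ord_widen Q (fun k => (f (k + n)%N x0 - f k x0) ^+ 2)) ?leq_subr//.
  rewrite big_mkcond/=; apply: ler_sum => k _; case: ifP => [kQ|_]; last exact: sqr_ge0.
  by rewrite /a modn_small// addnC -ltn_subRL.
apply: (@le_trans _ _ (\sum_(m < Q) e%:E * (csqnormH N (fourier Q f (z ^+ m)%R) + Q%:R%:E * Y))%E).
  by apply: lee_sum => m _.
have pos (m : nat) : (0 <= csqnormH N (fourier Q f (z ^+ m)%R) + Q%:R%:E * Y)%E.
  by rewrite adde_ge0 ?csqnormH_ge0// mule_ge0// lee_fin ltW.
rewrite -ge0_sume_distrr; last by move=> m _; exact: pos.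
rewrite muleCA lee_wpmul2l ?lee_fin//.
rewrite big_split/= ge0_muleDr; last 2 first.
- by apply: sume_ge0 => k _; exact: sqnormH_ge0.
- by rewrite mule_ge0// lee_fin ltW.
apply: leeD; last first.
  by rewrite sume_const// mule_ge0// lee_fin ltW.
rewrite /csqnormH -esum_sum; last first.
  by move=> x m _ _; rewrite lee_fin mulr_ge0 ?sqr_ge0 ?sqmod_ge0.
rewrite ge0_sume_distrr; last by move=> k _; exact: sqnormH_ge0.
have normE k : (Q%:R%:E * sqnormH N (f k))%E =
    S (fun x => (Q%:R * (weight N (val x) ^+ 2 * f k x ^+ 2))%:E).
  rewrite sqnormHE /energy -esumZl ?(ltW QR)// => x.
  by rewrite lee_fin mulr_ge0 ?sqr_ge0.
under [leRHS]eq_bigr do rewrite normE.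
rewrite -esum_sum; last first.
  by move=> x k _ _; rewrite lee_fin mulr_ge0 ?(ltW QR)// mulr_ge0 ?sqr_ge0.
apply: le_esum => x _; rewrite !sumEFin lee_fin -mulr_sumr.
rewrite /fourier (parseval (fun k => f k x) pz) mulrCA mulr_sumr mulr_sumr.
by apply: ler_sum => k _; rewrite mulrCA.
Qed.

End FourierSelection.

(** * Approximate eigenvectors *)

Section ApproximateEigenvector.
Variables (R : realType) (d : nat) (C : set (Zd d)).
Variables (w : Zd d -> Zd d -> R) (hw : conductances w).
Variables (K : R) (K1 : 1 <= K).
Hypothesis degK : forall x : C, degree w x <= K * japanese R (val x) ^+ 2.
Variables (p : R -> C -> C -> R) (hp : heat_kernel w p).
Implicit Types (f g u a b : C -> R) (x y : C) (c s t h e B : R) (mu z : R[i]).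
Local Open Scope complex_scope.

Local Notation S a := (\esum_(x in [set: C]) a x)%E.
Local Notation jap x := (japanese R (val x)).
Local Notation heat := (heat p).
Local Notation dom := (heat_dom p).

Lemma heat_dom_sum Q (c : nat -> R) (f : nat -> C -> R) : (forall k, dom (f k)) ->
  dom (fun x => \sum_(k < Q) c k * f k x).
Proof.
move=> df; elim: Q => [|Q IH].
  apply: heat_domW (heat_dom_cst hp 0) => x; by rewrite big_ord0.
apply: heat_domW (heat_domD IH (heat_domZ (c Q) (df Q))) => x.
by rewrite big_ord_recr.
Qed.

Lemma heat_lincomb t Q (c : nat -> R) (f : nat -> C -> R) x : 0 <= t -> (forall k, dom (f k)) ->
  heat t (fun x => \sum_(k < Q) c k * f k x) x = \sum_(k < Q) c k * heat t (f k) x.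
Proof.
move=> t0 df; elim: Q => [|Q IH].
  rewrite big_ord0 -[RHS](heat_cst hp t0 0 x).
  by rewrite (_ : (fun _ => _) = fun=> 0)//; apply/funext => y; rewrite big_ord0.
rewrite big_ord_recr/= -IH -heatZ// -heatD//; last 2 first.
- exact: heat_dom_sum.
- exact: heat_domZ.
rewrite (_ : (fun _ => \sum_(k < Q.+1) _) =
  fun y => \sum_(k < Q) c k * f k y + c Q * f Q y)//.
by apply/funext => y; rewrite big_ord_recr.
Qed.

Lemma Re_real_mul z (r : R) : complex.Re (z * r%:C) = complex.Re z * r.
Proof. by case: z => u v /=; ring. Qed.

Lemma Im_real_mul z (r : R) : complex.Im (z * r%:C) = complex.Im z * r.
Proof. by case: z => u v /=; ring. Qed.

Lemma Re_sum n (F : nat -> R[i]) :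
  complex.Re (\sum_(i < n) F i) = \sum_(i < n) complex.Re (F i).
Proof.
elim: n => [|n IH]; first by rewrite !big_ord0.
by rewrite !big_ord_recr/= -IH; case: (\sum_(i < n) _) (F n) => [? ?] [? ?].
Qed.

Lemma Im_sum n (F : nat -> R[i]) :
  complex.Im (\sum_(i < n) F i) = \sum_(i < n) complex.Im (F i).
Proof.
elim: n => [|n IH]; first by rewrite !big_ord0.
by rewrite !big_ord_recr/= -IH; case: (\sum_(i < n) _) (F n) => [? ?] [? ?].
Qed.

Lemma sqmod_bound z B : 0 <= B -> sqmod z <= B ^+ 2 ->
  `|complex.Re z| <= B /\ `|complex.Im z| <= B.
Proof.
move=> B0 zB; split; rewrite -(@ler_pXn2r _ 2)// ?nnegrE// real_normK ?num_real//.
  exact: le_trans (Re_sqr_le z) zB.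
exact: le_trans (Im_sqr_le z) zB.
Qed.

Section Fixed.
Variables (N : R) (N0 : 0 <= N) (A : R) (A0 : 0 <= A).
Hypothesis taylor : forall f (Y : R) h x,
  (sqnormH N f <= (Y ^+ 2)%:E)%E -> 0 <= Y -> 0 <= h <= 1 ->
  `|heat h f x - f x| <= h * (A * jap x `^ (N + 4) * Y) /\
  `|heat h f x - f x + h * laplacian w f x| <= h ^+ 2 * (A * jap x `^ (N + 4) * Y).
Variables (T : R) (T0 : 0 < T) (e : R) (e0 : 0 < e) (x0 : C).

(** The two summands stem from the expansion of [P_h] and from the boundary term [f_Q - f_0], each
    divided by [h] and stripped of the common factor [1 / n]. *)
Definition error_bound x :=
  T * (A * jap x `^ (N + 4) * (2 / Num.sqrt e)) + jap x `^ N * (2 / (T * Num.sqrt e)).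

(* [a + i b = g / g(x0)] and [al + i om = (1 - mu^-1) / h]; the relation
   [al = h (al^2 + om^2) / 2] expresses [|mu| = 1]. *)
Lemma approximate_eigenvector (n m : nat) (z : R[i]) (xi : C -> R) :
  let h := T / n%:R in let Q := (n ^ 4)%N in
  let f k := heat (k%:R * h) xi in let mu := z ^+ m in
  (0 < n)%N -> T <= n%:R -> Q.-primitive_root z -> dom xi ->
  (e%:E * (csqnormH N (fourier Q f mu) +
      Q%:R%:E * sqnormH N (fun x => (f Q x - f 0 x)%R)) <
    (sqmod (1 - mu ^+ n) * sqmod (fourier Q f mu x0))%:E)%E ->
  exists a b (al om : R), [/\ (sqnormH N a <= (4 / e)%:E)%E, (sqnormH N b <= (4 / e)%:E)%E,
    a x0 = 1, b x0 = 0 &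
    [/\ forall x, `|laplacian w a x - (al * a x - om * b x)| <= error_bound x / n%:R,
      forall x, `|laplacian w b x - (om * a x + al * b x)| <= error_bound x / n%:R,
      al = h / 2 * (al ^+ 2 + om ^+ 2) &
      e * weight N (val x0) ^+ 2 <= T ^+ 2 * (al ^+ 2 + om ^+ 2)]].
Proof.
move=> h Q f mu n0 Tn pz dxi sel.
have nR : 0 < n%:R :> R by rewrite ltr0n.
have h0 : 0 < h by rewrite divr_gt0.
have h1 : h <= 1 by rewrite ler_pdivrMr// mul1r.
have Q0 : (0 < Q)%N by rewrite expn_gt0 n0.
have QR : 0 < Q%:R :> R by rewrite ltr0n.
have muQ : mu ^+ Q = 1 by rewrite exprAC (prim_expr_order pz) expr1n.
have mu1 : sqmod mu = 1 := unit_modulus Q0 muQ.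
have mu0 : mu != 0 by rewrite -sqmod_eq0 mu1 oner_eq0.
pose nu := mu^-1.
have nu1 : sqmod nu = 1 by rewrite sqmodV mu1 invr1.
set g := fourier Q f mu in sel.
set G := sqmod (g x0) in sel.
set D := fun x => (f Q x - f 0 x)%R in sel.
have v4 : sqmod (1 - mu ^+ n) <= 4.
  by apply: sqmod_1sub_le; rewrite sqmodX mu1 expr1n.
set v := sqmod (1 - mu ^+ n) in sel v4.
have v0 : 0 <= v := sqmod_ge0 _.
have G0 : 0 <= G := sqmod_ge0 _.
have se0 : 0 < Num.sqrt e by rewrite sqrtr_gt0.
have sum_ge0 : (0 <= Q%:R%:E * sqnormH N D)%E.
  by rewrite mule_ge0 ?sqnormH_ge0// lee_fin ltW.
(* The strict inequality with a real number on the right forces both norms to be finite; below it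
   also forces [g x0 != 0]. *)
have fin : (csqnormH N g + Q%:R%:E * sqnormH N D < +oo)%E.
  rewrite ltNge leye_eq; apply/negP => /eqP E; move: sel; rewrite E.
  by rewrite gt0_muley ?lte_fin// ltNge leey.
have gfin : (csqnormH N g < +oo)%E by apply: le_lt_trans fin; rewrite leeDl.
have Dfin : (Q%:R%:E * sqnormH N D < +oo)%E.
  by apply: le_lt_trans fin; rewrite leeDr// csqnormH_ge0.
have [gn gn0 gE] := ge0_lty_ex (csqnormH_ge0 N g) gfin.
have [Dn Dn0 DE] : exists2 r, 0 <= r & sqnormH N D = r%:E.
  apply: ge0_lty_ex; first exact: sqnormH_ge0.
  rewrite ltNge leye_eq; apply/negP => /eqP Doo; move: Dfin.
  by rewrite Doo gt0_muley ?lte_fin.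
have {}sel : e * (gn + Q%:R * Dn) < v * G by move: sel; rewrite gE DE -lte_fin.
have Q_Dn : 0 <= Q%:R * Dn by rewrite mulr_ge0// ltW.
have sel1 : e * gn < v * G by apply: le_lt_trans sel; rewrite ler_wpM2l ?(ltW e0)// lerDl.
have sel2 : e * (Q%:R * Dn) < v * G by apply: le_lt_trans sel; rewrite ler_wpM2l ?(ltW e0)// lerDr.
have G_gt0 : 0 < G.
  rewrite lt_neqAle G0 andbT eq_sym; apply/eqP => G00; move: sel1.
  by rewrite G00 mulr0 ltNge mulr_ge0// ltW.
have gx0 : g x0 != 0 by rewrite -sqmod_eq0 gt_eqF.
pose psi x := g x * (g x0)^-1.
pose a x := complex.Re (psi x); pose b x := complex.Im (psi x).
pose rho x := (D x)%:C * (g x0)^-1.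
pose lam := (1 - nu) * (h^-1)%:C.
have psiE : (csqnormH N psi <= (4 / e)%:E)%E.
  rewrite csqnormHZ sqmodV -/G gE -EFinM lee_fin ler_pdivlMr// mulrC mulrCA.
  rewrite mulrC ler_pdivrMr// (le_trans (ltW sel1))// ler_wpM2r//.
have psi0 : psi x0 = 1 by rewrite /psi mulfV.
have aY := le_trans (sqnormH_Re N psi) psiE.
have bY := le_trans (sqnormH_Im N psi) psiE.
have Y2 : 4 / e = (2 / Num.sqrt e) ^+ 2.
  by rewrite expr_div_n sqr_sqrtr ?(ltW e0)//; congr (_ / _); ring.
have Yge : 0 <= 2 / Num.sqrt e by rewrite divr_ge0// ltW.
have kh0 k : 0 <= k%:R * h by apply: mulr_ge0 => //; exact: ltW.
have df k : dom (f k) by apply: (heat_dom_heat hp).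
have fS k x : heat h (f k) x = f k.+1 x.
  rewrite /f (heat_heat hp _ _ _)//; last exact: ltW.
  by rewrite (_ : h + _ = k.+1%:R * h)// -natr1; ring.
have psi_sum x : psi x = \sum_(k < Q) (mu ^+ k * (g x0)^-1) * (f k x)%:C.
  by rewrite /psi {1}/g /fourier mulr_suml; apply: eq_bigr => k _; rewrite mulrAC.
have heat_psi x : Complex (heat h a x) (heat h b x) =
    \sum_(k < Q) (mu ^+ k * (g x0)^-1) * (f k.+1 x)%:C.
  apply/eqP; rewrite eq_complex/= (Re_sum Q (fun k => (mu ^+ k * (g x0)^-1) * (f k.+1 x)%:C)).
  rewrite (Im_sum Q (fun k => (mu ^+ k * (g x0)^-1) * (f k.+1 x)%:C)).
  have -> : a = fun y => \sum_(k < Q) complex.Re (mu ^+ k * (g x0)^-1) * f k y.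
    apply/funext => y; rewrite /a psi_sum.
    rewrite (Re_sum Q (fun k => (mu ^+ k * (g x0)^-1) * (f k y)%:C)).
    by apply: eq_bigr => k _; rewrite Re_real_mul.
  have -> : b = fun y => \sum_(k < Q) complex.Im (mu ^+ k * (g x0)^-1) * f k y.
    apply/funext => y; rewrite /b psi_sum.
    rewrite (Im_sum Q (fun k => (mu ^+ k * (g x0)^-1) * (f k y)%:C)).
    by apply: eq_bigr => k _; rewrite Im_real_mul.
  rewrite (heat_lincomb Q (fun k => complex.Re (mu ^+ k * (g x0)^-1)) x (ltW h0) df).
  rewrite (heat_lincomb Q (fun k => complex.Im (mu ^+ k * (g x0)^-1)) x (ltW h0) df).
  by apply/andP; split; apply/eqP; apply: eq_bigr => k _; rewrite fS ?Re_real_mul ?Im_real_mul.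
(* Applying [P_h] advances the index by one, and a factor [mu] restores the phases; since
   [mu^Q = 1], only the two ends of the sum fail to match. *)
have shift x : Complex (heat h a x) (heat h b x) = nu * (psi x + rho x).
  rewrite heat_psi psi_sum /rho; apply: (mulfI mu0); rewrite mulrA mulfV// mul1r.
  have gen q : mu * (\sum_(k < q) mu ^+ k * (g x0)^-1 * (f k.+1 x)%:C) =
      \sum_(k < q) mu ^+ k * (g x0)^-1 * (f k x)%:C +
      (mu ^+ q * (f q x)%:C - (f 0 x)%:C) * (g x0)^-1.
    elim: q => [|q IH]; first by rewrite !big_ord0 mulr0 expr0 mul1r subrr mul0r addr0.
    by rewrite !big_ord_recr/= mulrDr IH exprS; ring.
  by rewrite gen muQ mul1r /D rmorphB.
(* [sel2] and [v <= 4] bound [Dn / G] by [4 / (e Q)] with [Q = n^4]; the square root supplies the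
   factor [n^-2]. *)
have rho_le x : sqmod (rho x) <= (jap x `^ N * (2 / (Num.sqrt e * n%:R ^+ 2))) ^+ 2.
  rewrite /rho sqmodM sqmod_real sqmodV -/G ler_pdivrMr//.
  have DnY : (sqnormH N D <= Dn%:E)%E by rewrite DE.
  have Dx := in_H_pointwise x DnY.
  have D2 : D x ^+ 2 <= (jap x `^ N) ^+ 2 * Dn.
    rewrite -real_normK ?num_real// -[X in _ * X]sqr_sqrtr// -exprMn.
    by apply: lerXn2r; rewrite ?nnegrE ?mulr_ge0 ?powR_ge0 ?sqrtr_ge0.
  apply: (le_trans D2); rewrite [X in _ <= X * G]exprMn -[leRHS]mulrA ler_wpM2l ?sqr_ge0//.
  rewrite expr_div_n exprMn sqr_sqrtr ?(ltW e0)// -exprM.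
  have -> : 2 ^+ 2 / (e * n%:R ^+ (2 * 2)) * G = 4 * G / (e * Q%:R).
    by rewrite /Q natrX; ring.
  rewrite ler_pdivlMr ?mulr_gt0//.
  rewrite [leLHS](_ : _ = e * (Q%:R * Dn)); last by ring.
  by rewrite (le_trans (ltW sel2))// ler_wpM2r.
have lamsq : sqmod lam * h ^+ 2 = sqmod (1 - nu).
  rewrite /lam sqmodM sqmod_real exprVn -mulrA mulVf ?mulr1//.
  by rewrite expf_neq0// gt_eqF.
have err x : exists E : R[i], [/\ `|complex.Re E| <= h ^+ 2 * (A * jap x `^ (N + 4) * (2 / Num.sqrt e)),
    `|complex.Im E| <= h ^+ 2 * (A * jap x `^ (N + 4) * (2 / Num.sqrt e)) &
    Complex (laplacian w a x) (laplacian w b x) - lam * psi x = (h^-1)%:C * (E - nu * rho x)].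
  pose E := Complex (heat h a x - a x + h * laplacian w a x)
    (heat h b x - b x + h * laplacian w b x).
  exists E; split => /=.
  - by apply: (proj2 (taylor x _ Yge _)); rewrite -?Y2 ?(ltW h0)//.
  - by apply: (proj2 (taylor x _ Yge _)); rewrite -?Y2 ?(ltW h0)//.
  have hC : h%:C != 0 by rewrite (inj_eq (@complexI R) h 0) gt_eqF.
  have hV : (h^-1)%:C = (h%:C)^-1 by exact: (fmorphV (real_complex R)).
  apply: (mulfI hC); rewrite hV; rewrite [RHS]mulrA mulfV// mul1r.
  have -> : E = Complex (heat h a x) (heat h b x) - psi x +
      h%:C * Complex (laplacian w a x) (laplacian w b x).
    rewrite /E /a /b; case: (psi x) => u1 u2 /=.
    by apply/eqP; rewrite eq_complex/=; apply/andP; split; apply/eqP; ring.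
  have -> : lam = (1 - nu) * (h%:C)^-1 by rewrite /lam hV.
  rewrite shift mulrBr [in LHS]mulrA [h%:C * (_ * _)]mulrCA mulfV// mulr1; ring.
have bound x : `|complex.Re (Complex (laplacian w a x) (laplacian w b x) - lam * psi x)| <=
      error_bound x / n%:R /\
    `|complex.Im (Complex (laplacian w a x) (laplacian w b x) - lam * psi x)| <=
      error_bound x / n%:R.
  have [E [E1 E2 ->]] := err x.
  have rb : sqmod (nu * rho x) <= (jap x `^ N * (2 / (Num.sqrt e * n%:R ^+ 2))) ^+ 2.
    by rewrite sqmodM nu1 mul1r.
  have rb0 : 0 <= jap x `^ N * (2 / (Num.sqrt e * n%:R ^+ 2)).
    by rewrite mulr_ge0 ?powR_ge0// divr_ge0// mulr_ge0 ?sqr_ge0// ltW.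
  have [r1 r2] := sqmod_bound rb0 rb.
  have -> : error_bound x / n%:R = h^-1 * (h ^+ 2 * (A * jap x `^ (N + 4) * (2 / Num.sqrt e)) +
      jap x `^ N * (2 / (Num.sqrt e * n%:R ^+ 2))).
    by rewrite /error_bound /h; field; rewrite !gt_eqF.
  rewrite mulrC Re_real_mul Im_real_mul !normrM (gtr0_norm (_ : 0 < h^-1)) ?invr_gt0//.
  rewrite ![_ * h^-1]mulrC; split; rewrite ler_wpM2l ?invr_ge0 ?(ltW h0)//.
    move: r1 E1; case: (nu * rho x) => u1 u2; case: E {E2} => v1 v2 /= r1 E1.
    by rewrite (le_trans (ler_normB _ _))// lerD.
  move: r2 E2; case: (nu * rho x) => u1 u2; case: E {E1} => v1 v2 /= r2 E2.
  by rewrite (le_trans (ler_normB _ _))// lerD.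
exists a, b, (complex.Re lam), (complex.Im lam).
split=> //; [by rewrite /a psi0|by rewrite /b psi0|split].
- move=> x; apply: le_trans (proj1 (bound x)).
  by rewrite /a /b; case: (psi x) lam {lamsq bound err} => u1 u2 [v1 v2] /=.
- move=> x; apply: le_trans (proj2 (bound x)).
  rewrite /a /b; case: (psi x) lam {lamsq bound err} => u1 u2 [v1 v2] /=.
  by rewrite [v1 * u2 + _]addrC.
(* On the unit circle [|1 - nu|^2 = 2 (1 - Re nu)], which is the relation between [al] and the
   squared modulus of the eigenvalue. *)
- have -> : complex.Re lam ^+ 2 + complex.Im lam ^+ 2 = sqmod (1 - nu) / h ^+ 2.
    by rewrite -lamsq mulfK// expf_neq0// gt_eqF.
  rewrite /lam Re_real_mul; move: nu1; rewrite /sqmod; generalize nu => -[u1 u2] /= nu1'.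
  have -> : (1 - u1) ^+ 2 + (0 - u2) ^+ 2 = 2 * (1 - u1).
    by rewrite sub0r sqrrN; move: nu1'; lra.
  by field; rewrite gt_eqF.
have -> : complex.Re lam ^+ 2 + complex.Im lam ^+ 2 = sqmod (1 - nu) / h ^+ 2.
  by rewrite -lamsq mulfK// expf_neq0// gt_eqF.
have -> : T ^+ 2 * (sqmod (1 - nu) / h ^+ 2) = n%:R ^+ 2 * sqmod (1 - nu).
  by rewrite /h; field; rewrite !gt_eqF.
have -> : sqmod (1 - nu) = sqmod (1 - mu).
  have -> : 1 - nu = - (nu * (1 - mu)) by rewrite mulrBr mulr1 mulVf// opprB.
  by rewrite sqmodN sqmodM nu1 mul1r.
(* The point [x0] alone contributes [weight^2 * G] to the squared norm of [g], so [sel1] bounds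
   [|1 - mu^n|] from below, and with it [n |1 - mu|]. *)
apply: le_trans (sqmod_1subX n mu1); rewrite -/v -(ler_pM2r G_gt0).
apply: le_trans (ltW sel1); rewrite -mulrA ler_wpM2l ?(ltW e0)//.
rewrite -lee_fin -gE; exact: (le_esum_term (fun x => (weight N (val x) ^+ 2 * sqmod (g x))%:E) x0).
Qed.

End Fixed.
End ApproximateEigenvector.

(** * Passage to the limit *)

Section Ultralimit.
Variables (R : realType) (U : set_system nat).
Hypothesis UU : UltraFilter U.

(** One ultrafilter makes every bounded sequence converge, so the values at all points and the
    eigenvalues have limits at once, without a diagonal extraction. *)
Lemma ultra_bounded_cvg (s : nat -> R) (B : R) : (forall n, `|s n| <= B) ->
  exists l : R, s @ U --> l.
Proof.
move=> sB; have PF : ProperFilter (s @ U) by exact: fmap_proper_filter.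
have sU : (s @ U) `[-B, B]%classic.
  apply: (@filterE _ U _ (s @^-1` `[-B, B]%classic)) => n.
  by have := sB n; rewrite ler_norml /= in_itv/=.
have [l [_ ll]] := @segment_compact R (-B) B _ PF sU.
exists l => V Vl; have [//|nV] := in_ultra_setVsetC (s @^-1` V) UU.
by have [v []] := ll (~` V) V nV Vl.
Qed.

Lemma ultra_cvg_le (s : nat -> R) (l B : R) : s @ U --> l -> (forall n, s n <= B) -> l <= B.
Proof.
move=> sl sB; apply: (closed_cvg (fun x => x <= B) _ _ l sl); first exact: closed_le.
by apply: filterE.
Qed.

Lemma cvg_bigsum (I : Type) (r : seq I) (F : nat -> I -> R) (G : I -> R) :
  (forall i, (fun n => F n i) @ U --> G i) ->
  (fun n => \sum_(i <- r) F n i) @ U --> \sum_(i <- r) G i.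
Proof.
move=> FG; elim: r => [|i r IH].
  by rewrite big_nil; under eq_fun do rewrite big_nil; exact: cvg_cst.
by rewrite big_cons; under eq_fun do rewrite big_cons; exact: cvgD.
Qed.

Hypothesis Uoo : \oo `<=` U.

Lemma ultra_vanish (s : nat -> R) (B : R) : (forall n, `|s n| <= B / n.+1%:R) ->
  s @ U --> (0 : R).
Proof.
move=> sB; have B0 : 0 <= B by have := sB 0; rewrite divr1; apply: le_trans.
have : s @ \oo --> (0 : R).
  apply/cvgrPdist_le => e e0; near=> n; rewrite sub0r normrN (le_trans (sB n))//.
  rewrite ler_pdivrMr// mulrC -ler_pdivrMr//.
  near: n; exists (Num.truncn (B / e)).+1 => // n /= Bn.
  apply/ltW/(lt_le_trans (truncnS_gt _)); rewrite ler_nat; exact: leqW.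
by move=> so V /so; exact: Uoo.
Unshelve. all: end_near. Qed.

End Ultralimit.

Section LimitEigenvector.
Variables (R : realType) (d : nat) (C : set (Zd d)).
Variables (w : Zd d -> Zd d -> R) (hw : conductances w).
Implicit Types (u v : C -> R) (x y : C).
Local Open Scope complex_scope.

Local Notation jap x := (japanese R (val x)).

Lemma lap_complex u v x :
  laplacian (fun a b => (w a b)%:C) (fun y => Complex (u y) (v y)) x =
  Complex (laplacian w u x) (laplacian w v x).
Proof.
rewrite !laplacianE; elim: (neighbours x) => [|y r IH]; first by rewrite !big_nil.
rewrite !big_cons IH; apply/eqP; rewrite eq_complex/=.
by apply/andP; split; apply/eqP; ring.
Qed.

Lemma lap_cvg (U : set_system nat) (FU : UltraFilter U) (u : nat -> C -> R) (v : C -> R) x :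
  (forall y, (fun n => u n y) @ U --> v y) ->
  (fun n => laplacian w (u n) x) @ U --> laplacian w v x.
Proof.
move=> uv; rewrite laplacianE; under eq_fun do rewrite laplacianE.
apply: cvg_bigsum => y; apply: cvgM; [exact: cvg_cst|exact: cvgB].
Qed.

Lemma limit_eigenvector (N : R) (x0 : C) (Y kappa D : R) (err : C -> R)
    (a b : nat -> C -> R) (al om : nat -> R) :
  (forall n, sqnormH N (a n) <= Y%:E)%E -> (forall n, sqnormH N (b n) <= Y%:E)%E ->
  (forall n, a n x0 = 1) -> (forall n, b n x0 = 0) ->
  (forall n x, `|laplacian w (a n) x - (al n * a n x - om n * b n x)| <= err x / n.+1%:R) ->
  (forall n x, `|laplacian w (b n) x - (om n * a n x + al n * b n x)| <= err x / n.+1%:R) ->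
  (forall n, al n = D / n.+1%:R * (al n ^+ 2 + om n ^+ 2)) ->
  0 < kappa -> (forall n, kappa <= al n ^+ 2 + om n ^+ 2) ->
  has_imaginary_eigenvalue C w N.
Proof.
move=> aY bY a0 b0 La Lb alE k0 lk.
have [U [UU Uoo]] := @ultraFilterLemma nat \oo _.
pose M x := jap x `^ N * Num.sqrt Y.
have aM n x : `|a n x| <= M x by exact: in_H_pointwise (aY n).
have bM n x : `|b n x| <= M x by exact: in_H_pointwise (bY n).
have err0 x : 0 <= err x.
  by have := La 0 x; rewrite divr1; apply: le_trans.
have errn n x : err x / n.+1%:R <= err x by rewrite ler_pdivrMr// ler_peMr// ler1n.
(* As [a n x0 = 1] and [b n x0 = 0], the Laplacians at [x0] are [al n] and [om n] up to the error,
   and the pointwise bound [M] keeps them bounded. *)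
pose J := signless w M x0 + err x0.
have lapM u : (forall y, `|u y| <= M y) -> `|laplacian w u x0| <= signless w M x0.
  by move=> uM; rewrite (le_trans (ler_norm_lap hw _ _))//; exact: ler_signless.
have alJ n : `|al n| <= J.
  have := La n x0; rewrite a0 b0 mulr1 mulr0 subr0 => H.
  rewrite (_ : al n = laplacian w (a n) x0 - (laplacian w (a n) x0 - al n)); last by ring.
  by rewrite (le_trans (ler_normB _ _))// lerD ?lapM// (le_trans H).
have omJ n : `|om n| <= J.
  have := Lb n x0; rewrite a0 b0 mulr1 mulr0 addr0 => H.
  rewrite (_ : om n = laplacian w (b n) x0 - (laplacian w (b n) x0 - om n)); last by ring.
  by rewrite (le_trans (ler_normB _ _))// lerD ?lapM// (le_trans H).
have J0 : 0 <= J by apply: le_trans (alJ 0%N).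
have sq_le (r : R) : `|r| <= J -> r ^+ 2 <= J ^+ 2.
  by move=> rJ; rewrite -real_normK ?num_real//; apply: lerXn2r; rewrite ?nnegrE.
have al_small n : `|al n| <= `|D| * (2 * J ^+ 2) / n.+1%:R.
  rewrite alE !normrM normfV (ger0_norm (ler0n _ _)) mulrAC ler_wpM2r ?invr_ge0//.
  rewrite ler_wpM2l// ger0_norm ?addr_ge0 ?sqr_ge0// mulr_natl mulr2n.
  by rewrite lerD ?sq_le.
have FU : Filter U by exact: ultra_proper.
have al0 : al @ U --> (0 : R) := ultra_vanish Uoo al_small.
have [om0 omo] := ultra_bounded_cvg UU omJ.
have /choice[va hva] : forall x, exists l : R, (fun n => a n x) @ U --> l.
  by move=> x; exact: (ultra_bounded_cvg UU (fun n => aM n x)).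
have /choice[vb hvb] : forall x, exists l : R, (fun n => b n x) @ U --> l.
  by move=> x; exact: (ultra_bounded_cvg UU (fun n => bM n x)).
have PU : ProperFilter U by exact: ultra_proper.
have va0 : va x0 = 1.
  apply: (cvg_unique _ (hva x0)) => //=; under eq_fun do rewrite a0; exact: cvg_cst.
have lim_la x : laplacian w va x = - (om0 * vb x).
  have h1 : (fun n => laplacian w (a n) x - (al n * a n x - om n * b n x)) @ U -->
      laplacian w va x - (0 * va x - om0 * vb x).
    by apply: cvgB; [exact: lap_cvg|apply: cvgB; apply: cvgM].
  have h2 := ultra_vanish Uoo (fun n => La n x).
  have /eqP : laplacian w va x - (0 * va x - om0 * vb x) = 0 by exact: cvg_unique h1 h2.
  rewrite mul0r sub0r opprK.
  by rewrite addr_eq0 => /eqP.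
have lim_lb x : laplacian w vb x = om0 * va x.
  have h1 : (fun n => laplacian w (b n) x - (om n * a n x + al n * b n x)) @ U -->
      laplacian w vb x - (om0 * va x + 0 * vb x).
    by apply: cvgB; [exact: lap_cvg|apply: cvgD; apply: cvgM].
  have h2 := ultra_vanish Uoo (fun n => Lb n x).
  have /eqP : laplacian w vb x - (om0 * va x + 0 * vb x) = 0 by exact: cvg_unique h1 h2.
  rewrite mul0r addr0.
  by rewrite subr_eq0 => /eqP.
(* [al] tends to 0, so the lower bound [kappa] falls entirely on the limit of [om]. *)
have o0 : om0 != 0.
  apply/eqP => oz.
  have h1 : (fun n => - (al n ^+ 2 + om n ^+ 2)) @ U --> - (0 ^+ 2 + 0 ^+ 2 : R).
    by rewrite !expr2; under eq_fun do rewrite !expr2; apply: cvgN; apply: cvgD; apply: cvgM; rewrite // -oz.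
  have := ultra_cvg_le UU h1 (B := - kappa) _.
  by rewrite expr0n/= addr0 oppr0 oppr_ge0 leNgt k0 => /(_ _)/negP; apply=> // n; rewrite lerN2.
(* Fatou's argument: each finite partial sum of the squared norm passes to the limit. *)
have lim_H (u : nat -> C -> R) v : (forall n, sqnormH N (u n) <= Y%:E)%E ->
    (forall x, (fun n => u n x) @ U --> v x) -> in_H N v.
  move=> uY uv; apply: (@le_lt_trans _ _ Y%:E); last exact: ltry.
  rewrite sqnormHE; apply: esum_le_ub => F; rewrite sumEFin lee_fin.
  apply: (ultra_cvg_le UU (s := fun n => \sum_(x <- F) weight N (val x) ^+ 2 * u n x ^+ 2)).
    by apply: cvg_bigsum => x; apply: cvgM; [exact: cvg_cst|]; rewrite expr2; under eq_fun do rewrite expr2; exact: cvgM.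
  move=> n; rewrite -lee_fin -sumEFin; apply: le_trans (uY n).
  by rewrite sqnormHE; exact: le_fset_esum (fun x => (weight N (val x) ^+ 2 * u n x ^+ 2)%:E) F.
exists (Complex 0 om0); split=> //.
  by rewrite eq_complex/= eqxx/=.
exists va, vb; split; [exact: lim_H aY hva|exact: lim_H bY hvb|split].
  by exists x0; rewrite eq_complex/= va0 oner_eq0.
move=> x; rewrite lap_complex lim_la lim_lb.
by apply/eqP; rewrite eq_complex/=; apply/andP; split; apply/eqP; ring.
Qed.

End LimitEigenvector.

(** * Measurability on tempered functions *)

Section Enumeration.
Variables (R : realType) (d : nat) (C : set (Zd d)).

(** Turns sums over [C] into series, for which measurability is known. [None] marks the numbers that
    code no point of [C] and contributes 0. *)
Lemma esum_enumeration : exists2 dec : nat -> option C, (forall y, exists n, dec n = Some y) &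
  forall a : C -> \bar R, (forall y, 0 <= a y)%E ->
  (\esum_(y in [set: C]) a y = \sum_(0 <= n <oo) oapp a 0 (dec n))%E.
Proof.
pose e (y : C) : nat := choice.pickle (val y).
have inje : injective e by move=> a b /(pcan_inj choice.pickleK)/val_inj.
pose dec n : option C := match pselect (exists y, e y = n) with
  | left h => Some (projT1 (cid h)) | right _ => None end.
have decK y : dec (e y) = Some y.
  rewrite /dec; case: pselect => [h|[]]; last by exists y.
  by case: cid => z /= /inje ->.
have decN n : ~ (exists y, e y = n) -> dec n = None by rewrite /dec; case: pselect.
exists dec => [y|a a0]; first by exists (e y).
have b0 n : (0 <= oapp a 0 (dec n))%E by case: (dec n) => /=.
rewrite nneseries_esum; last by move=> n _.
rewrite (_ : [set x | xpredT x] = [set: nat]); last by apply/seteqP; split.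
rewrite [RHS](esumID [set e y | y in [set: C]]); last by move=> n _.
rewrite setTI [X in (_ + X)%E]esum1 ?adde0; last first.
  by move=> n [_ /= ne]; rewrite decN// => -[y ey]; apply: ne; exists y.
rewrite esum_image; last by move=> a1 b _ _; exact: inje.
by apply: eq_esum => y _; rewrite decK.
Qed.

Lemma measurable_esum (dT : measure_display) (T : measurableType dT) (F : T -> C -> \bar R) :
  (forall t y, 0 <= F t y)%E -> (forall y, measurable_fun setT (F ^~ y)) ->
  measurable_fun setT (fun t => \esum_(y in [set: C]) F t y)%E.
Proof.
move=> F0 mF; have [dec _ decE] := esum_enumeration.
rewrite (_ : (fun t => _) = fun t => (\sum_(0 <= n <oo | n \in xpredT) oapp (F t) 0 (dec n))%E).
  apply: ge0_emeasurable_sum => [n t _ _|n _]; first by case: (dec n) => /=.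
  by case: (dec n) => [y|]/=; [exact: mF|exact: measurable_cst].
by apply/funext => t; rewrite decE.
Qed.

Lemma measurable_real_sum (dT : measure_display) (T : measurableType dT) (F : T -> C -> R) :
  (forall y, measurable_fun setT (F ^~ y)) -> measurable_fun setT (fun t => real_sum (F t)).
Proof.
move=> mF; apply: (measurableT_comp (fine_measurable measurableT)).
have mE y : measurable_fun setT (fun t => (F t y)%:E) by apply/measurable_EFinP.
apply: emeasurable_funB; apply: measurable_esum => [t y|y];
  [exact: funepos_ge0| |exact: funeneg_ge0|].
  apply: eq_measurable_fun (measurable_funepos (mE y)) => t _.
  by rewrite !funeposE.
apply: eq_measurable_fun (measurable_funeneg (mE y)) => t _.
by rewrite !funenegE.
Qed.

End Enumeration.

(** * Measurable maps into and out of the tempered functions *)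

Section SprimeMeasurability.
Variables (R : realType) (d : nat) (C : set (Zd d)).
Implicit Types (x y : C) (N : R) (xi : Sprime R C).

Local Notation ev xi := (@eval_Sprime R d C xi).

Definition mk_Sprime (f : C -> R) (tf : @tempered R d C f) : Sprime R C :=
  exist (fun f => f \in @tempered R d C) f (mem_set tf).

Lemma eval_Sprime_inj xi xi' : ev xi = ev xi' -> xi = xi'.
Proof. by move=> E; apply: val_inj. Qed.

Lemma eval_Sprime_tempered xi : @tempered R d C (ev xi).
Proof. by have := svalP xi; rewrite inE. Qed.

Lemma measurable_eval x : measurable_fun setT (fun xi => ev xi x).
Proof.
move=> _ B mB; rewrite setTI; apply: sub_sigma_algebra; exists x, B; by split.
Qed.

Lemma measurable_to_Sprime (dT : measure_display) (T : measurableType dT) (f : T -> Sprime R C) :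
  (forall x, measurable_fun setT (fun t => ev (f t) x)) -> measurable_fun setT f.
Proof.
move=> mf; apply: (@measurability _ _ T (Sprime R C) setT f (@cylinders R d C)) => //.
by move=> _ [_ [x [B [mB ->]]] <-]; exact: mf.
Qed.

Lemma measurable_heat (p : R -> C -> C -> R) t x :
  measurable_fun setT (fun xi => heat p t (ev xi) x).
Proof.
apply: measurable_real_sum => y.
by apply: measurable_funM; [exact: measurable_cst|exact: measurable_eval].
Qed.

Lemma measurable_sqnormH N (dT : measure_display) (T : measurableType dT) (g : T -> C -> R) :
  (forall x, measurable_fun setT (g ^~ x)) ->
  measurable_fun setT (fun t => sqnormH N (g t)).
Proof.
move=> mg.
rewrite (_ : (fun t => _) = fun t =>
  (\esum_(x in [set: C]) (weight N (val x) ^+ 2 * g t x ^+ 2)%:E)%E); last first.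
  by apply/funext => t; exact: sqnormHE.
apply: measurable_esum => [t x|x]; first by rewrite lee_fin mulr_ge0 ?sqr_ge0.
apply/measurable_EFinP; apply: measurable_funM; first exact: measurable_cst.
exact: measurable_funX.
Qed.

End SprimeMeasurability.

(** Only the first [m] terms of each block of length [n] are bounded below, because the increment of
    [P_T] is controlled only after a short additional time. *)
Lemma sum_blocks (R : realType) (a : nat -> \bar R) (b : R) n m J : (m <= n)%N ->
  (forall k, 0 <= a k)%E -> (forall j r, (r < m)%N -> b%:E <= a (j * n + r)%N)%E ->
  0 <= b -> (((J * m)%:R * b)%:E <= \sum_(k < J * n) a k)%E.
Proof.
move=> mn a0 ab b0; elim: J => [|J IH]; first by rewrite mul0r sume_ge0.
rewrite !mulSnr natrD mulrDl EFinD big_split_ord/=; apply: leeD => //.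
have := ab J; move: (J * n)%N => q {}ab.
rewrite -(subnKC mn) big_split_ord/= -[leLHS]adde0; apply: leeD; last exact: sume_ge0.
rewrite EFinM -sume_const//; apply: lee_sum => r _; exact: ab.
Qed.

(** * From an invariant measure to an eigenvalue *)

Section InvariantMeasure.
Variables (R : realType) (d : nat) (C : set (Zd d)).
Variables (w : Zd d -> Zd d -> R) (hw : conductances w).
Variables (K : R) (K1 : 1 <= K).
Hypothesis degK : forall x : C, degree w x <= K * japanese R (val x) ^+ 2.
Variables (p : R -> C -> C -> R) (hp : heat_kernel w p).
Implicit Types (f g u a b : C -> R) (x y : C) (s t h B : R) (xi : Sprime R C).

Local Notation jap x := (japanese R (val x)).
Local Notation heat := (heat p).
Local Notation dom := (heat_dom p).
Local Notation ev xi := (@eval_Sprime R d C xi).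

Lemma tempered_dom f : @tempered R d C f -> dom f.
Proof.
move=> [N N0 fN]; have [c _ cP] := heat_in_H hw K1 degK hp N0.
by have [] := cP f fN.
Qed.

Lemma heat_tempered t f : 0 <= t -> @tempered R d C f -> @tempered R d C (heat t f).
Proof.
move=> t0 [N N0 fN]; have [c _ cP] := heat_in_H hw K1 degK hp N0.
exists N => //; have [_ /(_ _ t0) H] := cP f fN; apply: le_lt_trans H _.
by rewrite lte_mul_pinfty// lee_fin ltW ?expR_gt0.
Qed.

Lemma sqnormHB N f g : (sqnormH N (fun x => (f x - g x)%R) <=
  2%:E * (sqnormH N f + sqnormH N g))%E.
Proof.
have := sqnormHD N f (fun x => -1 * g x); rewrite sqnormHZ sqrrN expr1n mul1e.
by rewrite (_ : (fun x => f x + -1 * g x) = fun x => f x - g x)//; apply/funext => x; rewrite mulN1r.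
Qed.

Lemma heat_sqnormH_le N : 0 <= N -> exists2 c, 0 <= c & forall f t,
  @tempered R d C f -> 0 <= t ->
  (sqnormH N (heat t f) <= (expR (c * t))%:E * sqnormH N f)%E.
Proof.
move=> N0; have [c c0 cP] := heat_in_H hw K1 degK hp N0; exists c => // f t tf t0.
have [fN|] := pselect (in_H N f); first by have [_ ->] := cP f fN.
move=> /negP; rewrite -leNgt leye_eq => /eqP ->.
by rewrite gt0_muley ?leey// lte_fin expR_gt0.
Qed.

(** Stated with extended values so that it holds off [H_{-N}] too and can be integrated. The summand
    1 in the constant keeps the right side infinite there when [s > 0]. *)
Lemma heat_sqr_increment N x0 : 0 <= N -> exists2 A : R, 0 < A & forall f s, 0 <= s <= 1 ->
  (((heat s f x0 - f x0) ^+ 2)%:E <= (s ^+ 2 * A)%:E * sqnormH N f)%E.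
Proof.
move=> N0; have [A A0 AP] := heat_taylor_H hw K1 degK hp N0.
pose B := A * jap x0 `^ (N + 4).
have B0 : 0 <= B by rewrite mulr_ge0// powR_ge0.
exists (B ^+ 2 + 1); first by rewrite ltr_wpDl ?sqr_ge0.
move=> f s /andP[s0 s1]; have [fN|] := pselect (in_H N f); last first.
  move=> /negP; rewrite -leNgt leye_eq => /eqP ->.
  move: s0; rewrite le_eqVlt => /predU1P[<-|s0].
    by rewrite (heat0 hp) subrr expr0n/= mul0r mul0e.
  by rewrite gt0_muley ?leey// lte_fin mulr_gt0 ?exprn_gt0// ltr_wpDl ?sqr_ge0.
have [Y Y0 YE] := ge0_lty_ex (sqnormH_ge0 N f) fN.
rewrite YE -EFinM lee_fin.
have fY : (sqnormH N f <= (Num.sqrt Y ^+ 2)%:E)%E by rewrite sqr_sqrtr// YE.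
have [H _] := AP f (Num.sqrt Y) s x0 fY (sqrtr_ge0 _) (introT andP (conj s0 s1)).
have sB0 : 0 <= s * (B * Num.sqrt Y) by apply: mulr_ge0 => //; apply: mulr_ge0.
rewrite -[leLHS]real_normK ?num_real//.
apply: (@le_trans _ _ ((s * (B * Num.sqrt Y)) ^+ 2)).
  by apply: lerXn2r => //; rewrite nnegrE.
have -> : (s * (B * Num.sqrt Y)) ^+ 2 = s ^+ 2 * B ^+ 2 * Num.sqrt Y ^+ 2 by ring.
rewrite sqr_sqrtr// ler_wpM2r// ler_wpM2l ?sqr_ge0//; lra.
Qed.

Variables (rho : probability (Sprime R C) R) (N : R) (N0 : 0 <= N) (T : R) (T0 : 0 < T).
Hypothesis rho_inv : forall A : set (Sprime R C), measurable A ->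
  rho [set xi | exists2 xi', A xi' & ev xi' = heat T (ev xi)] = rho A.
Hypothesis rho_fixed : (rho [set xi | heat T (ev xi) = ev xi] < 1)%E.
Hypothesis rho_moment : (\int[rho]_xi sqnormH N (ev xi) < +oo)%E.

Definition evolve xi : Sprime R C := mk_Sprime (heat_tempered (ltW T0) (eval_Sprime_tempered xi)).

Lemma ev_evolve xi : ev (evolve xi) = heat T (ev xi).
Proof. by []. Qed.

Lemma ev_iter j xi : ev (iter j evolve xi) = heat (j%:R * T) (ev xi).
Proof.
elim: j => [|j IH]; first by rewrite mul0r (heat0 hp).
rewrite iterS ev_evolve IH (heat_heat hp)//.
- by rewrite -natr1 mulrDl mul1r addrC.
- exact: ltW.
- by rewrite mulr_ge0// ltW.
- exact/tempered_dom/eval_Sprime_tempered.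
Qed.

Lemma measurable_evolve : measurable_fun setT evolve.
Proof. by apply: measurable_to_Sprime => x; exact: measurable_heat. Qed.

(** Invariance says that [rho] is its own push-forward by [evolve]: evaluation is injective, so the
    set written with a witness [xi'] is the preimage under [evolve]. *)
Lemma integral_evolve (F : Sprime R C -> \bar R) : (forall xi, 0 <= F xi)%E ->
  measurable_fun setT F -> (\int[rho]_xi F (evolve xi) = \int[rho]_xi F xi)%E.
Proof.
move=> F0 mF; have := ge0_integral_pushforward measurable_evolve rho measurableT mF (fun xi _ => F0 xi).
rewrite preimage_setT => <-; apply: eq_measure_integral => [|mev A mA _]; first exact: measurable_evolve.
transitivity (rho (evolve @^-1` A)); first by [].
apply: etrans (rho_inv mA); apply: (congr1 rho); apply/seteqP; split=> xi /=.
  by move=> Axi; exists (evolve xi).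
by move=> [xi' Axi' E]; rewrite (_ : evolve xi = xi')//; apply: eval_Sprime_inj; exact/esym.
Qed.

Lemma integral_iter j (F : Sprime R C -> \bar R) : (forall xi, 0 <= F xi)%E ->
  measurable_fun setT F -> (\int[rho]_xi F (iter j evolve xi) = \int[rho]_xi F xi)%E.
Proof.
move=> F0 mF; elim: j => //= j IH.
have mi : measurable_fun setT (iter j evolve).
  by apply: measurable_to_Sprime => x; under eq_fun do rewrite ev_iter; exact: measurable_heat.
under eq_integral do rewrite -iterS iterSr.
by rewrite (integral_evolve (F := fun xi => F (iter j evolve xi)))//; exact: measurableT_comp.
Qed.

Definition increment xi x := heat T (ev xi) x - ev xi x.

Lemma measurable_increment x : measurable_fun setT (fun xi => increment xi x).
Proof. by apply: measurable_funB; [exact: measurable_heat|exact: measurable_eval]. Qed.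

(** If all these integrals vanished, each increment would be 0 almost surely. As [C] is countable,
    almost every [xi] would be fixed. *)
Lemma nonfixed_point : exists x0,
  (0 < \int[rho]_xi (increment xi x0 ^+ 2)%:E)%E.
Proof.
apply: contrapT => none.
have [dec decT _] := esum_enumeration R C.
have msq x : measurable_fun setT (fun xi => (increment xi x ^+ 2)%:E).
  by apply/measurable_EFinP; apply: measurable_funX; exact: measurable_increment.
pose Z x := [set xi | (increment xi x ^+ 2)%:E != 0%E].
have mZ x : measurable (Z x) by have := emeasurable_neq measurableT (msq x) 0%E; rewrite setTI.
have Z0 x : rho.-negligible (Z x).
  have : (\int[rho]_xi `|(increment xi x ^+ 2)%:E| = 0)%E.
    apply/eqP; rewrite eq_le integral_ge0// andbT leNgt; apply/negP => H; apply: none.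
    by exists x; under eq_integral => xi _ do rewrite -[(_ ^+ 2)%:E]gee0_abs ?lee_fin ?sqr_ge0//.
  move=> /(ae_eq_integral_abs rho measurableT (msq x)).1; apply: negligibleS => xi /= /eqP Zx H.
  by apply: Zx; exact: H.
pose F n := oapp Z set0 (dec n).
have FE : \bigcup_n F n = ~` [set xi | heat T (ev xi) = ev xi].
  apply/seteqP; split=> xi /=.
    move=> [n _]; rewrite /F; case: (dec n) => //= x; rewrite /Z/= => H E; move: H.
    by rewrite /increment E subrr expr0n/= eqxx.
  move=> H; apply: contrapT => nF; apply: H; apply/funext => x.
  have [n nx] := decT x; apply/eqP; rewrite -subr_eq0 -sqrf_eq0; apply: contrapT => nz.
  apply: nF; exists n => //; rewrite /F nx /= /Z/= eqe; exact/negP.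
have mF : measurable (\bigcup_n F n).
  by apply: bigcup_measurable => n _; rewrite /F; case: (dec n) => //= ; exact: measurable0.
have F0 : rho (\bigcup_n F n) = 0%E.
  apply: measure_negligible => //; apply: negligible_bigcup => n.
  by rewrite /F; case: (dec n) => /= [x|]; [exact: Z0|exact: negligible_set0].
move: rho_fixed; rewrite -[X in rho X]setCK -FE probability_setC// F0 sube0.
by rewrite ltxx.
Qed.

Lemma second_moment : exists2 tau : R, 0 <= tau & (\int[rho]_xi sqnormH N (ev xi) = tau%:E)%E.
Proof.
have [|tau] := ge0_lty_ex _ rho_moment; last by exists tau.
by apply: integral_ge0 => xi _; exact: sqnormH_ge0.
Qed.

Lemma measurable_norm : measurable_fun setT (fun xi => sqnormH N (ev xi)).
Proof. by apply: measurable_sqnormH => x; exact: measurable_eval. Qed.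

(** [|a - b|^2 <= 2 (|a|^2 + |b|^2)], and by invariance both moments equal [tau]. The bound is
    uniform in [j], hence available at the far end of the time grid. *)
Lemma diff_moment (tau : R) j : (\int[rho]_xi sqnormH N (ev xi) = tau%:E)%E ->
  (\int[rho]_xi sqnormH N (fun x => (heat (j%:R * T) (ev xi) x - ev xi x)%R) <= (4 * tau)%:E)%E.
Proof.
move=> tauE.
have miter : measurable_fun setT (fun xi => sqnormH N (heat (j%:R * T) (ev xi))).
  by apply: measurable_sqnormH => x; exact: measurable_heat.
apply: (@le_trans _ _ (\int[rho]_xi (2%:E * (sqnormH N (heat (j%:R * T) (ev xi)) + sqnormH N (ev xi))))%E).
  apply: ge0_le_integral => //.
  - by move=> xi _; exact: sqnormH_ge0.
  - apply: measurable_sqnormH => x; apply: measurable_funB; [exact: measurable_heat|exact: measurable_eval].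
  - apply: measurable_funeM; apply: emeasurable_funD => //; exact: measurable_norm.
  - by move=> xi _; exact: sqnormHB.
rewrite ge0_integralZl_EFin//; last 2 first.
- by move=> xi _; rewrite adde_ge0 ?sqnormH_ge0.
- by apply: emeasurable_funD => //; exact: measurable_norm.
rewrite ge0_integralD//; last 3 first.
- by move=> xi _; exact: sqnormH_ge0.
- by move=> xi _; exact: sqnormH_ge0.
- exact: measurable_norm.
rewrite [X in (_ * (X + _))%E](_ : _ = tau%:E); last first.
  rewrite -tauE -(integral_iter j (F := fun xi => sqnormH N (ev xi))).
  - by apply: eq_integral => xi _; rewrite ev_iter.
  - by move=> xi; exact: sqnormH_ge0.
  - exact: measurable_norm.
rewrite tauE -EFinD -EFinM lee_fin; lra.
Qed.

(** With [u] the evolved and [v] the original increment, [v^2 <= 2 u^2 + 2 (u - v)^2]. The last term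
    integrates to at most [8 s^2 A tau], which [s1] keeps below [beta / 2]; this leaves [beta / 4]
    for [u^2]. *)
Lemma increment_lower x0 (beta : R) : 0 < beta ->
  (beta%:E <= \int[rho]_xi (increment xi x0 ^+ 2)%:E)%E ->
  exists2 s0 : R, 0 < s0 & forall s, 0 <= s <= s0 ->
    ((beta / 4)%:E <= \int[rho]_xi (heat s (increment xi) x0 ^+ 2)%:E)%E.
Proof.
move=> b0 bI; have [tau tau0 tauE] := second_moment.
have [A A0 AP] := heat_sqr_increment x0 N0.
pose s1 := Num.sqrt (beta / (16 * A * (tau + 1))).
have s1E : s1 ^+ 2 = beta / (16 * A * (tau + 1)).
  rewrite sqr_sqrtr// divr_ge0 ?(ltW b0)//; apply: mulr_ge0; last lra.
  by rewrite mulr_ge0// ltW.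
have s1_gt0 : 0 < s1.
  rewrite sqrtr_gt0 divr_gt0//; apply: mulr_gt0; last lra.
  by rewrite mulr_gt0.
exists (Num.min 1 s1); first by rewrite lt_min ltr01.
move=> s /andP[s0]; rewrite le_min => /andP[s_le1 s_le].
have mh : measurable_fun setT (fun xi => (heat s (increment xi) x0 ^+ 2)%:E).
  apply/measurable_EFinP; apply: measurable_funX.
  by apply: measurable_real_sum => y; apply: measurable_funM;
    [exact: measurable_cst|exact: measurable_increment].
have mnorm : measurable_fun setT (fun xi => sqnormH N (increment xi)).
  by apply: measurable_sqnormH => x; exact: measurable_increment.
have key : (\int[rho]_xi (increment xi x0 ^+ 2)%:E <=
    2%:E * \int[rho]_xi (heat s (increment xi) x0 ^+ 2)%:E +
    (2 * (s ^+ 2 * A))%:E * \int[rho]_xi sqnormH N (increment xi))%E.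
  have c0 : 0 <= 2 * (s ^+ 2 * A).
    by rewrite mulr_ge0// mulr_ge0 ?(ltW A0)// sqr_ge0.
  rewrite -!ge0_integralZl_EFin//; last 2 first.
  - by move=> xi _; exact: sqnormH_ge0.
  - by move=> xi _; rewrite lee_fin sqr_ge0.
  rewrite -ge0_integralD//; last 4 first.
  - by move=> xi _; rewrite mule_ge0// lee_fin sqr_ge0.
  - exact: measurable_funeM.
  - by move=> xi _; rewrite mule_ge0 ?sqnormH_ge0.
  - exact: measurable_funeM.
  apply: ge0_le_integral => //.
  - by move=> xi _; rewrite lee_fin sqr_ge0.
  - by apply/measurable_EFinP; apply: measurable_funX; exact: measurable_increment.
  - by apply: emeasurable_funD; exact: measurable_funeM.
  - move=> xi _.
    apply: (@le_trans _ _ (2%:E * (heat s (increment xi) x0 ^+ 2)%:E +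
        2%:E * ((heat s (increment xi) x0 - increment xi x0) ^+ 2)%:E)%E).
      rewrite -!EFinM -EFinD lee_fin.
      move: (heat s (increment xi) x0) (increment xi x0) => u v.
      rewrite -subr_ge0 (_ : _ - _ = (2 * u - v) ^+ 2) ?sqr_ge0//; ring.
    rewrite leeD2l// [X in (_ <= X * _)%E](EFinM 2 (s ^+ 2 * A)) -muleA lee_wpmul2l ?lee_fin//.
    by apply: AP; rewrite s0.
have := le_trans bI key => {key}.
have mom : (\int[rho]_xi sqnormH N (increment xi) <= (4 * tau)%:E)%E.
  by have := diff_moment 1 tauE; under eq_integral do rewrite mul1r.
have I0 : (0 <= \int[rho]_xi (heat s (increment xi) x0 ^+ 2)%:E)%E.
  by apply: integral_ge0 => xi _; rewrite lee_fin sqr_ge0.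
move: (\int[rho]_xi (heat s (increment xi) x0 ^+ 2)%:E)%E I0 => I I0 H.
have cD : ((2 * (s ^+ 2 * A))%:E * \int[rho]_xi sqnormH N (increment xi) <= (beta / 2)%:E)%E.
  have c0 : 0 <= 2 * (s ^+ 2 * A).
    by rewrite mulr_ge0// mulr_ge0 ?(ltW A0)// sqr_ge0.
  apply: (@le_trans _ _ ((2 * (s ^+ 2 * A))%:E * (4 * tau)%:E)%E).
    by rewrite lee_wpmul2l// lee_fin.
  rewrite -EFinM lee_fin.
  have ss : s ^+ 2 <= beta / (16 * A * (tau + 1)).
    by rewrite -s1E; apply: lerXn2r; rewrite ?nnegrE// ltW.
  have At : 0 < 16 * A * (tau + 1) by apply: mulr_gt0; [rewrite mulr_gt0|lra].
  move: ss; rewrite ler_pdivlMr// => ss.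
  have : 0 <= s ^+ 2 * A by rewrite mulr_ge0 ?(ltW A0)// sqr_ge0.
  move: ss; set v := s ^+ 2; nra.
have {cD H}H := le_trans H (leeD2l _ cD).
case: I I0 H => [r|_ _|//]; last exact: leey.
by rewrite -EFinM -EFinD !lee_fin => _; lra.
Qed.

Lemma heat_grid n k xi : (0 < n)%N ->
  heat (k%:R * (T / n%:R)) (ev xi) =
  heat ((k %% n)%:R * (T / n%:R)) (ev (iter (k %/ n) evolve xi)).
Proof.
move=> n0; have nR : 0 < n%:R :> R by rewrite ltr0n.
have h0 : 0 <= T / n%:R by rewrite divr_ge0// ltW.
have kE : k%:R * (T / n%:R) = (k %% n)%:R * (T / n%:R) + (k %/ n)%:R * T.
  rewrite {1}(divn_eq k n) natrD natrM; field; exact: lt0r_neq0.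
rewrite ev_iter (heat_heat hp) -?kE//.
- by rewrite mulr_ge0.
- by rewrite mulr_ge0// ltW.
- exact/tempered_dom/eval_Sprime_tempered.
Qed.

Lemma heat_grid_increment n j r xi x : (r < n)%N ->
  heat ((j * n + r + n)%N%:R * (T / n%:R)) (ev xi) x -
  heat ((j * n + r)%N%:R * (T / n%:R)) (ev xi) x =
  heat (r%:R * (T / n%:R)) (increment (iter j evolve xi)) x.
Proof.
move=> rn; have n0 : (0 < n)%N by case: n rn.
have h0 : 0 <= T / n%:R by rewrite divr_ge0// ltW.
have tev := fun xi => tempered_dom (eval_Sprime_tempered xi).
rewrite (heat_grid (j * n + r + n) xi n0) (heat_grid (j * n + r) xi n0).
have -> : ((j * n + r + n) %% n = r)%N by rewrite modnDr modnMDl modn_small.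
have -> : ((j * n + r) %% n = r)%N by rewrite modnMDl modn_small.
have -> : ((j * n + r + n) %/ n = j.+1)%N by rewrite addnAC -mulSnr divnMDl// divn_small// addn0.
have -> : ((j * n + r) %/ n = j)%N by rewrite divnMDl// divn_small// addn0.
symmetry; apply: (heatB (mulr_ge0 (ler0n R r) h0)); last exact: tev.
exact: (heat_dom_heat hp (ltW T0) (tev _)).
Qed.

(** Otherwise integrate the reverse inequality. The choice [T / q <= s0] puts the first [m] of the
    [n = q m] grid times of each period into [[0, s0]], so the differences contribute at least
    [(n^3 - 1) m beta / 4]. The right side is at most [e Q L] with [Q = n^3 q m], and [e] makes this
    less than [n^3 m beta / 8]. The two contradict each other because [n^3 >= 2]. *)
Lemma selection : exists (x0 : C) (e : R) (q : nat), [/\ 0 < e, (0 < q)%N &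
  forall m, (1 < m)%N -> let n := (q * m)%N in let h := T / n%:R in let Q := (n ^ 4)%N in
  exists xi, (e%:E * (\sum_(k < Q) sqnormH N (heat (k%:R * h)%R (ev xi)) +
      Q%:R%:E * sqnormH N (fun x => (heat (Q%:R * h) (ev xi) x - heat (0%:R * h) (ev xi) x)%R)) <
    (\sum_(k < Q - n) (heat ((k + n)%N%:R * h) (ev xi) x0 - heat (k%:R * h) (ev xi) x0) ^+ 2)%:E)%E].
Proof.
have [x0 hx0] := nonfixed_point.
have [beta b0 bI] : exists2 beta : R, 0 < beta &
    (beta%:E <= \int[rho]_xi (increment xi x0 ^+ 2)%:E)%E.
  case: (\int[rho]_xi _)%E hx0 => [r|_|//]; first by rewrite lte_fin => r0; exists r.
  by exists 1 => //; exact: leey.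
have [s0 s0_gt0 sP] := increment_lower b0 bI.
have [tau tau0 tauE] := second_moment.
have [c c0 cP] := heat_sqnormH_le N0.
pose q := (Num.truncn (T / s0)).+1.
have qs : T / q%:R <= s0.
  rewrite ler_pdivrMr ?ltr0n// mulrC -ler_pdivrMr//; apply: ltW.
  by rewrite /q; exact: truncnS_gt.
have qR : 0 < q%:R :> R by rewrite ltr0n.
pose L := expR (c * T) * tau + 4 * tau.
have L0 : 0 <= L by rewrite /L addr_ge0 ?mulr_ge0 ?(ltW (expR_gt0 _)).
have L1 : 0 < L + 1 by rewrite ltr_wpDl.
pose e := beta / (8 * q%:R * (L + 1)).
have e0 : 0 < e by apply: divr_gt0 => //; apply: mulr_gt0 => //; apply: mulr_gt0.
exists x0, e, q; split=> // m m1 n h Q.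
have n0 : (0 < n)%N by rewrite muln_gt0/= (ltn_trans _ m1).
have n2 : (2 <= n)%N by rewrite (leq_trans m1)// leq_pmull.
have nR : 0 < n%:R :> R by rewrite ltr0n.
have h0 : 0 <= h by rewrite divr_ge0 ?ltW.
have mheat t x : measurable_fun setT (fun xi => heat t (ev xi) x) by exact: measurable_heat.
pose f k xi := heat (k%:R * h) (ev xi).
pose G k xi := ((f (k + n)%N xi x0 - f k xi x0) ^+ 2)%:E.
have G0 k xi : (0 <= G k xi)%E by rewrite lee_fin sqr_ge0.
have mG k : measurable_fun setT (G k).
  by apply/measurable_EFinP; apply: measurable_funX; apply: measurable_funB; exact: mheat.
pose H xi := sqnormH N (fun x => (f Q xi x - f 0 xi x)%R).
have mf k : measurable_fun setT (fun xi => sqnormH N (f k xi)).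
  by apply: measurable_sqnormH => x; exact: mheat.
have mH : measurable_fun setT H.
  by apply: measurable_sqnormH => x; apply: measurable_funB; exact: mheat.
have QE : (Q = n ^ 3 * n)%N by rewrite /Q expnSr.
have Jn : (Q - n = (n ^ 3 - 1) * n)%N by rewrite QE mulnBl mul1n.
apply: contrapT => none.
have {}none xi : (\sum_(k < Q - n) G k xi <=
    e%:E * (\sum_(k < Q) sqnormH N (f k xi) + Q%:R%:E * H xi))%E.
  rewrite leNgt; apply/negP => lt; apply: none; exists xi.
  by move: lt; rewrite /G sumEFin.
have sum0 xi : (0 <= \sum_(k < Q) sqnormH N (f k xi))%E.
  by apply: sume_ge0 => k _; exact: sqnormH_ge0.
have QH0 xi : (0 <= Q%:R%:E * H xi)%E by rewrite mule_ge0// ?lee_fin// sqnormH_ge0.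
have lower : ((((n ^ 3 - 1) * m)%N%:R * (beta / 4))%:E <= \int[rho]_xi \sum_(k < Q - n) G k xi)%E.
  rewrite ge0_integral_sum// Jn.
  apply: (sum_blocks (a := fun k => \int[rho]_xi G k xi)%E).
  - by rewrite leq_pmull.
  - by move=> k; apply: integral_ge0.
  - move=> j r rm; have rn : (r < n)%N by rewrite (leq_trans rm)// leq_pmull.
    rewrite (_ : (\int[rho]_xi _)%E = (\int[rho]_xi (heat (r%:R * h) (increment xi) x0 ^+ 2)%:E)%E).
      apply: sP; rewrite mulr_ge0//=; apply: le_trans qs.
      have mR : 0 < m%:R :> R by rewrite ltr0n (ltn_trans _ m1).
      rewrite ler_pdivlMr// (_ : _ * _ = r%:R / m%:R * T); last first.
        by rewrite /h /n natrM; field; rewrite !gt_eqF.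
      rewrite -[leRHS]mul1r ler_wpM2r ?(ltW T0)// ler_pdivrMr// mul1r.
      by rewrite ler_nat ltnW.
    rewrite -(integral_iter j (F := fun xi => (heat (r%:R * h) (increment xi) x0 ^+ 2)%:E)).
    + by apply: eq_integral => xi _; rewrite /G /f /h heat_grid_increment.
    + by move=> xi; rewrite lee_fin sqr_ge0.
    + apply/measurable_EFinP; apply: measurable_funX.
      by apply: measurable_real_sum => y; apply: measurable_funM;
        [exact: measurable_cst|exact: measurable_increment].
  - by rewrite divr_ge0// ltW.
(* Each grid time is a multiple of [T], harmless by invariance, plus a remainder below [T] that
   costs [exp (c T)]; the boundary term is [diff_moment] at [n^3] periods. *)
have upper : (\int[rho]_xi (\sum_(k < Q) sqnormH N (f k xi) + Q%:R%:E * H xi) <= (Q%:R * L)%:E)%E.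
  rewrite ge0_integralD//; last 2 first.
  - by apply: emeasurable_sum.
  - exact: measurable_funeM.
  rewrite mulrDr EFinD; apply: leeD.
    rewrite ge0_integral_sum//; last by move=> k xi _; exact: sqnormH_ge0.
    rewrite EFinM -sume_const; last by rewrite lee_fin mulr_ge0// ltW ?expR_gt0.
    apply: lee_sum => k _.
    have mn : measurable_fun setT (fun xi => (expR (c * T))%:E * sqnormH N (ev xi))%E.
      by apply: measurable_funeM; exact: measurable_norm.
    apply: (@le_trans _ _ (\int[rho]_xi ((expR (c * T))%:E * sqnormH N (ev (iter (k %/ n) evolve xi))))%E).
      apply: ge0_le_integral => //.
      - by move=> xi _; exact: sqnormH_ge0.
      - apply: measurable_funeM; apply: measurable_sqnormH => x.
        by under eq_fun do rewrite ev_iter; exact: mheat.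
      - move=> xi _; rewrite /f /h heat_grid//.
        have kn : (k %% n)%:R * (T / n%:R) <= T.
          rewrite mulrCA -[leRHS]mulr1 ler_wpM2l ?(ltW T0)// ler_pdivrMr// mul1r ler_nat.
          by rewrite ltnW// ltn_mod.
        apply: le_trans (cP _ _ (eval_Sprime_tempered _) _) _; first by rewrite mulr_ge0.
        by rewrite lee_wpmul2r ?sqnormH_ge0// lee_fin ler_expR ler_wpM2l.
    rewrite (integral_iter (k %/ n) (F := fun xi => ((expR (c * T))%:E * sqnormH N (ev xi))%E))//.
      rewrite ge0_integralZl_EFin// ?tauE//.
      - by move=> xi _; exact: sqnormH_ge0.
      - exact: measurable_norm.
    by move=> xi; rewrite mule_ge0 ?sqnormH_ge0// lee_fin ltW ?expR_gt0.
  rewrite ge0_integralZl_EFin//; last by move=> xi _; exact: sqnormH_ge0.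
  rewrite EFinM lee_wpmul2l ?lee_fin//.
  have := diff_moment (n ^ 3) tauE; congr (_ <= _)%E; apply: eq_integral => xi _.
  rewrite /H /f mul0r (heat0 hp) (_ : Q%:R * h = (n ^ 3)%N%:R * T)//.
  by rewrite QE natrM /h; field; rewrite gt_eqF.
have chain : ((((n ^ 3 - 1) * m)%N%:R * (beta / 4))%:E <= e%:E * (Q%:R * L)%:E)%E.
  apply: (le_trans lower); apply: (@le_trans _ _
    (\int[rho]_xi (e%:E * (\sum_(k < Q) sqnormH N (f k xi) + Q%:R%:E * H xi)))%E).
    apply: ge0_le_integral => //.
    - by move=> xi _; exact: sume_ge0.
    - exact: emeasurable_sum.
    - apply: measurable_funeM; apply: emeasurable_funD; last exact: measurable_funeM.
      exact: emeasurable_sum.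
  rewrite ge0_integralZl_EFin//; last 3 first.
  - by move=> xi _; exact: adde_ge0.
  - by apply: emeasurable_funD; [exact: emeasurable_sum|exact: measurable_funeM].
  - exact: ltW.
  by rewrite lee_wpmul2l// lee_fin ltW.
move: chain; rewrite -EFinM lee_fin; apply/negP; rewrite -ltNge.
have Qq : Q%:R = n%:R ^+ 3 * (q%:R * m%:R) :> R by rewrite QE natrM natrX /n natrM.
have mR : 0 < m%:R :> R by rewrite ltr0n (ltn_trans _ m1).
have n3 : 2 <= n%:R ^+ 3 :> R.
  by rewrite -natrX ler_nat (leq_trans n2)// -{1}(expn1 n) leq_pexp2l.
have nm : 0 < n%:R ^+ 3 * m%:R :> R by rewrite mulr_gt0// exprn_gt0.
apply: (@lt_le_trans _ _ (n%:R ^+ 3 * m%:R * (beta / 8))).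
  rewrite (_ : e * _ = n%:R ^+ 3 * m%:R * (beta / 8) * (L / (L + 1))); last first.
    by rewrite /e Qq; field; rewrite !gt_eqF.
  rewrite gtr_pMr; last by rewrite mulr_gt0// divr_gt0.
  by rewrite ltr_pdivrMr// mul1r ltrDl.
rewrite natrM natrB ?expn_gt0 ?n0// natrX.
have : 0 <= m%:R * beta by rewrite mulr_ge0 ?ltW.
move: n3; set v := n%:R ^+ 3; nra.
Qed.

Theorem invariant_imaginary_eigenvalue : has_imaginary_eigenvalue C w N.
Proof.
have [x0 [e [q [e0 q0 sel]]]] := selection.
have [A A0 taylor] := heat_taylor_H hw K1 degK hp N0.
(* As a factor of the subdivision it guarantees [m > 1] and [T <= k], so that [h <= 1], for every
   index [n]. *)
pose m1 := (Num.truncn T).+2.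
have m1T : T <= m1%:R.
  by rewrite ltW// (lt_trans (truncnS_gt T))// ltr_nat.
have qR : 0 < q%:R :> R by rewrite ltr0n.
pose err (x : C) : R := error_bound N A T e x.
have err0 x : 0 <= err x.
  have s0 : 0 < Num.sqrt e by rewrite sqrtr_gt0.
  apply: addr_ge0; apply: mulr_ge0; rewrite ?powR_ge0 ?(ltW T0)//.
    by rewrite mulr_ge0 ?divr_ge0 ?(ltW s0)// mulr_ge0 ?powR_ge0.
  by rewrite divr_ge0// ltW// mulr_gt0.
have approx (n : nat) : exists X : (C -> R) * (C -> R) * R * R,
    [/\ (sqnormH N X.1.1.1 <= (4 / e)%:E)%E, (sqnormH N X.1.1.2 <= (4 / e)%:E)%E,
      X.1.1.1 x0 = 1, X.1.1.2 x0 = 0 &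
      [/\ forall x, `|laplacian w X.1.1.1 x - (X.1.2 * X.1.1.1 x - X.2 * X.1.1.2 x)| <= err x / n.+1%:R,
        forall x, `|laplacian w X.1.1.2 x - (X.2 * X.1.1.1 x + X.1.2 * X.1.1.2 x)| <= err x / n.+1%:R,
        X.1.2 = T / (2 * (q * m1)%N%:R) / n.+1%:R * (X.1.2 ^+ 2 + X.2 ^+ 2) &
        e * weight N (val x0) ^+ 2 / T ^+ 2 <= X.1.2 ^+ 2 + X.2 ^+ 2]].
  have mgt1 : (1 < m1 * n.+1)%N by rewrite (leq_trans _ (leq_pmulr _ _)).
  have [xi hxi] := sel _ mgt1; set k := (q * (m1 * n.+1))%N in hxi.
  have k0 : (0 < k)%N by rewrite muln_gt0 q0.
  have nk : (n.+1 <= k)%N by rewrite /k mulnA leq_pmull// muln_gt0 q0.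
  have k4 : (0 < k ^ 4)%N by rewrite expn_gt0 k0.
  have [z pz] := prim_root_exists R k4.
  have kQ : (k <= k ^ 4)%N by rewrite -{1}(expn1 k) leq_pexp2l.
  have [m hm] := fourier_select (f := fun j : nat => heat (j%:R * (T / k%:R)) (ev xi)) pz kQ (ltW e0) (sqnormH_ge0 N _) hxi.
  have Tk : T <= k%:R by rewrite (le_trans m1T)// ler_nat /k mulnCA leq_pmulr// muln_gt0 q0.
  have dxi : dom (ev xi) by exact/tempered_dom/eval_Sprime_tempered.
  have [a [b [al [om [aY bY a0 b0 [E1 E2 E3 E4]]]]]] :=
    approximate_eigenvector hp taylor T0 e0 k0 Tk pz dxi hm.
  have le_err x : err x / k%:R <= err x / n.+1%:R.
    by rewrite ler_wpM2l// lef_pV2 ?posrE ?ltr0n// ler_nat.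
  exists (a, b, al, om); split=> //=; split=> [x|x||].
  - exact: le_trans (E1 x) (le_err x).
  - exact: le_trans (E2 x) (le_err x).
  - rewrite {1}E3; congr (_ * _).
    by rewrite /k mulnA natrM; field; rewrite !gt_eqF ?ltr0n// muln_gt0 q0.
  - by rewrite ler_pdivrMr ?exprn_gt0// [leRHS]mulrC.
have [X hX] := choice approx.
apply: (@limit_eigenvector R d C w hw N x0 (4 / e) (e * weight N (val x0) ^+ 2 / T ^+ 2)
  (T / (2 * (q * m1)%N%:R)) err (fun n => (X n).1.1.1) (fun n => (X n).1.1.2)
  (fun n => (X n).1.2) (fun n => (X n).2)).
- by move=> n; have [] := hX n.
- by move=> n; have [] := hX n.
- by move=> n; have [] := hX n.
- by move=> n; have [] := hX n.
- by move=> n; have [_ _ _ _ []] := hX n.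
- by move=> n; have [_ _ _ _ []] := hX n.
- by move=> n; have [_ _ _ _ []] := hX n.
- apply: divr_gt0; last exact: exprn_gt0.
  by apply: mulr_gt0 => //; apply: exprn_gt0; exact: weight_gt0.
- by move=> n; have [_ _ _ _ []] := hX n.
Qed.

End InvariantMeasure.

(** * Rotation of an eigenvector *)

Section TrigonometricBounds.
Variable R : realType.
Implicit Types x : R.

(** The mean value theorem, applied twice for the sine. Quadratic accuracy suffices, since it
    matches the [O(h^2)] error of the expansion of [P_h]. *)
Lemma trig_bounds x : `|sin x - x| <= x ^+ 2 /\ `|cos x - 1| <= x ^+ 2.
Proof.
wlog x0 : x / 0 <= x.
  move=> H; have [|x0] := leP 0 x; first exact: H.
  have [] := H (- x); first by rewrite oppr_ge0 ltW.
  by rewrite sinN cosN sqrrN -opprD normrN.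
have cs (f : R -> R) : continuous f -> forall y : R, {within `[0, y], continuous f}.
  by move=> cf y; exact: continuous_subspaceT.
have sin_le (y : R) : 0 <= y -> `|sin y| <= y.
  move=> y0; have [c _] := MVT_segment y0 (fun z _ => is_derive_sin z) (cs _ (@continuous_sin R) y).
  rewrite sin0 !subr0 => ->; rewrite normrM (ger0_norm y0).
  by rewrite -[leRHS]mul1r ler_wpM2r// cos_max.
have cos_le (y : R) : 0 <= y -> exists2 c, 0 <= c <= y & cos y - 1 = - sin c * y.
  move=> y0; have [c] := MVT_segment y0 (fun z _ => is_derive_cos z) (cs _ (@continuous_cos R) y).
  by rewrite in_itv/= cos0 subr0 => cy E; exists c.
split.
  pose g := fun y : R => sin y - y.
  have dg (z : R) : is_derive z 1 g (cos z - 1) by exact: is_deriveB.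
  have cg : continuous g.
    by move=> z; apply: cvgB; [exact: continuous_sin|exact: cvg_id].
  have [c] := MVT_segment x0 (fun z _ => dg z) (cs _ cg x).
  rewrite in_itv/= /g sin0 !subr0 => /andP[c0 cx] ->.
  have [c' _ ->] := cos_le c c0.
  rewrite !normrM normrN (ger0_norm c0) (ger0_norm x0) expr2 ler_wpM2r//.
  by rewrite (le_trans _ cx)// -[leRHS]mul1r ler_wpM2r// sin_max.
have [c /andP[c0 cx] ->] := cos_le x x0.
by rewrite normrM normrN (ger0_norm x0) expr2 ler_wpM2r// (le_trans (sin_le _ c0)).
Qed.

End TrigonometricBounds.

Section Rotation.
Variables (R : realType) (d : nat) (C : set (Zd d)).
Variables (w : Zd d -> Zd d -> R) (hw : conductances w).
Variables (K : R) (K1 : 1 <= K).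
Hypothesis degK : forall x : C, degree w x <= K * japanese R (val x) ^+ 2.
Variables (p : R -> C -> C -> R) (hp : heat_kernel w p).
Variables (N : R) (N0 : 0 <= N) (xi eta : C -> R) (om : R).
Hypotheses (xiN : in_H N xi) (etaN : in_H N eta).
Hypothesis lap_xi : forall x, laplacian w xi x = - om * eta x.
Hypothesis lap_eta : forall x, laplacian w eta x = om * xi x.
Implicit Types (x y : C) (s t h a b : R).

Local Notation jap x := (japanese R (val x)).
Local Notation heat := (heat p).
Local Notation dom := (heat_dom p).

(** The real part of [exp (- i a) (xi + i eta)]; its imaginary part is the rotation by a further
    quarter turn, [rotation (a + pi / 2)]. *)
Definition rotation a x := cos a * xi x + sin a * eta x.

Lemma rotationD a b x :
  rotation (a + b) x = cos b * rotation a x + sin b * rotation (a + pi / 2) x.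
Proof. rewrite /rotation cosD sinD cosDpihalf sinDpihalf; ring. Qed.

Lemma lap_rotation a x : laplacian w (rotation a) x = - om * rotation (a + pi / 2) x.
Proof.
rewrite lapD !lapZ lap_xi lap_eta /rotation cosDpihalf sinDpihalf; ring.
Qed.

Lemma rotation_bound : exists2 Y : R, 0 <= Y & forall a, (sqnormH N (rotation a) <= (Y ^+ 2)%:E)%E.
Proof.
have [X X0 XE] := ge0_lty_ex (sqnormH_ge0 N xi) xiN.
have [Z Z0 ZE] := ge0_lty_ex (sqnormH_ge0 N eta) etaN.
have XZ : 0 <= 2 * (X + Z) by rewrite mulr_ge0// addr_ge0.
exists (Num.sqrt (2 * (X + Z))) => // a; rewrite sqr_sqrtr//.
apply: le_trans (sqnormHD N (fun x => cos a * xi x) (fun x => sin a * eta x)) _.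
rewrite !sqnormHZ XE ZE -[leLHS]/((2 * (cos a ^+ 2 * X + sin a ^+ 2 * Z))%:E).
rewrite lee_fin ler_wpM2l//.
have := cos2Dsin2 a; have := sqr_ge0 (cos a); have := sqr_ge0 (sin a).
move: (cos a ^+ 2) (sin a ^+ 2) => u v; nra.
Qed.

Lemma rotation_dom a : dom (rotation a).
Proof.
have [Y Y0 YP] := rotation_bound; have [c c0 cP] := heat_in_H hw K1 degK hp N0.
by have [] := cP (rotation a) (le_lt_trans (YP a) (ltry _)).
Qed.

(** To first order [P_h] subtracts [h Delta], which adds [om * h] times the quarter turn, and
    rotating by [om * h] does the same. The constant is uniform in [a] because all rotations have
    norm at most [Y]. *)
Lemma heat_rotation_step : exists2 B : R, 0 <= B & forall a h x, 0 <= h <= 1 ->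
  `|heat h (rotation a) x - rotation (a + om * h) x| <= h ^+ 2 * B * jap x `^ (N + 4).
Proof.
have [Y Y0 YP] := rotation_bound.
have [A A0 AP] := heat_taylor_H hw K1 degK hp N0.
exists (A * Y + 2 * om ^+ 2 * Y).
  by apply: addr_ge0; apply: mulr_ge0 => //; apply: mulr_ge0 => //; exact: sqr_ge0.
move=> a h x h01; have [_ step] := AP _ _ h x (YP a) Y0 h01.
have ptw b : `|rotation b x| <= jap x `^ (N + 4) * Y.
  have := in_H_pointwise x (YP b); rewrite sqrtr_sqr (ger0_norm Y0) => H.
  by apply: le_trans H _; rewrite ler_wpM2r// ler_powR ?japanese_ge1// lerDl.
have [sin_b cos_b] := trig_bounds (om * h).
rewrite (_ : heat h (rotation a) x - _ =
    (heat h (rotation a) x - rotation a x + h * laplacian w (rotation a) x) -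
    ((cos (om * h) - 1) * rotation a x + (sin (om * h) - om * h) * rotation (a + pi / 2) x)); last first.
  by rewrite rotationD lap_rotation; ring.
apply: le_trans (ler_normB _ _) _.
rewrite (_ : h ^+ 2 * _ * _ = h ^+ 2 * (A * jap x `^ (N + 4) * Y) +
  ((om * h) ^+ 2 * (jap x `^ (N + 4) * Y) + (om * h) ^+ 2 * (jap x `^ (N + 4) * Y))); last by ring.
apply: lerD => //; apply: le_trans (ler_normD _ _) _; rewrite !normrM.
by apply: lerD; apply: ler_pM.
Qed.

(* The one-step errors are [O(h^2) <x>^(N + 4)], and this weight lies in
   [H_{-(N + 4 + d)}], so that its evolution up to time [t] is bounded at [x]. *)
Theorem heat_rotation a t : 0 <= t -> heat t (rotation a) = rotation (a + om * t).
Proof.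
move=> t0; apply/funext => x.
have [B B0 step] := heat_rotation_step.
pose V y := jap y `^ (N + 4).
pose M := N + 4 + d%:R.
have M0 : 0 <= M by rewrite !addr_ge0.
have VM : in_H M V.
  rewrite /in_H; apply: (le_lt_trans _ (summable_weight R C (leqnn (2 * d)))).
  rewrite sqnormHE; apply: le_esum => y _; rewrite lee_fin /V /weight.
  rewrite -exprMn -powRD; last by apply/implyP => _; rewrite gt_eqF// japanese_gt0.
  rewrite (_ : - M + (N + 4) = - d%:R); last by rewrite /M; ring.
  have J0 : 0 <= jap y by rewrite ltW ?japanese_gt0.
  by rewrite powRN (powR_mulrn d J0) exprVn -exprM (mulnC d 2).
have [c c0 cP] := heat_in_H hw K1 degK hp M0.
have [Vdom VP] := cP V VM.
have [Z Z0 ZE] := ge0_lty_ex (sqnormH_ge0 M V) VM.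
pose W := jap x `^ M * Num.sqrt (expR (c * t) * Z).
have VW s : 0 <= s <= t -> heat s V x <= W.
  move=> /andP[s0 st]; apply: le_trans (ler_norm _) _; apply: in_H_pointwise.
  apply: le_trans (VP s s0) _; rewrite ZE -EFinM lee_fin ler_wpM2r//.
  by rewrite ler_expR ler_wpM2l.
have W0 : 0 <= W by rewrite mulr_ge0 ?powR_ge0.
(* Telescoping over the steps: a one-step error is dominated by a multiple of [V], and by positivity
   its further evolution by the evolution of [V], which is at most [W] at [x]. *)
have tele h k b : 0 <= h <= 1 -> k%:R * h <= t ->
    `|heat (k%:R * h) (rotation b) x - rotation (b + om * (k%:R * h)) x| <= k%:R * (h ^+ 2 * B * W).
  move=> /andP[h0 h1]; elim: k b => [|k IH] b.
    by rewrite !mul0r mulr0 addr0 (heat0 hp) subrr normr0.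
  move=> kt; have kt' : k%:R * h <= t by apply: le_trans kt; rewrite ler_wpM2r// ler_nat.
  have kh0 : 0 <= k%:R * h by rewrite mulr_ge0.
  have kE : k.+1%:R * h = k%:R * h + h by rewrite -natr1; ring.
  rewrite kE -(heat_heat hp kh0 h0 (rotation_dom b)).
  rewrite (_ : _ - _ = heat (k%:R * h) (fun y => heat h (rotation b) y - rotation (b + om * h) y) x +
    (heat (k%:R * h) (rotation (b + om * h)) x - rotation (b + om * h + om * (k%:R * h)) x)); last first.
    rewrite heatB//; [|exact: (heat_dom_heat hp h0 (rotation_dom b))|exact: rotation_dom].
    rewrite (_ : b + om * h + om * (k%:R * h) = b + om * (k%:R * h + h)); last by ring.
    by rewrite addrA subrK.
  apply: le_trans (ler_normD _ _) _.
  rewrite -natr1 mulrDl mul1r addrC; apply: lerD; first exact: IH.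
  have sdom : dom (fun y => heat h (rotation b) y - rotation (b + om * h) y).
    apply: (heat_domD (heat_dom_heat hp h0 (rotation_dom b))).
    exact: heat_domN (rotation_dom _).
  apply: le_trans (ler_norm_heat hp kh0 _ sdom) _.
  apply: (@le_trans _ _ (heat (k%:R * h) (fun y => h ^+ 2 * B * V y) x)).
    apply: (ler_heat hp kh0) => [||y]; [exact: heat_dom_norm|exact: heat_domZ|].
    by apply: step; rewrite h0.
  rewrite heatZ// ler_wpM2l; [by []| |by apply: VW; rewrite kh0].
  by rewrite mulr_ge0// sqr_ge0.
apply/eqP; rewrite -subr_eq0 -normr_le0 leNgt; apply/negP => D0.
set D := `|_| in D0.
(* The first summand ensures [t / n <= 1], the second makes the total error [t^2 B W / n] smaller
   than the supposed discrepancy [D]. *)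
pose n := (Num.truncn t + Num.truncn (t ^+ 2 * B * W / D)).+1.
have nR : 0 < n%:R :> R by rewrite ltr0n.
have tn : t <= n%:R.
  by rewrite ltW// (lt_le_trans (truncnS_gt _))// ler_nat ltnS leq_addr.
have cn : t ^+ 2 * B * W / D < n%:R.
  by rewrite (lt_le_trans (truncnS_gt _))// ler_nat ltnS leq_addl.
have nt : n%:R * (t / n%:R) = t by rewrite mulrC divfK// gt_eqF.
have h01 : 0 <= t / n%:R <= 1 by rewrite divr_ge0//= ler_pdivrMr// mul1r.
have := tele (t / n%:R) n a h01; rewrite nt lexx => /(_ isT).
rewrite -/D (_ : n%:R * _ = t ^+ 2 * B * W / n%:R); last by field; rewrite gt_eqF.
rewrite ler_pdivlMr// leNgt => /negP; apply.
by rewrite [ltRHS]mulrC -ltr_pdivrMr.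
Qed.

End Rotation.

(** * Uniform measure on the circle *)

Section CircleMeasure.
Variable R : realType.
Implicit Types (A B : set R) (s : R).

Local Notation leb := (@lebesgue_measure R).

Lemma measurable_translate s : measurable_fun [set: measurableTypeR R] (fun x : measurableTypeR R => x + s : measurableTypeR R).
Proof. by apply: measurable_funD; [exact: measurable_id|exact: measurable_cst]. Qed.

Lemma lebesgue_measure_translate s A : measurable A -> leb [set x | A (x + s)] = leb A.
Proof.
move=> mA.
suff <- : pushforward leb (fun x : measurableTypeR R => x + s : measurableTypeR R) A = leb A by [].
have mtr := measurable_translate s.
apply/esym/lebesgue_measure_unique => //= _ [[a b]] _ <-.
rewrite /pushforward (_ : _ @^-1` _ = `]a - s, b - s]%classic); last first.
  by apply/seteqP; split=> x /=; rewrite !in_itv/= ltrBlDr lerBrDr.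
by rewrite !lebesgue_measure_itv/= !lte_fin ltrD2r -!EFinB opprB addrA subrK.
Qed.

(** Rotation invariance of the circle: translate to [[s, s + 1[], cut at 1, and move the part beyond
    1 back by one period. *)
Lemma lebesgue_measure_periodic s A : measurable A -> (forall x, A (x + 1) <-> A x) ->
  leb ([set x | A (x + s)] `&` `[0, 1[) = leb (A `&` `[0, 1[).
Proof.
move=> mA A1.
have An x (n : nat) : A (x + n%:R) <-> A x.
  by elim: n => [|n IH]; rewrite ?addr0// -natr1 addrA A1.
have Az x (z : int) : A (x + z%:~R) <-> A x.
  case: z => n; first exact: An.
  by rewrite -(An (x + _) n.+1) NegzE mulrNz -pmulrn subrK.
have mi a b : measurable (`[a, b[%classic : set R) by exact: measurable_itv.
(* By periodicity [s] may be replaced by its fractional part. *)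
wlog /andP[s0 s1] : s / 0 <= s < 1.
  move=> H; pose s' := s - (Num.floor s)%:~R.
  rewrite -(H s'); last first.
    have /andP[fl fs] := floor_itv s; rewrite intrD in fs.
    by rewrite /s' subr_ge0 fl ltrBlDr addrC.
  congr (leb (_ `&` _)); apply/seteqP; split=> x /=; rewrite /s' addrA.
    by rewrite -(Az (x + s - _) (Num.floor s)) subrK.
  by rewrite -{1}(Az (x + s - _) (Num.floor s)) subrK.
have -> : [set x | A (x + s)] `&` `[0, 1[ = [set x | (A `&` `[s, s + 1[) (x + s)].
  apply/seteqP; split=> x /=; rewrite !in_itv/= => -[Ax /andP[x0 x1]]; split=> //.
    by rewrite lerDr x0 addrC ltrD2l.
  by move: x0 x1; rewrite lerDr addrC ltrD2l => -> ->.
rewrite lebesgue_measure_translate; last exact: measurableI.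
have -> : A `&` `[s, s + 1[ = (A `&` `[s, 1[) `|` (A `&` `[1, s + 1[).
  rewrite -setIUr; congr (_ `&` _); apply/seteqP; split=> x /=; rewrite !in_itv/=.
    by move=> /andP[x0 x1]; case: (ltP x 1) => x2; [left|right]; rewrite ?x0 ?x1.
  by case=> /andP[a1 a2]; apply/andP; split; lra.
have -> : A `&` `[0, 1[ = (A `&` `[s, 1[) `|` (A `&` `[0, s[).
  rewrite -setIUr; congr (_ `&` _); apply/seteqP; split=> x /=; rewrite !in_itv/=.
    by move=> /andP[x0 x1]; case: (leP s x) => xs; [left|right]; rewrite ?x0 ?x1.
  by case=> /andP[a1 a2]; apply/andP; split; lra.
have E : leb (A `&` `[1, s + 1[) = leb (A `&` `[0, s[).
  rewrite -(lebesgue_measure_translate 1 (A := A `&` `[1, s + 1[)); last exact: measurableI.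
  congr (leb _); apply/seteqP; split=> x /=; rewrite !in_itv/= => -[/A1 Ax /andP[x0 x1]].
    by split=> //; apply/andP; split; lra.
  by split=> //; apply/andP; split; lra.
rewrite !measureU//; try exact: measurableI; last 2 first.
- by apply/seteqP; split=> x //=; rewrite !in_itv/= => -[[_ /andP[a1 a2]] [_ /andP[b1 b2]]]; lra.
- by apply/seteqP; split=> x //=; rewrite !in_itv/= => -[[_ /andP[a1 a2]] [_ /andP[b1 b2]]]; lra.
congr (_ + _)%E; exact: E.
Qed.

(** The circle is parametrised by [[0, 1[], with angle [2 pi a], so that the total mass is 1 without
    normalisation. *)
Definition circle_measure : set (measurableTypeR R) -> \bar R :=
  mrestr lebesgue_measure (measurable_itv `[0, 1[).

HB.instance Definition _ := Measure.on circle_measure.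

Lemma circle_measure_setT : circle_measure setT = 1%E.
Proof.
by rewrite /circle_measure /mrestr setTI lebesgue_measure_itv/= lte_fin ltr01 oppr0 adde0.
Qed.

HB.instance Definition _ := Measure_isProbability.Build _ _ _ circle_measure circle_measure_setT.

End CircleMeasure.

(** * From an eigenvalue to an invariant measure *)

Section RotationLaw.
Variables (R : realType) (d : nat) (C : set (Zd d)).
Variables (w : Zd d -> Zd d -> R) (hw : conductances w).
Variables (K : R) (K1 : 1 <= K).
Hypothesis degK : forall x : C, degree w x <= K * japanese R (val x) ^+ 2.
Variables (p : R -> C -> C -> R) (hp : heat_kernel w p).
Variables (N : R) (N0 : 0 <= N) (xi eta : C -> R) (om : R).
Hypotheses (xiN : in_H N xi) (etaN : in_H N eta) (om0 : om != 0).
Hypothesis lap_xi : forall x, laplacian w xi x = - om * eta x.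
Hypothesis lap_eta : forall x, laplacian w eta x = om * xi x.
Hypothesis nonzero : exists x, (xi x != 0) || (eta x != 0).
Implicit Types (x y : C) (s t h a b : R).

Local Notation heat := (heat p).
Local Notation ev xi := (@eval_Sprime R d C xi).
Local Notation rot := (rotation xi eta).

Lemma rotation_tempered a : @tempered R d C (rot a).
Proof.
by exists N => //; apply: in_HD; exact: in_HZ.
Qed.

Definition rotation_path (a : measurableTypeR R) : Sprime R C :=
  mk_Sprime (rotation_tempered (pi *+ 2 * a)).

Lemma measurable_rotation_path : measurable_fun setT rotation_path.
Proof.
apply: measurable_to_Sprime => x /=.
have mlin : measurable_fun [set: measurableTypeR R] (fun a : measurableTypeR R => pi *+ 2 * a : measurableTypeR R).
  by apply: measurable_funM; [exact: measurable_cst|exact: measurable_id].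
have trig (f : R -> R) : continuous f -> measurable_fun setT (fun a : measurableTypeR R => f (pi *+ 2 * a)).
  by move=> cf; apply: measurableT_comp mlin; exact: continuous_measurable_fun.
apply: measurable_funD; apply: measurable_funM; try exact: measurable_cst; apply: trig.
  exact: continuous_cos.
exact: continuous_sin.
Qed.

HB.instance Definition _ := isMeasurableFun.Build _ _ _ _ rotation_path measurable_rotation_path.

Definition rotation_law : probability (Sprime R C) R :=
  distribution (@circle_measure R) rotation_path.

Lemma rotation_lawE (A : set (Sprime R C)) :
  rotation_law A = circle_measure [set a | A (rotation_path a)].
Proof. by []. Qed.

Lemma rotation_path_periodic a : rotation_path (a + 1) = rotation_path a.
Proof.
apply: eval_Sprime_inj; apply/funext => x; rewrite /= /rotation mulrDr mulr1.
by rewrite cosD2pi sinD2pi.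
Qed.

(** On the path the semigroup acts as a translation of the parameter, which reduces invariance of
    the law to that of the circle measure. *)
Lemma heat_rotation_path t a : 0 <= t ->
  heat t (ev (rotation_path a)) = ev (rotation_path (a + om * t / (pi *+ 2))).
Proof.
move=> t0; have pi2 : pi *+ 2 != 0 :> R by rewrite mulrn_eq0/= gt_eqF// pi_gt0.
rewrite /= (heat_rotation hw K1 degK hp N0 xiN etaN lap_xi lap_eta)//.
by congr (rotation xi eta _); rewrite mulrDr mulrCA mulfV ?mulr1.
Qed.

Lemma rotation_law_invariant t (A : set (Sprime R C)) : 0 <= t -> measurable A ->
  rotation_law [set z | exists2 z', A z' & ev z' = heat t (ev z)] = rotation_law A.
Proof.
move=> t0 mA; rewrite !rotation_lawE.
pose B : set R := [set a | A (rotation_path a)].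
have mB : measurable (B : set (measurableTypeR R)).
  by have := measurable_rotation_path measurableT mA; rewrite setTI.
rewrite -[RHS](@lebesgue_measure_periodic R (om * t / (pi *+ 2)) B)//; last first.
  by move=> a; rewrite /B/= rotation_path_periodic.
congr (lebesgue_measure (_ `&` _)); apply/seteqP; split=> a /=.
  move=> [z Az Ez]; rewrite /B/= (_ : rotation_path _ = z)//.
  exact/eval_Sprime_inj/esym/(etrans Ez)/heat_rotation_path.
by move=> Aa; eexists; [exact: Aa|rewrite heat_rotation_path].
Qed.

Lemma rotation_law_moment : (\int[rotation_law]_z sqnormH N (ev z) < +oo)%E.
Proof.
have [Y Y0 YP] := rotation_bound xiN etaN.
have mnorm : measurable_fun setT (fun z : Sprime R C => sqnormH N (ev z)).
  by apply: measurable_sqnormH => x; exact: measurable_eval.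
rewrite (ge0_integral_pushforward measurable_rotation_path)//; last first.
  by move=> z _; exact: sqnormH_ge0.
apply: (@le_lt_trans _ _ (\int[@circle_measure R]_(a in [set: measurableTypeR R]) cst ((Y ^+ 2)%:E) a)%E).
  rewrite preimage_setT; apply: ge0_le_integral => //.
  - by move=> a _; exact: sqnormH_ge0.
  - exact: measurableT_comp mnorm measurable_rotation_path.
  - by move=> a _; exact: YP.
by rewrite integral_cst// [X in (_ * X)%E](circle_measure_setT R) mule1 ltry.
Qed.

(** If a rotation vanished, so would its Laplacian and, as [om != 0], the quarter turn. Rotating
    back, [xi] and [eta] would vanish. *)
Lemma rotation_neq0 a : exists x, rot a x != 0.
Proof.
apply: contrapT => none.
have z b : (forall x, rot b x = 0) -> forall x, rot (b + pi / 2) x = 0.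
  move=> rz x; have := lap_rotation lap_xi lap_eta b x.
  rewrite (_ : rot b = fun=> 0); last exact/funext.
  rewrite lap_cst => /esym/eqP; rewrite mulf_eq0 oppr_eq0 (negbTE om0)/= => /eqP //.
have ra x : rot a x = 0 by apply: contrapT => /eqP H; apply: none; exists x.
have rb := z _ ra.
have [x] := nonzero; rewrite /rotation in ra rb.
have := ra x; have := rb x; rewrite cosDpihalf sinDpihalf => E1 E2.
have cs := cos2Dsin2 a.
have -> : xi x = 0.
  transitivity ((cos a ^+ 2 + sin a ^+ 2) * xi x); first by rewrite cs mul1r.
  transitivity (cos a * (cos a * xi x + sin a * eta x) - sin a * (- sin a * xi x + cos a * eta x)); first ring.
  by rewrite E1 E2 !mulr0 subr0.
have -> : eta x = 0.
  transitivity ((cos a ^+ 2 + sin a ^+ 2) * eta x); first by rewrite cs mul1r.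
  transitivity (sin a * (cos a * xi x + sin a * eta x) + cos a * (- sin a * xi x + cos a * eta x)); first ring.
  by rewrite E1 E2 !mulr0 addr0.
by rewrite eqxx.
Qed.

(** At this time the rotation has turned by [pi] in one direction or the other and has changed sign,
    while it is not 0. *)
Lemma half_period_not_fixed a : heat (pi / `|om|) (ev (rotation_path a)) <> ev (rotation_path a).
Proof.
have T0 : 0 <= pi / `|om| by rewrite divr_ge0// pi_ge0.
rewrite /= (heat_rotation hw K1 degK hp N0 xiN etaN lap_xi lap_eta)// => E.
have [x /eqP] := rotation_neq0 (pi *+ 2 * a); apply.
move/(congr1 (fun f => f x)): E; rewrite rotationD.
have [-> ->] : cos (om * (pi / `|om|)) = -1 /\ sin (om * (pi / `|om|)) = 0.
  have [om_gt|om_lt|omz] := ltgtP om 0; last by have := om0; rewrite omz eqxx.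
    rewrite (ltr0_norm om_gt) (_ : om * _ = - pi); last by field; rewrite lt_eqF.
    by rewrite cosN sinN cospi sinpi oppr0.
  rewrite (gtr0_norm om_lt) (_ : om * _ = pi); last by field; rewrite gt_eqF.
  by rewrite cospi sinpi.
by rewrite mul0r addr0; lra.
Qed.

End RotationLaw.

Lemma eigenvector_real (R : realType) (d : nat) (C : set (Zd d)) (w : Zd d -> Zd d -> R)
    (lam : R[i]) (xi eta : C -> R) : complex.Re lam = 0 ->
  eigenvector w lam (fun x => (xi x +i* eta x)%C) ->
  [/\ exists x, (xi x != 0) || (eta x != 0),
    forall x, laplacian w xi x = - complex.Im lam * eta x &
    forall x, laplacian w eta x = complex.Im lam * xi x].
Proof.
case: lam => re om /= -> [[x0 nz] eig]; split.
- by exists x0; move: nz; rewrite eq_complex/= negb_and.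
- by move=> x; have /(congr1 (@complex.Re R)) := eig x; rewrite lap_complex/= mul0r sub0r mulNr.
- by move=> x; have /(congr1 (@complex.Im R)) := eig x; rewrite lap_complex/= mul0r add0r.
Qed.

Theorem theorem2p10 (R : realType) (d : nat) (hd : (1 <= d)%N)
    (w : Zd d -> Zd d -> R) (hw : conductances w)
    (C : set (Zd d)) (hC : unique (infinite_component w) C)
    (dO : measure_display) (Omega : measurableType dO)
    (P : C -> probability Omega R) (X : R -> Omega -> C)
    (hX : is_vsrw P X w)
    (hgrowth : quadratic_growth w) :
  (forall (rho : probability (Sprime R C) R) (N : R), 0 <= N ->
     (exists T : R, [/\ 0 < T, invariant_at P X rho T &
                        (rho (fixed_at P X T) < 1)%E]) ->
     moment_condition rho N ->
     has_imaginary_eigenvalue C w N) /\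
  (forall N : R, 0 <= N ->
     has_imaginary_eigenvalue C w N ->
     exists rho : probability (Sprime R C) R,
       [/\ exists T : R, [/\ 0 < T, invariant_at P X rho T &
                             (rho (fixed_at P X T) < 1)%E],
           moment_condition rho N,
           forall t : R, 0 <= t -> invariant_at P X rho t &
           rho [set xi | forall t : R, 0 <= t -> fixed_at P X t xi] = 0%E]).
Proof.
have [K K1 degK] := degree_growth C hw hgrowth.
have hp := vsrw_heat_kernel hX.
split=> [rho N N0 [T [T0 inv fixed]] mom|N N0 [lam [re0 lam0 [xi [eta [xiN etaN eig]]]]]].
  exact: (invariant_imaginary_eigenvalue hw K1 degK hp N0 T0 inv fixed mom).
have [nz lap_xi lap_eta] := eigenvector_real re0 eig.
have om0 : complex.Im lam != 0.
  by apply: contra lam0 => /eqP im0; rewrite eq_complex re0 im0 !eqxx.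
have pT : 0 < pi / `|complex.Im lam| by rewrite divr_gt0 ?pi_gt0// normr_gt0.
pose rho := rotation_law N0 xiN etaN.
have inv t : 0 <= t -> invariant_at P X rho t.
  by move=> t0 A mA; exact: (rotation_law_invariant hw K1 degK hp).
have nofix a : ~ fixed_at P X (pi / `|complex.Im lam|) (rotation_path N0 xiN etaN a).
  exact: (half_period_not_fixed hw K1 degK hp).
(* No point of the path is fixed at the half period, so the preimage of [F] in the circle is empty;
   this settles both the single time and the intersection over all [t]. *)
have null (F : set (Sprime R C)) : F `<=` fixed_at P X (pi / `|complex.Im lam|) -> rho F = 0%E.
  move=> FT; rewrite rotation_lawE (_ : [set a | _] = set0) ?measure0//.
  by apply/seteqP; split=> a //= /FT /nofix.
exists rho; split=> //.
- exists (pi / `|complex.Im lam|); split=> //; first exact/inv/ltW.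
  by rewrite null// lte01.
- exact: rotation_law_moment.
- by apply: null => z /(_ _ (ltW pT)).
Qed.
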